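(* There exists an extremiser for the Airy Strichartz inequality $\|e^{-t\partial_x^3} f\|_{L^8_{t,x}(\mathbb{R}\times\mathbb{R})}\le C\|f\|_{L^2(\mathbb{R})}$; that is, there exists $f\in L^2(\mathbb{R})$, not equal to the zero function a.e., such that $$\|e^{-t\partial_x^3} f\|_{L^8_{t,x}(\mathbb{R}\times \mathbb{R})} = \mathcal{A}\, \|f\|_{L^2(\mathbb{R})},$$ where $\mathcal{A}:=\sup\{\|e^{-t\partial_x^3}g\|_{L^8_{t,x}(\mathbb{R}\times\mathbb{R})}:\ g\in L^2(\mathbb{R}),\ \|g\|_{L^2}=1\}$.
   Context: Functions are complex-valued. The Fourier transform is normalized to be unitary on $L^2(\mathbb{R})$: $\widehat f(k)=(2\pi)^{-1/2}\int_{\mathbb{R}}e^{-ixk}f(x)\,dx$. For $f\in L^2(\mathbb{R})$ the Airy evolution is $$e^{-t\partial_x^3} f(x):=(2\pi)^{-1/2}\int_\mathbb{R} e^{ixk+itk^3}\widehat{f}(k)\,dk,$$ i.e. the solution of $\partial_t u+\partial_x^3u=0$, $u(0)=f$. It is known that the Airy Strichartz inequality $\|e^{-t\partial_x^3} f\|_{L^8_{t,x}(\mathbb{R}\times\mathbb{R})}\le C\|f\|_{L^2(\mathbb{R})}$ holds with a finite constant $C$, so $\mathcal{A}<\infty$. *)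

(* Defs.v *)
From HB Require Import structures.
From mathcomp Require Import all_boot all_order all_algebra.
From mathcomp Require Import complex.
From mathcomp Require Import all_classical all_reals all_analysis.

Set Implicit Arguments.
Unset Strict Implicit.
Unset Printing Implicit Defensive.

Import Order.TTheory GRing.Theory Num.Theory.
Import numFieldNormedType.Exports.

Local Open Scope classical_set_scope.
Local Open Scope complex_scope.
Local Open Scope ring_scope.

Definition cmeasurable_fun d (T : measurableType d) (R : realType)
    (f : T -> R[i]) : Prop :=
  measurable_fun [set: T] (fun x => complex.Re (f x)) /\
  measurable_fun [set: T] (fun x => complex.Im (f x)).

Definition cintegral d (T : measurableType d) (R : realType)
    (m : {measure set T -> \bar R}) (D : set T) (f : T -> R[i]) : R[i] :=
  Rintegral m D (fun x => complex.Re (f x)) +i*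
  Rintegral m D (fun x => complex.Im (f x)).

Definition cLnorm d (T : measurableType d) (R : realType)
    (m : {measure set T -> \bar R}) (p : R) (f : T -> R[i]) : \bar R :=
  Lnorm m p%:E (fun x => (Normc.normc (f x))%:E).

Section AiryEvolution.
Variable R : realType.
Local Notation mu := (@lebesgue_measure R).
Implicit Types f g : R -> R[i].

Definition expi (y : R) : R[i] := cos y +i* sin y.

Definition L2norm f : \bar R := cLnorm mu 2 f.

Definition memL2 f : Prop :=
  cmeasurable_fun (T := measurableTypeR R) f /\
  (L2norm f < +oo)%E.

Definition L2_limit (F : nat -> R -> R[i]) g : Prop :=
  memL2 g /\ L2norm (fun x => F n x - g x) @[n --> \oo] --> 0%E.

(* An integral over R of e^{i phase} times an L^2 function need not converge
   absolutely: as in Plancherel's theorem, it denotes the L^2-limit of the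
   integrals over [-n, n], which do. *)
Definition truncated_osc_integral (phase : R -> R -> R) f (n : nat) (y : R) :
    R[i] :=
  ((Num.sqrt (2 * pi))^-1)%:C *
  cintegral mu `[- n%:R, n%:R] (fun x => expi (phase y x) * f x).

Definition is_fourier f g : Prop :=
  L2_limit (truncated_osc_integral (fun k x => - (x * k)) f) g.

(* For f in L^2 such a g exists and is unique up to a null set (Plancherel). *)
Definition fourier f : R -> R[i] := xget (fun=> 0) [set g | is_fourier f g].

(* u is a function of the pair (t, x).  Each slice u(t, .) is only determined
   almost everywhere, so measurability in (t, x) has to be required in order
   to speak of the space-time norm; it makes u unique up to a null set. *)
Definition is_airy_evolution f (u : R * R -> R[i]) : Prop :=
  cmeasurable_fun (T := (measurableTypeR R * measurableTypeR R)%type) u /\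
  forall t : R,
    L2_limit
      (truncated_osc_integral (fun x k => x * k + t * k ^+ 3) (fourier f))
      (fun x => u (t, x)).

(* Such a u exists for f in L^2: the truncated integrals are continuous in
   (t, x) and converge in L^2(dx) uniformly in t. *)
Definition airy f : R * R -> R[i] :=
  xget (fun=> 0) [set u | is_airy_evolution f u].

Definition L8norm (u : R * R -> R[i]) : \bar R := cLnorm (mu \x mu)%E 8 u.

Definition airy_const : \bar R :=
  ereal_sup [set L8norm (airy g) | g in [set g | memL2 g /\ L2norm g = 1%E]].

End AiryEvolution.

Arguments airy_const : clear implicits.

(* Main.v *)
Require Import Defs.
From HB Require Import structures.
From mathcomp Require Import all_boot all_order all_algebra.
From mathcomp Require Import complex.
From mathcomp Require Import all_classical all_reals all_analysis.
From mathcomp Require Import measurable_realfun.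
From mathcomp Require Import ring lra zify.

Set Implicit Arguments.
Unset Strict Implicit.
Unset Printing Implicit Defensive.

Import Order.TTheory GRing.Theory Num.Theory.
Import numFieldNormedType.Exports.

Local Open Scope classical_set_scope.
Local Open Scope ring_scope.

Local Notation Rep := (@complex.Re _).
Local Notation Imp := (@complex.Im _).

(* By Plancherel the problem is to maximise |E h|_8 over |h|_2 = 1, where
   E h(t, x) is the integral of exp(i(xk + tk^3)) h(k) dk. A refined Strichartz
   inequality, obtained from the bilinear estimate with weight |k^2 - k'^2|^-1
   by a layer-cake decomposition, shows that |E h|_8 is small unless some
   integral of exp(i(xk + tk^3)) h(k) over |k| < N is at least of order
   N^(1/2). Dilations and translations move this concentration to N = 1,
   t = x = 0, so a maximising sequence h_n can be chosen with a non-zero weak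
   limit h. Kato smoothing makes E h_n converge to E h in L^2 on bounded boxes
   of space-time, and a Brezis-Lieb argument yields, with A the supremum of
   |E h|_8^8 and a = |h|_2^2,
     A <= |E h|_8^8 + A (1 - a)^4 <= A (a^4 + (1 - a)^4),
   which forces a = 1 and |E h|_8^8 = A. *)

(** * Square-integrable functions *)

Section square_integrable.
Context d (T : measurableType d) (R : realType) (m : {measure set T -> \bar R}).
Implicit Types f g : T -> R.

Definition rint f := m.-integrable setT (EFin \o f).

Definition sqint f : Prop := measurable_fun setT f /\ rint (fun x => f x ^+ 2).

Definition nsq f : R := \int[m]_x (f x ^+ 2).
Definition ip f g : R := \int[m]_x (f x * g x).

Lemma rint_EFin f : rint f -> (\int[m]_x (f x)%:E)%E = (\int[m]_x f x)%:E.
Proof. by move=> fi; rewrite fineK//; exact: integrable_fin_num. Qed.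

Lemma rint_le f g : measurable_fun setT f -> rint g ->
  (forall x, `|f x| <= g x) -> rint f.
Proof.
move=> mf gi fg; apply: le_integrable gi => //; first exact/measurable_EFinP.
by move=> x _ /=; rewrite lee_fin (le_trans (fg x))// ler_norm.
Qed.

Lemma rint_ge0 f : measurable_fun setT f -> (forall x, 0 <= f x) ->
  (\int[m]_x (f x)%:E < +oo)%E -> rint f.
Proof.
move=> mf f0 fi; apply/integrableP; split; first exact/measurable_EFinP.
by under eq_integral do rewrite /= ger0_norm//.
Qed.

Lemma rintD f g : rint f -> rint g -> rint (fun x => f x + g x).
Proof.
move=> fi gi; rewrite /rint (_ : _ \o _ = (EFin \o f) \+ (EFin \o g))%E//.
exact: integrableD.
Qed.

Lemma rintZ k f : rint f -> rint (fun x => k * f x).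
Proof.
move=> fi; rewrite /rint (_ : _ \o _ = fun x => k%:E * (EFin \o f) x)%E//.
exact: integrableZl.
Qed.

Lemma rintN f : rint f -> rint (fun x => - f x).
Proof. by move=> /(rintZ (-1)); under [X in rint X -> _]eq_fun do rewrite mulN1r. Qed.

Lemma rintB f g : rint f -> rint g -> rint (fun x => f x - g x).
Proof. by move=> fi /rintN; exact: rintD. Qed.

Lemma rint_meas f : rint f -> measurable_fun setT f.
Proof. by move=> /measurable_int /measurable_EFinP. Qed.

Lemma rint_abs f : rint f -> rint (fun x => `|f x|).
Proof.
by move=> fi; exact: integrable_norm.
Qed.

Lemma sqint_mul f g : sqint f -> sqint g -> rint (fun x => f x * g x).
Proof.
move=> [mf fi] [mg gi]; apply: (rint_le _ (rintD fi gi)).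
  exact: measurable_funM.
move=> x; rewrite ler_norml; apply/andP; split.
  have := sqr_ge0 (f x + g x); nra.
have := sqr_ge0 (f x - g x); nra.
Qed.

Lemma sqintD f g : sqint f -> sqint g -> sqint (fun x => f x + g x).
Proof.
move=> Hf Hg; split; first by apply: measurable_funD; [case: Hf|case: Hg].
have -> : (fun x => (f x + g x) ^+ 2) = fun x => f x ^+ 2 + (2 * (f x * g x) + g x ^+ 2).
  by apply/funext => x; ring.
apply: rintD; first by case: Hf.
by apply: rintD; [apply: rintZ; exact: sqint_mul|case: Hg].
Qed.

Lemma sqintZ k f : sqint f -> sqint (fun x => k * f x).
Proof.
move=> [mf fi]; split; first exact: measurable_funM.
have -> : (fun x => (k * f x) ^+ 2) = fun x => k ^+ 2 * f x ^+ 2.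
  by apply/funext => x; ring.
exact: rintZ.
Qed.

Lemma sqintB f g : sqint f -> sqint g -> sqint (fun x => f x - g x).
Proof.
move=> Hf Hg; have := sqintD Hf (sqintZ (-1) Hg).
by under [X in sqint X -> _]eq_fun do rewrite mulN1r.
Qed.

Lemma sqint0 : sqint (fun=> 0).
Proof.
split => //; rewrite /rint (_ : _ \o _ = cst 0%E); first exact: integrable0.
by apply/funext => x /=; rewrite expr0n.
Qed.

Lemma nsq_ge0 f : 0 <= nsq f.
Proof. by apply: Rintegral_ge0 => x _; exact: sqr_ge0. Qed.

Lemma nsqE f : sqint f -> (\int[m]_x (f x ^+ 2)%:E)%E = (nsq f)%:E.
Proof. by move=> [_ /rint_EFin]. Qed.

Lemma sqintP f : measurable_fun setT f ->
  (\int[m]_x (f x ^+ 2)%:E < +oo)%E -> sqint f.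
Proof.
move=> mf fi; split=> //; apply: rint_ge0 => // [|x]; last exact: sqr_ge0.
exact: measurable_funX.
Qed.

Lemma RintD f g : rint f -> rint g ->
  \int[m]_x (f x + g x) = \int[m]_x f x + \int[m]_x g x.
Proof. by move=> fi gi; rewrite RintegralD. Qed.

Lemma RintB f g : rint f -> rint g ->
  \int[m]_x (f x - g x) = \int[m]_x f x - \int[m]_x g x.
Proof. by move=> fi gi; rewrite RintegralB. Qed.

Lemma RintZ k f : rint f -> \int[m]_x (k * f x) = k * \int[m]_x f x.
Proof. by move=> fi; rewrite RintegralZl. Qed.

Lemma Rint_le f g : rint f -> rint g -> (forall x, f x <= g x) ->
  \int[m]_x f x <= \int[m]_x g x.
Proof. by move=> fi gi fg; apply: le_Rintegral => // x _; exact: fg. Qed.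

Lemma Rint_abs f : rint f -> `|\int[m]_x f x| <= \int[m]_x `|f x|.
Proof. by move=> fi; exact: le_normr_Rintegral. Qed.

Lemma eq_Rint f g : f =1 g -> \int[m]_x f x = \int[m]_x g x.
Proof. by move=> fg; congr fine; apply: eq_integral => x _; rewrite fg. Qed.

Lemma ipC f g : ip f g = ip g f.
Proof. by apply: eq_Rint => x; rewrite mulrC. Qed.

Lemma ipDr f g h : sqint f -> sqint g -> sqint h ->
  ip f (fun x => g x + h x) = ip f g + ip f h.
Proof.
move=> Hf Hg Hh; rewrite /ip -RintD; [|exact: sqint_mul|exact: sqint_mul].
by apply: eq_Rint => x; rewrite mulrDr.
Qed.

Lemma ipZr f g k : sqint f -> sqint g -> ip f (fun x => k * g x) = k * ip f g.
Proof.
move=> Hf Hg; rewrite /ip -RintZ; last exact: sqint_mul.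
by apply: eq_Rint => x; ring.
Qed.

Lemma nsqD f g : sqint f -> sqint g ->
  nsq (fun x => f x + g x) = nsq f + 2 * ip f g + nsq g.
Proof.
move=> Hf Hg; rewrite /nsq /ip -RintZ; last exact: sqint_mul.
rewrite -RintD; [|by case: Hf|by apply: rintZ; exact: sqint_mul].
rewrite -RintD; [|apply: rintD; [by case: Hf|by apply: rintZ; exact: sqint_mul]|by case: Hg].
by apply: eq_Rint => x; ring.
Qed.

Lemma nsqZ f k : sqint f -> nsq (fun x => k * f x) = k ^+ 2 * nsq f.
Proof.
move=> Hf; rewrite /nsq -RintZ; last by case: Hf.
by apply: eq_Rint => x; ring.
Qed.

Lemma nsqB f g : sqint f -> sqint g ->
  nsq (fun x => f x - g x) = nsq f - 2 * ip f g + nsq g.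
Proof.
move=> Hf Hg.
have -> : (fun x => f x - g x) = (fun x => f x + (-1) * g x).
  by apply/funext => x; ring.
by rewrite nsqD//; [rewrite ipZr// nsqZ//; ring|exact: sqintZ].
Qed.

Lemma cauchy_schwarz f g : sqint f -> sqint g -> ip f g ^+ 2 <= nsq f * nsq g.
Proof.
move=> Hf Hg.
have H s : 0 <= nsq f + 2 * s * ip f g + s ^+ 2 * nsq g.
  have := nsq_ge0 (fun x => f x + s * g x).
  by rewrite nsqD//; [rewrite ipZr// nsqZ//; rewrite mulrA|exact: sqintZ].
have [g0|g0] := eqVneq (nsq g) 0.
  have [->|f0] := eqVneq (ip f g) 0; first by rewrite expr0n/= g0 mulr0.
  have := H (- (nsq f + 1) / (2 * ip f g)).
  rewrite g0 mulr0 addr0.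
  have -> : 2 * (- (nsq f + 1) / (2 * ip f g)) * ip f g = - (nsq f + 1) by field.
  by lra.
have gp : 0 < nsq g by rewrite lt_neqAle eq_sym g0 nsq_ge0.
have := H (- ip f g / nsq g).
have -> : nsq f + 2 * (- ip f g / nsq g) * ip f g + (- ip f g / nsq g) ^+ 2 * nsq g =
  nsq f - ip f g ^+ 2 / nsq g by field.
by rewrite subr_ge0 ler_pdivrMr.
Qed.

End square_integrable.

Section completeness.
Context (R : realType).

Lemma fast_cauchy_cvg (u : nat -> R) (s : R) : 0 <= s ->
  (forall j, `|u j.+1 - u j| <= s * 2^-1 ^+ j) ->
  exists2 l, u @ \oo --> l & forall j, `|u j - l| <= 2 * s * 2^-1 ^+ j.
Proof.
move=> s0 us.
have h0 j : 0 <= (2^-1 : R) ^+ j by rewrite exprn_ge0.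
have bnd j k : `|u (j + k)%N - u j| <= 2 * s * 2^-1 ^+ j * (1 - 2^-1 ^+ k).
  elim: k => [|k IH]; first by rewrite addn0 !subrr normr0 mulr0.
  rewrite addnS -(subrKC (u (j + k)%N) (u (j + k).+1)) addrAC.
  rewrite (le_trans (ler_normD _ _))//.
  rewrite (le_trans (lerD IH (us _)))// exprD exprS.
  by rewrite le_eqVlt; apply/orP; left; apply/eqP; field.
have bnd2 j n : (j <= n)%N -> `|u n - u j| <= 2 * s * 2^-1 ^+ j.
  move=> jn; rewrite -(subnKC jn) (le_trans (bnd _ _))// ler_piMr//.
    by rewrite !mulr_ge0.
have cu : cvgn u.
  apply: cauchy_cvg; apply: cauchy_exP => e e0.
  have : (fun j => 2 * s * 2^-1 ^+ j) @ \oo --> (2 * s * 0 : R).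
    by apply: cvgMr; apply: cvg_expr; rewrite ger0_norm// invf_lt1// ltr1n.
  rewrite mulr0 => /cvgrPdist_lt /(_ _ e0)[N _ HN].
  exists (u N); exists N => // n /= Nn.
  have := HN N (leqnn N); rewrite /= sub0r normrN ger0_norm ?mulr_ge0// => lt1.
  by rewrite /ball/= distrC (le_lt_trans (bnd2 _ _ Nn)).
exists (limn u); first exact: cu.
move=> j; rewrite distrC.
have : `|u n - u j| @[n --> \oo] --> `|limn u - u j|.
  by apply: cvg_norm; apply: cvgB => //; exact: cvg_cst.
move=> /cvgP /[dup] /= c1 c2.
have -> : `|limn u - u j| = limn (fun n => `|u n - u j|).
  by apply/esym/cvg_lim => //; apply: cvg_norm; apply: cvgB => //; exact: cvg_cst.
apply: limr_le => //; near=> n; apply: bnd2; near: n; exact: nbhs_infty_ge.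
Unshelve. all: by end_near. Qed.

End completeness.

Section fast_L2.
Context d (T : measurableType d) (R : realType) (m : {measure set T -> \bar R}).
Implicit Types f g : T -> R.

Definition flim (f : nat -> T -> R) (x : T) : R :=
  fine (limn_esup (fun j => (f j x)%:E)).

Lemma measurable_flim (f : nat -> T -> R) :
  (forall j, measurable_fun setT (f j)) -> measurable_fun setT (flim f).
Proof.
move=> mf; apply: measurableT_comp => //.
by apply: measurable_fun_limn_esup => j; exact/measurable_EFinP.
Qed.

Lemma flimE (f : nat -> T -> R) x l : f ^~ x @ \oo --> l -> flim f x = l.
Proof.
move=> fl; have /cvg_limn_einf_sup[_] : (f j x)%:E @[j --> \oo] --> l%:E.
  by apply: cvg_EFin => //; exact: nearW.
by rewrite /flim => ->.
Qed.

Lemma fast_L2_cvg (f : nat -> T -> R) : (forall j, sqint m (f j)) ->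
  (forall j, nsq m (fun x => f j.+1 x - f j x) <= 16^-1 ^+ j) ->
  [/\ sqint m (flim f),
    forall j, nsq m (fun x => f j x - flim f x) <= 8 * 4^-1 ^+ j &
    {ae m, forall x, f ^~ x @ \oo --> flim f x}].
Proof.
move=> sf df.
pose dd j x := f j.+1 x - f j x.
have sd j : sqint m (dd j) by exact: sqintB.
have md j : measurable_fun setT (fun x => (4 ^+ j * dd j x ^+ 2)%:E : \bar R).
  by apply/measurable_EFinP; apply: measurable_funM => //; apply: measurable_funX; case: (sd j).
pose G x := (\sum_(0 <= j <oo) (4 ^+ j * dd j x ^+ 2)%:E)%E.
have d0 j x : (0 <= (4 ^+ j * dd j x ^+ 2)%:E)%E.
  by rewrite lee_fin; apply: mulr_ge0; [exact: exprn_ge0|exact: sqr_ge0].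
have G0 x : (0 <= G x)%E by apply: nneseries_ge0 => j _ _.
have mG : measurable_fun setT G by apply: ge0_emeasurable_sum.
have IG : (\int[m]_x G x <= 2%:E)%E.
  rewrite integral_nneseries//.
  have le1 j : (\int[m]_x (4 ^+ j * dd j x ^+ 2)%:E <= (2^-1 ^+ j)%:E)%E.
    rewrite rint_EFin; last by apply: rintZ; case: (sd j).
    rewrite RintZ; last by case: (sd j).
    rewrite lee_fin (le_trans (ler_wpM2l _ (df j)))//.
    rewrite -exprMn (_ : 4 * 16^-1 = 4^-1); last by field.
    by rewrite lerXn2r ?nnegrE// lef_pV2 ?posrE// ler_nat.
  apply: (@le_trans _ _ (\sum_(0 <= j <oo) (2^-1 ^+ j)%:E)%E).
    by apply: lee_nneseries => // j _ _; exact: integral_ge0.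
  have -> : (fun n => \sum_(0 <= j < n) (2^-1 ^+ j)%:E)%E =
      (fun n => (series (geometric (1 : R) 2^-1) n)%:E).
    apply/funext => n; rewrite sumEFin; congr EFin.
    by apply: eq_bigr => i _; rewrite /= mul1r.
  have c : series (geometric (1 : R) 2^-1) @ \oo --> ((1 - 2^-1)^-1 : R).
    rewrite -[X in _ --> X]mul1r.
    by apply: cvg_geometric_series; rewrite ger0_norm// invf_lt1// ltr1n.
  have cE : (series (geometric (1 : R) 2^-1) n)%:E @[n --> \oo] --> ((1 - 2^-1)^-1 : R)%:E.
    by apply: cvg_EFin => //; exact: nearW.
  rewrite (cvg_lim _ cE)// lee_fin.
  by rewrite (_ : 1 - 2^-1 = 2^-1) ?invrK//; field.
have Gi : m.-integrable setT G.
  apply/integrableP; split=> //.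
  by under eq_integral do rewrite gee0_abs//; rewrite (le_lt_trans IG)// ltry.
have Gfin := integrable_ae measurableT Gi.
have key x : G x \is a fin_num ->
    f ^~ x @ \oo --> flim f x /\
    forall j, (f j x - flim f x) ^+ 2 <= 4 * 4^-1 ^+ j * fine (G x).
  move=> Gx.
  have s0 : 0 <= Num.sqrt (fine (G x)) by exact: sqrtr_ge0.
  have [|l fl fb] := @fast_cauchy_cvg R (f ^~ x) _ s0.
    move=> j; have h : 4 ^+ j * dd j x ^+ 2 <= fine (G x).
      rewrite -lee_fin fineK//; apply: (le_trans _ (nneseries_lim_ge j.+1 _)) => //.
      by rewrite big_nat_recr//= leeDr// sume_ge0.
    rewrite -/(dd j x) -(ler_pXn2r (n := 2)) ?nnegrE ?mulr_ge0 ?exprn_ge0//.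
    rewrite exprMn sqr_sqrtr ?fine_ge0// real_normK ?num_real//.
    have -> : (2^-1 ^+ j) ^+ 2 = (4 ^+ j)^-1 :> R.
      rewrite -exprM mulnC exprM -exprVn; congr (_ ^+ j).
      by rewrite expr2 -invfM; congr (_^-1); ring.
    by rewrite ler_pdivlMr ?exprn_gt0// mulrC.
  split; first by rewrite (flimE fl).
  move=> j; rewrite (flimE fl).
  have := fb j; rewrite -(ler_pXn2r (n := 2)) ?nnegrE ?mulr_ge0 ?exprn_ge0//.
  rewrite real_normK ?num_real// => /le_trans; apply.
  rewrite !exprMn sqr_sqrtr ?fine_ge0// -exprM mulnC exprM.
  rewrite (_ : 2^-1 ^+ 2 = 4^-1 :> R); last by field.
  by rewrite le_eqVlt; apply/orP; left; apply/eqP; ring.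
have mfl : measurable_fun setT (flim f).
  by apply: measurable_flim => j; case: (sf j).
have IB j : (\int[m]_x ((f j x - flim f x) ^+ 2)%:E <= (8 * 4^-1 ^+ j)%:E)%E.
  apply: (@le_trans _ _ (\int[m]_x ((4 * 4^-1 ^+ j)%:E * G x))%E).
    apply: ae_ge0_le_integral => //.
    - by move=> x _; rewrite lee_fin sqr_ge0.
    - apply/measurable_EFinP; apply: measurable_funX; apply: measurable_funB => //.
      by case: (sf j).
    - by move=> x _; rewrite mule_ge0// lee_fin mulr_ge0// exprn_ge0.
    - by apply: emeasurable_funM.
    - apply: filterS Gfin => x /(_ Logic.I) Gx _.
      by rewrite -(fineK Gx) lee_fin; exact: (key x Gx).2.
  rewrite ge0_integralZl_EFin//.
  apply: (@le_trans _ _ ((4 * 4^-1 ^+ j)%:E * 2%:E)%E).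
    by apply: lee_wpmul2l => //; rewrite lee_fin mulr_ge0// exprn_ge0.
  by rewrite -EFinM lee_fin mulrAC ler_pM2r ?exprn_gt0//; lra.
have sl j : sqint m (fun x => f j x - flim f x).
  apply: sqintP; last by rewrite (le_lt_trans (IB j))// ltry.
  by apply: measurable_funB => //; case: (sf j).
split.
- have := sqintB (sf 0%N) (sl 0%N).
  by rewrite (_ : (fun x => _) = flim f)//; apply/funext => x; ring.
- by move=> j; rewrite -lee_fin -nsqE.
- by apply: filterS Gfin => x /(_ Logic.I) Gx; exact: (key x Gx).1.
Qed.

End fast_L2.

Section riesz.
Context d (T : measurableType d) (R : realType) (m : {measure set T -> \bar R}).
Implicit Types f g : T -> R.

Lemma quadratic_ge0 (p q : R) : (forall s : R, 0 <= s * p + s ^+ 2 * q) -> p = 0.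
Proof.
move=> H; apply/eqP/negPn/negP => p0.
have q0 : 0 <= q by have := H 1; have := H (-1); lra.
have := H (- p / (q + 1)).
have -> : - p / (q + 1) * p + (- p / (q + 1)) ^+ 2 * q = - (p / (q + 1)) ^+ 2.
  by field; lra.
rewrite oppr_ge0 => h; have : (p / (q + 1)) ^+ 2 == 0 by rewrite eq_le h sqr_ge0.
by rewrite sqrf_eq0 mulf_eq0 (negbTE p0)/= invr_eq0; lra.
Qed.

Lemma ip_cvg (f : nat -> T -> R) g h : (forall j, sqint m (f j)) -> sqint m g ->
  sqint m h -> (fun j => nsq m (fun x => f j x - g x)) @ \oo --> (0 : R) ->
  (fun j => ip m (f j) h) @ \oo --> ip m g h.
Proof.
move=> sf sg sh fg; apply/cvgrPdist_lt => e e0.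
have c : (fun j => nsq m (fun x => f j x - g x) * nsq m h) @ \oo --> (0 : R).
  by rewrite -(mul0r (nsq m h)); apply: cvgM => //; exact: cvg_cst.
have e20 : 0 < e ^+ 2 by rewrite exprn_gt0.
move/cvgrPdist_lt : c => /(_ _ e20); apply: filterS => j; rewrite sub0r normrN => lt1.
have -> : ip m g h - ip m (f j) h = - ip m h (fun x => f j x - g x).
  rewrite (_ : (fun x => f j x - g x) = (fun x => f j x + (-1) * g x)).
    rewrite ipDr//; last exact: sqintZ.
    by rewrite ipZr// (ipC m h (f j)) (ipC m h g); ring.
  by apply/funext => x; ring.
rewrite normrN -(ltr_pXn2r (n := 2)) ?nnegrE ?(ltW e0)// real_normK ?num_real//.
apply: le_lt_trans lt1.
rewrite ger0_norm ?mulr_ge0 ?nsq_ge0//.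
by rewrite mulrC; apply: cauchy_schwarz => //; exact: sqintB.
Qed.

(* The functional g |-> |g|^2 - 2 L g is minimised; the parallelogram law makes
   a minimising sequence Cauchy. *)
Lemma riesz (L : (T -> R) -> R) (M : R) : 0 <= M ->
  (forall f g, sqint m f -> sqint m g -> L (fun x => f x + g x) = L f + L g) ->
  (forall k f, sqint m f -> L (fun x => k * f x) = k * L f) ->
  (forall f, sqint m f -> L f ^+ 2 <= M * nsq m f) ->
  exists2 f, sqint m f & forall g, sqint m g -> ip m f g = L g.
Proof.
move=> M0 LD LZ LM.
pose J g := nsq m g - 2 * L g.
have Jlb g : sqint m g -> - M <= J g.
  move=> sg; have := LM _ sg; have := nsq_ge0 m g; rewrite /J.
  move: (nsq m g) (L g) => a l a0 la.
  rewrite leNgt; apply/negP => h.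
  have h1 : a + M < 2 * l by lra.
  have h2 : 0 <= a + M by lra.
  have h3 : (a + M) ^+ 2 < (2 * l) ^+ 2 by rewrite ltr_pXn2r// nnegrE; lra.
  by have := sqr_ge0 (a - M); nra.
pose S := [set J g | g in [set g | sqint m g]].
have S0 : has_inf S.
  split; first by exists (J (fun=> 0)), (fun=> 0) => //; exact: sqint0.
  by exists (- M) => _ [g sg <-]; exact: Jlb.
have Jinf g : sqint m g -> inf S <= J g.
  by move=> sg; apply: ge_inf; [case: S0|exists g].
have /choice[g gP] : forall j, exists g, sqint m g /\ J g < inf S + 16^-1 ^+ j / 4.
  move=> j; have e0 : (0 : R) < 16^-1 ^+ j / 4 by rewrite divr_gt0// exprn_gt0.
  by have [_ [g sg <-] lt1] := inf_adherent e0 S0; exists g.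
have sg j := (gP j).1.
have par j : nsq m (fun x => g j.+1 x - g j x) <= 16^-1 ^+ j.
  have sD := sqintD (sg j) (sg j.+1).
  have := Jinf _ (sqintZ 2^-1 sD).
  rewrite /J nsqZ// LZ// nsqD// LD// nsqB//.
  have := (gP j).2; have := (gP j.+1).2; rewrite /J.
  have h0 : (0 : R) <= 16^-1 ^+ j by rewrite exprn_ge0.
  rewrite exprS ipC; move: (16^-1 ^+ j : R) h0 => z h0.
  by nra.
have [sf f_nsq _] := fast_L2_cvg sg par.
set f := flim g in sf f_nsq.
have gf : (fun j => nsq m (fun x => g j x - f x)) @ \oo --> (0 : R).
  have c : (fun j => 8 * 4^-1 ^+ j) @ \oo --> (8 * 0 : R).
    by apply: cvgMr; apply: cvg_expr; rewrite ger0_norm// invf_lt1// ltr1n.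
  rewrite mulr0 in c.
  apply: squeeze_cvgr c; last exact: cvg_cst.
  by near=> j; rewrite nsq_ge0 f_nsq.
exists f => // h sh; apply/eqP; rewrite -subr_eq0; apply/eqP.
have H s : 0 <= s * (2 * (ip m f h - L h)) + s ^+ 2 * nsq m h.
  have c1 : (fun j => s * (2 * (ip m (g j) h - L h)) + s ^+ 2 * nsq m h +
      16^-1 ^+ j / 4) @ \oo -->
      (s * (2 * (ip m f h - L h)) + s ^+ 2 * nsq m h + 0 / 4 : R).
    apply: cvgD; last first.
      apply: cvgMl; apply: cvg_expr; rewrite ger0_norm// invf_lt1// ltr1n//.
    apply: cvgD; last exact: cvg_cst.
    apply: cvgMr; apply: cvgMr; apply: cvgB; last exact: cvg_cst.
    exact: ip_cvg.
  rewrite mul0r addr0 in c1.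
  rewrite -(cvg_lim _ c1)//; apply: limr_ge; first by apply/cvg_ex; eexists; exact: c1.
  near=> j.
  have := Jinf _ (sqintD (sg j) (sqintZ s sh)); have := (gP j).2.
  rewrite /J nsqD// ?LD// ?LZ// ?nsqZ// ?ipZr//; try exact: sqintZ.
  by move: (16^-1 ^+ j : R) => z; nra.
have := quadratic_ge0 H; lra.
Unshelve. all: by end_near. Qed.

Lemma ultra_bounded_cvg (U : set_system nat) (UU : UltraFilter U) (u : nat -> R) (M : R) :
  (forall n, `|u n| <= M) -> exists l : R, u @ U --> l.
Proof.
move=> uM.
have := @segment_compact R (- M) M.
have PU : ProperFilter U by exact: ultra_proper.
move=> /(_ (u @ U) _)[|l [_ cl]].
  by apply: nearW => n /=; rewrite in_itv/= -ler_norml.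
exists l; move=> V nV.
have [//|UV] := in_ultra_setVsetC (u @^-1` V) UU.
have [x [/= nx Vx]] := cl (~` V) V UV nV.
by [].
Qed.

Lemma weak_limit (U : set_system nat) (UU : UltraFilter U) (a : nat -> T -> R) (M : R) :
  (forall n, sqint m (a n)) -> (forall n, nsq m (a n) <= M) ->
  exists2 f, sqint m f &
    forall g, sqint m g -> (fun n => ip m (a n) g) @ U --> ip m f g.
Proof.
move=> sa aM.
have PU : ProperFilter U by exact: ultra_proper.
have M0 : 0 <= M by rewrite (le_trans _ (aM 0%N))// nsq_ge0.
have ex g : sqint m g -> exists l : R, (fun n => ip m (a n) g) @ U --> l.
  move=> sg; apply: (@ultra_bounded_cvg _ _ _ (M * nsq m g + 1)) => n.
  have := cauchy_schwarz (sa n) sg.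
  have := ler_wpM2r (nsq_ge0 m g) (aM n).
  rewrite -(real_normK (num_real (ip m (a n) g))).
  have := normr_ge0 (ip m (a n) g); have := mulr_ge0 M0 (nsq_ge0 m g).
  move: (M * nsq m g) `|ip m (a n) g| (nsq m (a n) * nsq m g) => x y z.
  by nra.
pose L g := lim ((fun n => ip m (a n) g) @ U).
have LP g : sqint m g -> (fun n => ip m (a n) g) @ U --> L g.
  by move=> /ex[l hl]; apply: cvgP hl.
have [//|f g sf sg|k f sf|f sf|f sf fL] := @riesz L M.
- apply/cvg_lim => //; rewrite (_ : (fun n => _) = (fun n => ip m (a n) f + ip m (a n) g)).
    by apply: cvgD; exact: LP.
  by apply/funext => n; rewrite ipDr.
- apply/cvg_lim => //; rewrite (_ : (fun n => _) = (fun n => k * ip m (a n) f)).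
    by apply: cvgMr; exact: LP.
  by apply/funext => n; rewrite ipZr.
- have c : (fun n => ip m (a n) f ^+ 2) @ U --> L f ^+ 2.
    by rewrite expr2; under eq_fun do rewrite expr2; apply: cvgM; exact: LP.
  rewrite -(cvg_lim _ c)//; apply: limr_le; first by apply/cvg_ex; eexists; exact: c.
  apply: nearW => n; rewrite (le_trans (cauchy_schwarz _ _))//.
  by rewrite ler_wpM2r ?nsq_ge0.
- by exists f => // g sg; rewrite fL//; exact: LP.
Qed.

End riesz.

(** * Fubini's theorem for real integrals *)

Section fubini_real.
Context d1 d2 (T1 : measurableType d1) (T2 : measurableType d2) (R : realType).
Variable m1 : {sigma_finite_measure set T1 -> \bar R}.
Variable m2 : {sigma_finite_measure set T2 -> \bar R}.

Lemma rint_prod (f : T1 -> R) (g : T2 -> R) : rint m1 f -> rint m2 g ->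
  rint (m1 \x m2)%E (fun z => f z.1 * g z.2).
Proof.
move=> fi gi; have mf := rint_meas fi; have mg := rint_meas gi.
have mfg : measurable_fun setT (fun z : T1 * T2 => f z.1 * g z.2).
  by apply: measurable_funM; apply: measurableT_comp.
apply/integrable12ltyP; first exact/measurable_EFinP.
have /integrableP[_ fl] := fi; have /integrableP[_ gl] := gi.
under eq_integral => x _.
  under eq_integral => y _ do rewrite /= normrM EFinM.
  rewrite ge0_integralZl_EFin//; last 1 first.
    by apply/measurable_EFinP; exact: measurableT_comp.
  over.
rewrite ge0_integralZr//; last 2 first.
- by apply/measurable_EFinP; exact: measurableT_comp.
- exact: integral_ge0.
by rewrite lte_mul_pinfty// ?integral_ge0//; rewrite ge0_fin_numE// integral_ge0.
Qed.

Variable F : T1 * T2 -> R.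

Lemma measurable_Rint1 : measurable_fun setT F ->
  measurable_fun setT (fun x => \int[m2]_y F (x, y)).
Proof.
move=> mF; apply: measurableT_comp => //.
rewrite (_ : (fun x => _) = (fun x => \int[m2]_y (EFin \o F)^\+ (x, y)) \-
  (fun x => \int[m2]_y (EFin \o F)^\- (x, y)))%E; last first.
  apply/funext => x; rewrite [LHS]integralE /=.
  by congr (_ - _)%E; apply: eq_integral => y _; rewrite ?funeposE ?funenegE.
have mE : measurable_fun setT (EFin \o F) by exact/measurable_EFinP.
apply: emeasurable_funB; apply: measurable_fun_fubini_tonelli_F => //.
  exact: measurable_funepos.
exact: measurable_funeneg.
Qed.

Hypothesis Fi : rint (m1 \x m2)%E F.

Let H1 : m1.-integrable setT (fubini_F m2 (EFin \o F)).
Proof. exact: integrable_fubini_F. Qed.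

Lemma rint_Rint1 : rint m1 (fun x => \int[m2]_y F (x, y)).
Proof.
have h := H1; apply/integrableP; split.
  by apply/measurable_EFinP; apply: measurable_Rint1; exact: rint_meas Fi.
have /integrableP[_] := h; apply: le_lt_trans.
apply: ae_ge0_le_integral => //.
- apply: measurableT_comp => //; apply/measurable_EFinP.
  by apply: measurable_Rint1; exact: rint_meas Fi.
- by apply: measurableT_comp => //; have /integrableP[] := h.
- apply: filterS (integrable_ae measurableT h) => x /(_ Logic.I) xf _.
  by rewrite -(fineK xf).
Qed.

Lemma Rint_fubini1 : \int[(m1 \x m2)%E]_z F z = \int[m1]_x \int[m2]_y F (x, y).
Proof.
congr fine; rewrite -(integral12_prod_meas1 Fi); apply: ae_eq_integral => //.
- by have /integrableP[] := H1.
- by apply/measurable_EFinP; apply: measurable_Rint1; exact: rint_meas Fi.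
- apply: filterS (integrable_ae measurableT H1) => x /(_ Logic.I) xf _.
  by rewrite -(fineK xf).
Qed.

End fubini_real.

Section fubini_real2.
Context d1 d2 (T1 : measurableType d1) (T2 : measurableType d2) (R : realType).
Variable m1 : {sigma_finite_measure set T1 -> \bar R}.
Variable m2 : {sigma_finite_measure set T2 -> \bar R}.
Variable F : T1 * T2 -> R.
Hypothesis Fi : rint (m1 \x m2)%E F.

Let H2 : m2.-integrable setT (fubini_G m1 (EFin \o F)).
Proof.
have mF : measurable_fun setT (EFin \o F) by apply/measurable_EFinP; exact: rint_meas Fi.
apply/integrableP; split; first exact: (measurable_fubini_G Fi).
have := (integrable21ltyP _ _ mF).1 Fi.
apply: le_lt_trans; apply: ge0_le_integral => //.
- by apply: measurableT_comp => //; exact: (measurable_fubini_G Fi).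
- apply: (@measurable_fun_fubini_tonelli_G _ _ _ _ _ m1 (abse \o (EFin \o F))) => //=.
  exact: measurableT_comp.
- move=> y _; apply: le_abse_integral => //.
  exact: (@measurableT_comp _ _ _ _ _ _ _ _ _ mF).
Qed.

Let mG : measurable_fun setT (fun y => \int[m1]_x F (x, y)).
Proof.
by apply: measurableT_comp => //; have /integrableP[] := H2.
Qed.

Lemma Rint_fubini2 : \int[(m1 \x m2)%E]_z F z = \int[m2]_y \int[m1]_x F (x, y).
Proof.
congr fine; rewrite -(integral21_prod_meas1 Fi); apply: ae_eq_integral => //.
- by have /integrableP[] := H2.
- by apply/measurable_EFinP.
- apply: filterS (integrable_ae measurableT H2) => x /(_ Logic.I) xf _.
  by rewrite -(fineK xf).
Qed.

Lemma rint_Rint2 : rint m2 (fun y => \int[m1]_x F (x, y)).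
Proof.
have h := H2; apply/integrableP; split; first exact/measurable_EFinP.
have /integrableP[_] := h; apply: le_lt_trans.
apply: ae_ge0_le_integral => //.
- by apply: measurableT_comp => //; exact/measurable_EFinP.
- by apply: measurableT_comp => //; have /integrableP[] := h.
- apply: filterS (integrable_ae measurableT h) => x /(_ Logic.I) xf _.
  by rewrite -(fineK xf).
Qed.

End fubini_real2.

Lemma Rint_prodM d1 d2 (T1 : measurableType d1) (T2 : measurableType d2) (R : realType)
    (m1 : {sigma_finite_measure set T1 -> \bar R})
    (m2 : {sigma_finite_measure set T2 -> \bar R}) (f : T1 -> R) (g : T2 -> R) :
  rint m1 f -> rint m2 g ->
  \int[(m1 \x m2)%E]_z (f z.1 * g z.2) = \int[m1]_x f x * \int[m2]_y g y.
Proof.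
move=> fi gi; rewrite Rint_fubini1; last exact: rint_prod.
under eq_Rint do rewrite /= RintZ//.
by under eq_Rint do rewrite mulrC; rewrite RintZ// mulrC.
Qed.

Section product_sigma_finite.
Context d1 d2 (T1 : measurableType d1) (T2 : measurableType d2) (R : realType).
Variable m1 : {sigma_finite_measure set T1 -> \bar R}.
Variable m2 : {sigma_finite_measure set T2 -> \bar R}.

(* The sigma-finiteness of [m1 \x m2] is shadowed by another canonical
   instance in the library; this alias carries it. *)
Definition prodm : set (T1 * T2) -> \bar R := (m1 \x m2)%E.

HB.instance Definition _ := Measure.on prodm.

Lemma prodm_sigma_finite : sigma_finite setT prodm.
Proof.
have [F FT Ff] := sigma_finiteT m1; have [G GT Gf] := sigma_finiteT m2.
exists (fun n => let: (i, j) := odflt (0, 0)%N (unpickle n) in F i `*` G j).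
  apply/seteqP; split => // -[x y] _.
  have : (\bigcup_i F i) x by rewrite -FT.
  have : (\bigcup_i G i) y by rewrite -GT.
  move=> [j _ Gy] [i _ Fx]; exists (pickle (i, j)) => //.
  by rewrite pickleK.
move=> n; case: (odflt _ _) => i j; have [mF Fl] := Ff i; have [mG Gl] := Gf j.
split; first exact: measurableX.
rewrite /prodm product_measure1E//.
by apply: lte_mul_pinfty => //; rewrite ge0_fin_numE.
Qed.

HB.instance Definition _ := Measure_isSigmaFinite.Build _ _ _ prodm prodm_sigma_finite.

End product_sigma_finite.

Lemma measurable_cosr (R : realType) : measurable_fun setT (@cos R).
Proof. by apply: continuous_measurable_fun; exact: continuous_cos. Qed.

Lemma measurable_sinr (R : realType) : measurable_fun setT (@sin R).
Proof. by apply: continuous_measurable_fun; exact: continuous_sin. Qed.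

Lemma measurable_fun_invr d (T : measurableType d) (R : realType) (f : T -> R) :
  measurable_fun setT f -> measurable_fun setT (fun x => (f x)^-1).
Proof.
move=> mf; apply: (@measurableT_comp _ _ _ _ _ _ (@GRing.inv R)) mf.
rewrite -(setvU [set (0 : R)]); apply/measurable_funU => //.
  exact: measurableC.
split; last exact: measurable_fun_set1.
apply: open_continuous_measurable_fun; first exact: closed_openC.
move=> x; rewrite inE/= => /eqP x0; exact: inv_continuous.
Qed.

Section oscillatory.
Context d (T : measurableType d) (R : realType) (m : {measure set T -> \bar R}).
Implicit Types (h : T -> R[i]) (th : T -> R).

Definition c2 (z : R[i]) : R := Rep z ^+ 2 + Imp z ^+ 2.

Definition cint h := rint m (Rep \o h) /\ rint m (Imp \o h).

Definition oscR th h := \int[m]_k (cos (th k) * Rep (h k) - sin (th k) * Imp (h k)).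
Definition oscI th h := \int[m]_k (cos (th k) * Imp (h k) + sin (th k) * Rep (h k)).
Definition osc2 th h := oscR th h ^+ 2 + oscI th h ^+ 2.

Lemma c2_ge0 z : 0 <= c2 z.
Proof. by rewrite addr_ge0 ?sqr_ge0. Qed.

Lemma osc2_ge0 th h : 0 <= osc2 th h.
Proof. by rewrite addr_ge0 ?sqr_ge0. Qed.

Lemma le_normM (x y M : R) : `|x| <= M -> `|x * y| <= M * `|y|.
Proof. by move=> xM; rewrite normrM ler_wpM2r. Qed.

Lemma norm_cos_le1 (x : R) : `|cos x| <= 1.
Proof. by rewrite ler_norml cos_geN1 cos_le1. Qed.

Lemma norm_sin_le1 (x : R) : `|sin x| <= 1.
Proof. by rewrite ler_norml sin_geN1 sin_le1. Qed.

Lemma rintM_bnd (f g : T -> R) M : measurable_fun setT f -> (forall x, `|f x| <= M) ->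
  rint m g -> rint m (fun x => f x * g x).
Proof.
move=> mf fM gi; apply: (rint_le _ (rintZ M (rint_abs gi))).
  by apply: measurable_funM => //; exact: rint_meas gi.
by move=> x; exact: le_normM.
Qed.

Lemma rint_oscR th h : measurable_fun setT th -> cint h ->
  rint m (fun k => cos (th k) * Rep (h k) - sin (th k) * Imp (h k)).
Proof.
move=> mth [hr hi]; apply: rintB; apply: (@rintM_bnd _ _ 1) => //.
- by apply: measurableT_comp => //; exact: measurable_cosr.
- by move=> x; exact: norm_cos_le1.
- by apply: measurableT_comp => //; exact: measurable_sinr.
- by move=> x; exact: norm_sin_le1.
Qed.

Lemma rint_oscI th h : measurable_fun setT th -> cint h ->
  rint m (fun k => cos (th k) * Imp (h k) + sin (th k) * Rep (h k)).
Proof.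
move=> mth [hr hi]; apply: rintD; apply: (@rintM_bnd _ _ 1) => //.
- by apply: measurableT_comp => //; exact: measurable_cosr.
- by move=> x; exact: norm_cos_le1.
- by apply: measurableT_comp => //; exact: measurable_sinr.
- by move=> x; exact: norm_sin_le1.
Qed.

End oscillatory.

Lemma schur_ineq (R : realType) (a b a' b' x y : R) : 0 < x -> 0 < y ->
  `|a * a' + b * b'| <=
    2^-1 * ((a ^+ 2 + b ^+ 2) / x * y + (a' ^+ 2 + b' ^+ 2) / y * x).
Proof.
move=> x0 y0; set S := (X in _ <= X).
have h (s : R) : s ^+ 2 = 1 -> 0 <= S - s * (a * a' + b * b').
  move=> s1; have -> : S - s * (a * a' + b * b') =
      ((a * y - s * (a' * x)) ^+ 2 + (b * y - s * (b' * x)) ^+ 2) / (2 * x * y) +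
      (1 - s ^+ 2) * (a' ^+ 2 + b' ^+ 2) * x / (2 * y).
    by rewrite /S; field; rewrite !gt_eqF.
  by rewrite s1 subrr !mul0r addr0 divr_ge0 ?addr_ge0 ?sqr_ge0// !mulr_ge0// ltW.
have := h 1 (expr1n _ _); have := h (-1) ltac:(by rewrite sqrrN expr1n).
by rewrite ler_norml; lra.
Qed.

Section TTstar.
Context d1 d2 (Y : measurableType d1) (T : measurableType d2) (R : realType).
Variable p : {sigma_finite_measure set Y -> \bar R}.
Variable m : {sigma_finite_measure set T -> \bar R}.
Variables (w : Y -> R) (th : Y -> T -> R) (h : T -> R[i]) (K : T -> T -> R).
Hypothesis w0 : forall y, 0 <= w y.
Hypothesis wi : rint p w.
Hypothesis mth : measurable_fun setT (fun z : Y * T => th z.1 z.2).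
Hypothesis hi : cint m h.
Hypothesis HK : forall k k', \int[p]_y (w y * cos (th y k - th y k')) = K k k'.
Hypothesis HS : forall k k', \int[p]_y (w y * sin (th y k - th y k')) = 0.

Let A y k : R := cos (th y k) * Rep (h k) - sin (th y k) * Imp (h k).
Let B y k : R := cos (th y k) * Imp (h k) + sin (th y k) * Rep (h k).
Let g k : R := `|Rep (h k)| + `|Imp (h k)|.
Let Phi (z : Y * (T * T)) : R := w z.1 * (A z.1 z.2.1 * A z.1 z.2.2 + B z.1 z.2.1 * B z.1 z.2.2).

Let mhr : measurable_fun setT (fun k => Rep (h k)). Proof. by case: hi => /rint_meas. Qed.
Let mhi : measurable_fun setT (fun k => Imp (h k)). Proof. by case: hi => _ /rint_meas. Qed.
Let mw : measurable_fun setT w. Proof. exact: rint_meas wi. Qed.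
Let mcos : measurable_fun setT (fun z : Y * T => cos (th z.1 z.2)).
Proof. by apply: measurableT_comp => //; exact: measurable_cosr. Qed.
Let msin : measurable_fun setT (fun z : Y * T => sin (th z.1 z.2)).
Proof. by apply: measurableT_comp => //; exact: measurable_sinr. Qed.

Let mA : measurable_fun setT (fun z : Y * T => A z.1 z.2).
Proof.
by apply: measurable_funB; apply: measurable_funM => //; [exact: (measurableT_comp mhr measurable_snd)|exact: (measurableT_comp mhi measurable_snd)].
Qed.
Let mB : measurable_fun setT (fun z : Y * T => B z.1 z.2).
Proof.
by apply: measurable_funD; apply: measurable_funM => //; [exact: (measurableT_comp mhi measurable_snd)|exact: (measurableT_comp mhr measurable_snd)].
Qed.

Let gi : rint m g.
Proof. by case: hi => hr hI; apply: rintD; apply: rint_abs. Qed.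

Let Ag y k : `|A y k| <= g k.
Proof.
rewrite (le_trans (ler_normB _ _))// lerD//.
  by rewrite -[leRHS]mul1r; apply: le_normM; exact: norm_cos_le1.
by rewrite -[leRHS]mul1r; apply: le_normM; exact: norm_sin_le1.
Qed.

Let Bg y k : `|B y k| <= g k.
Proof.
rewrite /g addrC (le_trans (ler_normD _ _))// lerD//.
  by rewrite -[leRHS]mul1r; apply: le_normM; exact: norm_cos_le1.
by rewrite -[leRHS]mul1r; apply: le_normM; exact: norm_sin_le1.
Qed.

Let p1 : measurable_fun setT (fun z : Y * (T * T) => (z.1, z.2.1)).
Proof. by apply: measurable_fun_pair => //; exact: measurableT_comp. Qed.
Let p2 : measurable_fun setT (fun z : Y * (T * T) => (z.1, z.2.2)).
Proof. by apply: measurable_fun_pair => //; exact: measurableT_comp. Qed.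

Let Phii : rint (p \x prodm m m)%E Phi.
Proof.
have gg : rint (prodm m m) (fun z => g z.1 * g z.2) := rint_prod gi gi.
apply: (rint_le _ (rint_prod (rintZ 2 wi) gg)).
  apply: measurable_funM; first exact: measurableT_comp.
  apply: measurable_funD; apply: measurable_funM.
  - exact: (measurableT_comp mA p1).
  - exact: (measurableT_comp mA p2).
  - exact: (measurableT_comp mB p1).
  - exact: (measurableT_comp mB p2).
move=> [y [k k']] /=; rewrite /Phi/= normrM ger0_norm// mulrAC mulrC.
apply: ler_wpM2r => //.
rewrite (le_trans (ler_normD _ _))// !normrM mulr_natl mulr2n.
by apply: lerD; apply: ler_pM.
Qed.

Let fiberA y : rint m (A y).
Proof. by apply: rint_oscR => //; exact: (measurableT_comp mth (pair1_measurable y)). Qed.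

Let fiberB y : rint m (B y).
Proof. by apply: rint_oscI => //; exact: (measurableT_comp mth (pair1_measurable y)). Qed.

Let Phi_inner1 y : \int[(prodm m m)]_z Phi (y, z) = w y * osc2 m (th y) h.
Proof.
have AA := rint_prod (fiberA y) (fiberA y).
have BB := rint_prod (fiberB y) (fiberB y).
by rewrite /Phi /= RintZ ?RintD ?Rint_prodM//; apply: rintD.
Qed.

Let wb (f : R -> R) k k' : measurable_fun setT f -> (forall x, `|f x| <= 1) ->
  rint p (fun y => w y * f (th y k - th y k')).
Proof.
move=> mf f1; under [X in rint _ X]eq_fun do rewrite mulrC.
apply: (@rintM_bnd _ _ _ _ _ _ 1) => //.
apply: measurableT_comp => //; apply: measurable_funB; exact: (measurableT_comp mth (pair2_measurable _)).
Qed.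

Let Phi_inner2 z : \int[p]_y Phi (y, z) =
  K z.1 z.2 * (Rep (h z.1) * Rep (h z.2) + Imp (h z.1) * Imp (h z.2)).
Proof.
case: z => k k' /=; set q := Rep (h k) * _ + _.
pose q' := Rep (h k) * Imp (h k') - Imp (h k) * Rep (h k').
rewrite (eq_Rint _ (g := fun y => q * (w y * cos (th y k - th y k')) +
   q' * (w y * sin (th y k - th y k')))); last first.
  move=> y; rewrite /Phi/= /A /B cosB sinB /q /q'; ring.
have hc : rint p (fun y => w y * cos (th y k - th y k')).
  by apply: wb; [exact: measurable_cosr|exact: norm_cos_le1].
have hs : rint p (fun y => w y * sin (th y k - th y k')).
  by apply: wb; [exact: measurable_sinr|exact: norm_sin_le1].
rewrite RintD; [|exact: rintZ|exact: rintZ].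
by rewrite !RintZ// HK HS mulr0 addr0 mulrC.
Qed.

Lemma TT_rint : rint p (fun y => w y * osc2 m (th y) h).
Proof.
have := rint_Rint1 Phii.
by under [X in rint _ X -> _]eq_fun do rewrite Phi_inner1.
Qed.

Lemma TT_identity : \int[p]_y (w y * osc2 m (th y) h) =
  \int[(prodm m m)]_z
    (K z.1 z.2 * (Rep (h z.1) * Rep (h z.2) + Imp (h z.1) * Imp (h z.2))).
Proof.
under eq_Rint do rewrite -Phi_inner1.
rewrite -(Rint_fubini1 Phii) (Rint_fubini2 Phii).
by under eq_Rint do rewrite Phi_inner2.
Qed.

Lemma TT_rint2 : rint (prodm m m) (fun z =>
    K z.1 z.2 * (Rep (h z.1) * Rep (h z.2) + Imp (h z.1) * Imp (h z.2))).
Proof.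
have := rint_Rint2 Phii.
by under [X in rint _ X -> _]eq_fun do rewrite Phi_inner2.
Qed.

Hypothesis K0 : forall k k', 0 <= K k k'.
Hypothesis KC : forall k k', K k k' = K k' k.
Hypothesis mK : measurable_fun setT (fun z : T * T => K z.1 z.2).
Variable W : T -> R.
Hypothesis W0 : forall k, 0 <= W k.
Hypothesis mW : measurable_fun setT W.
Hypothesis hW : forall k, W k = 0 -> h k = 0.
Variable C : R.
Hypothesis C0 : 0 <= C.
Hypothesis KW : forall k, (\int[m]_k' (K k k' * W k')%:E <= C%:E)%E.

(* Schur's test with the weight [W]; at points where [W] vanishes so does [h],
   and then [c2 (h k) / W k] is [0]. *)
Lemma TT_schur : (\int[p]_y (w y * osc2 m (th y) h)%:E <=
  C%:E * \int[m]_k (c2 (h k) / W k)%:E)%E.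
Proof.
rewrite rint_EFin; last exact: TT_rint.
rewrite TT_identity -rint_EFin; last exact: TT_rint2.
pose q k := c2 (h k) / W k.
have q0 k : 0 <= q k by rewrite divr_ge0// c2_ge0.
have mq : measurable_fun setT q.
  apply: measurable_funM.
    by apply: measurable_funD; apply: measurable_funX.
  exact: measurable_fun_invr.
pose G1 z := K z.1 z.2 * (q z.1 * W z.2).
pose G2 z := K z.1 z.2 * (q z.2 * W z.1).
have mfst (f : T -> R) : measurable_fun setT f -> measurable_fun setT (fun z : T * T => f z.1).
  by move=> mf; exact: measurableT_comp.
have msnd (f : T -> R) : measurable_fun setT f -> measurable_fun setT (fun z : T * T => f z.2).
  by move=> mf; exact: measurableT_comp.
have mG1 : measurable_fun setT (EFin \o G1).
  by apply/measurable_EFinP; apply: measurable_funM => //; apply: measurable_funM; [exact: mfst|exact: msnd].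
have mG2 : measurable_fun setT (EFin \o G2).
  by apply/measurable_EFinP; apply: measurable_funM => //; apply: measurable_funM; [exact: msnd|exact: mfst].
have G10 z : 0 <= G1 z by apply: mulr_ge0 => //; exact: mulr_ge0.
have G20 z : 0 <= G2 z by apply: mulr_ge0 => //; exact: mulr_ge0.
have IG1 : (\int[prodm m m]_z (G1 z)%:E <= C%:E * \int[m]_k (q k)%:E)%E.
  rewrite [in leLHS]/prodm fubini_tonelli1//=.
  rewrite -ge0_integralZl//; last 2 first.
  - exact/measurable_EFinP.
  - by move=> k _; rewrite lee_fin.
  apply: ge0_le_integral => //.
  - by move=> k _; apply: integral_ge0 => z _; rewrite lee_fin.
  - by apply: (@measurable_fun_fubini_tonelli_F _ _ _ _ _ m (EFin \o G1)) => // z; rewrite lee_fin.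
  - by apply: emeasurable_funM => //; exact/measurable_EFinP.
  - move=> k _; rewrite /fubini_F /=.
    under eq_integral do rewrite /G1/= mulrCA EFinM.
    rewrite ge0_integralZl//; last 3 first.
    + by apply/measurable_EFinP; apply: measurable_funM => //; exact: (measurableT_comp mK (pair1_measurable k)).
    + by move=> z _; rewrite lee_fin mulr_ge0.
    + by rewrite lee_fin.
    by rewrite muleC; apply: lee_wpmul2r; rewrite ?lee_fin.
have IG2 : (\int[prodm m m]_z (G2 z)%:E <= C%:E * \int[m]_k (q k)%:E)%E.
  rewrite [in leLHS]/prodm fubini_tonelli2//=.
  rewrite -ge0_integralZl//; last 2 first.
  - exact/measurable_EFinP.
  - by move=> k _; rewrite lee_fin.
  apply: ge0_le_integral => //.
  - by move=> k _; apply: integral_ge0 => z _; rewrite lee_fin.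
  - by apply: (@measurable_fun_fubini_tonelli_G _ _ _ _ _ m (EFin \o G2)) => // z; rewrite lee_fin.
  - by apply: emeasurable_funM => //; exact/measurable_EFinP.
  - move=> k _; rewrite /fubini_G /=.
    under eq_integral do rewrite /G2/= KC mulrCA EFinM.
    rewrite ge0_integralZl//; last 3 first.
    + by apply/measurable_EFinP; apply: measurable_funM => //; exact: (measurableT_comp mK (pair1_measurable k)).
    + by move=> z _; rewrite lee_fin mulr_ge0.
    + by rewrite lee_fin.
    by rewrite muleC; apply: lee_wpmul2r; rewrite ?lee_fin.
have pt z : `|K z.1 z.2 * (Rep (h z.1) * Rep (h z.2) + Imp (h z.1) * Imp (h z.2))| <=
    2^-1 * (G1 z + G2 z).
  rewrite /G1 /G2 -mulrDr mulrCA normrM ger0_norm//; apply: ler_wpM2l => //.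
  have q1 : 0 <= q z.1 * W z.2 by exact: mulr_ge0.
  have q2 : 0 <= q z.2 * W z.1 by exact: mulr_ge0.
  have [W1|W1] := eqVneq (W z.1) 0.
    by rewrite hW//= !mul0r addr0 normr0 mulr_ge0// addr_ge0.
  have [W2|W2] := eqVneq (W z.2) 0.
    by rewrite (hW W2)/= !mulr0 addr0 normr0 mulr_ge0// addr_ge0.
  have Wp1 : 0 < W z.1 by rewrite lt_neqAle eq_sym W1 W0.
  have Wp2 : 0 < W z.2 by rewrite lt_neqAle eq_sym W2 W0.
  exact: schur_ineq.
apply: (@le_trans _ _ (\int[prodm m m]_z (2^-1%:E * ((G1 z)%:E + (G2 z)%:E)))%E).
  apply: (@le_trans _ _ (\int[prodm m m]_z `|(K z.1 z.2 * (Rep (h z.1) * Rep (h z.2) + Imp (h z.1) * Imp (h z.2)))%:E|)%E).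
    by rewrite (le_trans (lee_abs _))// le_abse_integral//; case/integrableP: TT_rint2.
  apply: ge0_le_integral => //.
  - by apply: measurableT_comp => //; case/integrableP: TT_rint2.
  - by apply: emeasurable_funM => //; exact: emeasurable_funD.
  by move=> z _; rewrite -EFinD -EFinM lee_fin pt.
rewrite ge0_integralZl//; last 2 first.
- exact: emeasurable_funD.
- by move=> z _; rewrite -EFinD lee_fin addr_ge0.
rewrite ge0_integralD//; last 2 first.
- by move=> z _; rewrite lee_fin.
- by move=> z _; rewrite lee_fin.
apply: (@le_trans _ _ (2^-1%:E * (C%:E * \int[m]_k (q k)%:E + C%:E * \int[m]_k (q k)%:E)))%E.
  by apply: lee_wpmul2l; [rewrite lee_fin|exact: leeD].
rewrite -[leRHS]/(C%:E * \int[m]_k (q k)%:E)%E.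
case: (C%:E * _)%E => [r| |]; last 2 first.
- exact: leey.
- by rewrite addeNy gt0_muleNy// lte_fin.
by rewrite -EFinD -EFinM lee_fin; lra.
Qed.

End TTstar.

(** * Poisson kernels and bilinear estimates *)

Section affine.
Context (R : realType).
Local Notation mu := (@lebesgue_measure R).

Let aff (a c x : R) : measurableTypeR R := a * x + c.

Let maff a c : measurable_fun setT (aff a c : measurableTypeR R -> measurableTypeR R).
Proof. by apply: measurable_funD => //; exact: measurable_funM. Qed.

Lemma lebesgue_measure_affine (a c : R) (A : set (measurableTypeR R)) : 0 < a -> measurable A ->
  mu A = (a%:E * mu (aff a c @^-1` A))%E.
Proof.
move=> a0 mA.
pose an := NngNum (ltW a0).
have := @lebesgue_measure_unique R (mscale an (pushforward mu (aff a c))).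
apply => // _ [[u v] _ <-] /=.
rewrite /mscale/= /pushforward.
have -> : aff a c @^-1` `]u, v] = `](u - c) / a, (v - c) / a]%classic.
  apply/seteqP; split => x /=; rewrite !in_itv/= /aff ltr_pdivrMr// ler_pdivlMr//;
    by rewrite ltrBlDr lerBrDr mulrC.
rewrite !lebesgue_measure_itv/= !lte_fin ltr_pM2r ?invr_gt0// ltrD2r.
case: ifPn => _; last by rewrite mule0.
by rewrite -!EFinB -EFinM; congr EFin; field; rewrite gt_eqF.
Qed.

Lemma ge0_integral_affine (a c : R) (f : R -> \bar R) : 0 < a ->
  measurable_fun setT f -> (forall x, (0 <= f x)%E) ->
  (\int[mu]_x f x = a%:E * \int[mu]_x f (a * x + c)%R)%E.
Proof.
move=> a0 mf f0; pose an := NngNum (ltW a0).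
pose p1 : {measure set (measurableTypeR R) -> \bar R} := pushforward mu (aff a c).
transitivity (\int[mscale an (p1 (maff a c))]_x f x)%E.
  by apply: eq_measure_integral => A mA _; exact: lebesgue_measure_affine.
rewrite ge0_integral_mscale//=; congr (_ * _)%E.
by rewrite ge0_integral_pushforward.
Qed.

Lemma ge0_integral_translate (c : R) (f : R -> \bar R) :
  measurable_fun setT f -> (forall x, (0 <= f x)%E) ->
  (\int[mu]_x f x = \int[mu]_x f (x + c)%R)%E.
Proof.
move=> mf f0; rewrite (@ge0_integral_affine 1 c)// mul1e.
by under eq_integral do rewrite mul1r.
Qed.

Lemma ge0_integral_opp (f : R -> \bar R) :
  measurable_fun setT f -> (forall x, (0 <= f x)%E) ->
  (\int[mu]_x f x = \int[mu]_x f (- x)%R)%E.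
Proof.
move=> mf f0.
have mN : measurable_fun setT (-%R : measurableTypeR R -> measurableTypeR R) by [].
transitivity (\int[pushforward mu (-%R : _ -> measurableTypeR R)]_x f x)%E.
  apply: eq_measure_integral => A mA _; exact/esym/lebesgue_measureN.
by rewrite ge0_integral_pushforward.
Qed.

Let Rint_change (phi : R -> R) (a : R) : 0 < a -> measurable_fun setT phi ->
  (forall f : R -> \bar R, measurable_fun setT f -> (forall x, (0 <= f x)%E) ->
    (\int[mu]_x f x = a%:E * \int[mu]_x f (phi x)))%E ->
  forall f, rint mu f -> rint mu (fun x => f (phi x)) /\
    \int[mu]_x f x = a * \int[mu]_x f (phi x).
Proof.
move=> a0 mphi H f fi; have mf := rint_meas fi.
have mfp : measurable_fun setT (fun x => f (phi x)) by exact: measurableT_comp.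
have mE : measurable_fun setT (EFin \o f) by exact/measurable_EFinP.
have fip : rint mu (fun x => f (phi x)).
  apply/integrableP; split; first exact/measurable_EFinP.
  have /integrableP[_] := fi; rewrite H//; last exact: measurableT_comp.
  change ((a%:E * \int[mu]_x `|(EFin \o f) (phi x)| < +oo)%E ->
    (\int[mu]_x `|(EFin \o f) (phi x)| < +oo)%E).
  by case: (\int[mu]_x _)%E => [r| |]; [by rewrite !ltry|rewrite gt0_muley ?lte_fin//|].
split=> //; rewrite /Rintegral integralE [in RHS]integralE.
rewrite (H (EFin \o f)^\+%E)//; last exact: measurable_funepos.
rewrite (H (EFin \o f)^\-%E)//; last exact: measurable_funeneg.
have := integrable_pos_fin_num measurableT fip.
have := integrable_neg_fin_num measurableT fip.
move=> /fineK h1 /fineK h2.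
have -> : (\int[mu]_x (EFin \o f)^\+ (phi x) = \int[mu]_x (EFin \o (fun x => f (phi x)))^\+ x)%E.
  by apply: eq_integral => x _; rewrite !funeposE.
have -> : (\int[mu]_x (EFin \o f)^\- (phi x) = \int[mu]_x (EFin \o (fun x => f (phi x)))^\- x)%E.
  by apply: eq_integral => x _; rewrite !funenegE.
move: h1 h2; set N := (\int[mu]_x (EFin \o (fun x => f (phi x)))^\- x)%E.
set P := (\int[mu]_x (EFin \o (fun x => f (phi x)))^\+ x)%E => h1 h2.
change (fine (a%:E * P - a%:E * N)%E = a * fine (P - N)%E).
by rewrite -h1 -h2 -!EFinM -!EFinB /= mulrBr.
Qed.

Lemma Rint_affine (a c : R) (f : R -> R) : 0 < a -> rint mu f ->
  rint mu (fun x => f (a * x + c)) /\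
  \int[mu]_x f x = a * \int[mu]_x f (a * x + c).
Proof.
move=> a0; apply: Rint_change => //; first exact: maff.
by move=> g mg g0; exact: ge0_integral_affine.
Qed.

Lemma Rint_opp (f : R -> R) : rint mu f ->
  rint mu (fun x => f (- x)) /\ \int[mu]_x f x = \int[mu]_x f (- x).
Proof.
move=> fi; have [//|//|||h1 h2] := @Rint_change (-%R) 1 _ _ _ f => //.
  by move=> g mg g0; rewrite mul1e ge0_integral_opp.
by split=> //; rewrite h2 mul1r.
Qed.

End affine.

Section poisson.
Context (R : realType).
Local Notation mu := (@lebesgue_measure R).

Lemma FTC_is_derive (f F : R -> R) (a b : R) : a <= b ->
  (forall x, is_derive (x : R) 1 F (f x)) -> continuous f ->
  (\int[mu]_(x in `[a, b]) (f x)%:E = (F b - F a)%:E)%E.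
Proof.
rewrite le_eqVlt => /predU1P[<- _ _|ab dF cf].
  by rewrite set_itv1 integral_set1 subrr.
have cF : continuous F.
  by move=> x; apply/differentiable_continuous/derivable1_diffP; case: (dF x).
rewrite (@continuous_FTC2 _ f F)// ?EFinB//.
- exact: continuous_subspaceT.
- split; [by move=> x _; case: (dF x)| |].
    by apply: cvg_at_right_filter; exact: cF.
  by apply: cvg_at_left_filter; exact: cF.
- by move=> x _; rewrite derive1E; apply: derive_val.
Qed.

Definition poisson (eps d : R) : R := 2 * eps / (eps ^+ 2 + d ^+ 2).

Lemma poisson_ge0 eps d : 0 < eps -> 0 <= poisson eps d.
Proof. by move=> e0; rewrite divr_ge0 ?mulr_ge0 ?addr_ge0 ?sqr_ge0// ltW. Qed.

Lemma poissonN eps d : poisson eps (- d) = poisson eps d.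
Proof. by rewrite /poisson sqrrN. Qed.

Lemma continuous_poisson eps : 0 < eps -> continuous (poisson eps).
Proof.
move=> e0 x; apply: cvgM; first exact: cvg_cst.
apply: cvgV; first by rewrite gt_eqF// ltr_pwDl ?exprn_gt0 ?sqr_ge0.
by apply: cvgD; [exact: cvg_cst|exact: exprn_continuous].
Qed.

Lemma measurable_poisson eps : 0 < eps -> measurable_fun setT (poisson eps).
Proof. by move=> e0; apply: continuous_measurable_fun; exact: continuous_poisson. Qed.

Lemma poisson_FTC (eps tau : R) (f F : R -> R) (a b : R) : 0 < eps -> a <= b ->
  (forall x, is_derive (x : R) 1 F (f x)) -> continuous f ->
  (\int[mu]_(x in `[a, b]) (poisson eps (F x - tau) * f x)%:E =
    (2 * atan ((F b - tau) / eps) - 2 * atan ((F a - tau) / eps))%:E)%E.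
Proof.
move=> e0 ab dF cf.
have cF : continuous F.
  by move=> x; apply/differentiable_continuous/derivable1_diffP; case: (dF x).
apply: (@FTC_is_derive _ (fun x => 2 * atan ((F x - tau) / eps))) => //.
- move=> x; have dFx := dF x.
  have d1 : is_derive (x : R) 1 (fun x => (F x - tau) / eps) (f x / eps).
    have -> : (fun x => (F x - tau) / eps) = (eps^-1 \*: (F - cst tau)).
      by apply/funext => y; rewrite /= mulrC.
    apply: is_derive_eq; rewrite subr0; exact: mulrC.
  have := @is_derive1_comp R (@atan R) _ x _ _ (is_derive1_atan _) d1.
  move=> d2; have -> : (fun x0 => 2 * atan ((F x0 - tau) / eps)) =
     (2 \*: (@atan R \o (fun x => (F x - tau) / eps))) by [].
  apply: is_derive_eq; rewrite /poisson /=.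
  rewrite /GRing.scale/=; field.
  by apply/andP; split; rewrite gt_eqF// ltr_pwDl ?exprn_gt0 ?sqr_ge0.
- move=> x; apply: cvgM; last exact: cf.
  apply: (@continuous_comp _ _ _ (fun x => F x - tau)); last exact: continuous_poisson.
  by apply: cvgB; [exact: cF|exact: cvg_cst].
Qed.

Lemma poisson_FTC_le (eps tau : R) (f F : R -> R) (a b : R) : 0 < eps -> a <= b ->
  (forall x, is_derive (x : R) 1 F (f x)) -> continuous f ->
  (\int[mu]_(x in `[a, b]) (poisson eps (F x - tau) * f x)%:E <= (2 * pi)%:E)%E.
Proof.
move=> e0 ab dF cf; rewrite poisson_FTC// lee_fin.
have := atan_ltpi2 ((F b - tau) / eps); have := atan_gtNpi2 ((F a - tau) / eps).
lra.
Qed.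

Lemma integral_sup_segments (f : R -> \bar R) (C : \bar R) :
  measurable_fun setT f -> (forall x, 0 <= f x)%E ->
  (forall n : nat, (\int[mu]_(x in `[(- n%:R)%R, n%:R]) f x <= C)%E) ->
  (\int[mu]_x f x <= C)%E.
Proof.
move=> mf f0 H.
have -> : [set: R] = \bigcup_n `[(- n%:R)%R, n%:R]%classic.
  apply/esym/seteqP; split => // x _; exists (Num.truncn `|x|).+1 => //=.
  rewrite in_itv/= -ler_norml ltW//; exact: truncnS_gt.
have c := @ge0_nondecreasing_set_cvg_integral _ (measurableTypeR R) R (fun n => `[(- n%:R : R)%R, n%:R]%classic) f mu.
rewrite -(cvg_lim _ (c _ _ _ _))//; first apply: lime_le.
- apply/cvg_ex; eexists; apply: c => //.
  + move=> n m nm; apply/subsetPset/subset_itv; rewrite bnd_simp ?lerN2 ler_nat//.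
  + by move=> i; exact: measurable_funTS.
- exact: nearW.
- move=> n m nm; apply/subsetPset/subset_itv; rewrite bnd_simp ?lerN2 ler_nat//.
- by move=> i; exact: measurable_funTS.
Qed.

Lemma poisson_deriv_le (eps tau : R) (f F : R -> R) : 0 < eps ->
  (forall x, is_derive (x : R) 1 F (f x)) -> continuous f -> (forall x, 0 <= f x) ->
  (\int[mu]_x (poisson eps (F x - tau) * f x)%:E <= (2 * pi)%:E)%E.
Proof.
move=> e0 dF cf f0; apply: integral_sup_segments.
- apply/measurable_EFinP; apply: measurable_funM.
    apply: measurableT_comp; first exact: measurable_poisson.
    apply: measurable_funB => //; apply: continuous_measurable_fun => x.
    by apply/differentiable_continuous/derivable1_diffP; case: (dF x).
  exact: continuous_measurable_fun.
- by move=> x; rewrite lee_fin mulr_ge0// poisson_ge0.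
- move=> n; apply: poisson_FTC_le => //.
  by rewrite (@le_trans _ _ 0)// oppr_le0.
Qed.

End poisson.

Section abel_weight.
Context (R : realType).
Local Notation mu := (@lebesgue_measure R).
Variable eps : R.
Hypothesis e0 : 0 < eps.

Definition abelw (y : R) : R := expR (- (eps * `|y|)).

Lemma abelw_ge0 y : 0 <= abelw y. Proof. exact: expR_ge0. Qed.

Lemma continuous_abelw : continuous abelw.
Proof.
move=> x; apply: (@continuous_comp _ _ _ (fun y => - (eps * `|y|)) expR); last exact: continuous_expR.
by apply: cvgN; apply: cvgM; [exact: cvg_cst|exact: norm_continuous].
Qed.

Lemma measurable_abelw : measurable_fun setT abelw.
Proof. by apply: continuous_measurable_fun; exact: continuous_abelw. Qed.

Lemma continuous_cosM (d : R) : continuous (fun y : R => cos (y * d)).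
Proof.
move=> x; apply: (@continuous_comp _ _ _ (fun y : R => y * d) (@cos R)); last exact: continuous_cos.
by apply: cvgM => //; exact: cvg_cst.
Qed.

Let g d y := abelw y * (1 + cos (y * d)).

Lemma integral_abelw_1cos d :
  (\int[mu]_y (abelw y * (1 + cos (y * d)))%:E = (2 / eps + poisson eps d)%:E)%E.
Proof.
have q0 : 0 < eps ^+ 2 + d ^+ 2 by rewrite ltr_pwDl ?exprn_gt0 ?sqr_ge0.
rewrite (@ge0_symfun_integralT _ (g d)); last 3 first.
- by move=> y; rewrite mulr_ge0 ?abelw_ge0//; have := @cos_geN1 R (y * d); lra.
- move=> x; apply: cvgM; first exact: continuous_abelw.
  by apply: cvgD; [exact: cvg_cst|exact: continuous_cosM].
- by move=> y; rewrite /g /abelw /= normrN mulNr cosN.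
rewrite -set_itvcy.
pose f y : R := expR (- (eps * y)) * (1 + cos (y * d)).
have -> : (\int[mu]_(x in `[0%R, +oo[) (g d x)%:E = \int[mu]_(x in `[0%R, +oo[) (f x)%:E)%E.
  apply: eq_integral => y; rewrite inE/= in_itv/= andbT => y0.
  by rewrite /g /abelw ger0_norm.
pose E y : R := expR (- (eps * y)).
pose F y : R := E y * (- eps^-1 + (d * sin (y * d) - eps * cos (y * d)) / (eps ^+ 2 + d ^+ 2)).
have dE (y : R) : is_derive y 1 E (- eps * E y).
  have d1 : is_derive y 1 (fun y : R => - (eps * y)) (- eps).
    have -> : (fun y : R => - (eps * y)) = ((- eps) \*: id).
      by apply/funext => z; rewrite /= /GRing.scale/= mulNr.
    by apply: is_derive_eq; rewrite /GRing.scale/= mulr1.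
  have d2 := @is_derive1_comp R (@expR R) _ y _ _ (is_derive_expR _) d1.
  by apply: is_derive_eq; rewrite mulrC.
have dl (y : R) : is_derive y 1 (fun y : R => y * d) d.
  have -> : (fun y : R => y * d) = (d \*: id).
    by apply/funext => z; rewrite /= mulrC.
  by apply: is_derive_eq; rewrite /GRing.scale/= mulr1.
have dF (y : R) : is_derive y 1 F (f y).
  have ds := @is_derive1_comp R (@sin R) _ y _ _ (is_derive_sin _) (dl y).
  have dc := @is_derive1_comp R (@cos R) _ y _ _ (is_derive_cos _) (dl y).
  have -> : F = E * (cst (- eps^-1) + (eps ^+ 2 + d ^+ 2)^-1 \*:
      ((d \*: (@sin R \o (fun y : R => y * d))) - (eps \*: (@cos R \o (fun y : R => y * d))))).
    by apply/funext => z; rewrite /F [X in - _ + X]mulrC.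
  apply: is_derive_eq; rewrite /f -/(E y) /GRing.scale/=.
  set G := (X in X * (- eps * E y)).
  have -> : G = - eps^-1 + (eps ^+ 2 + d ^+ 2)^-1 * (d * sin (y * d) - eps * cos (y * d)) by [].
  by field; rewrite !gt_eqF.
have El : E y @[y --> +oo%R] --> (0 : R).
  apply: (cvg_comp (fun y => eps * y) (fun y => expR (- y))); last exact: cvgr_expR.
  exact: gt0_cvgMry.
have Fl : F y @[y --> +oo%R] --> (0 : R).
  pose B := eps^-1 + (`|d| + eps) / (eps ^+ 2 + d ^+ 2).
  have cB : E y * B @[y --> +oo%R] --> (0 : R).
    by rewrite -(mul0r B); apply: cvgM => //; exact: cvg_cst.
  apply: norm_cvg0; apply: squeeze_cvgr cB; last exact: (cvg_cst (0 : R)).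
  near=> y; rewrite normr_ge0/= normrM ger0_norm ?expR_ge0//.
  rewrite ler_wpM2l ?expR_ge0// (le_trans (ler_normD _ _))// lerD//.
    by rewrite normrN ger0_norm// invr_ge0 ltW.
  rewrite normrM [X in _ * X]ger0_norm ?invr_ge0 ?(ltW q0)//.
  rewrite ler_wpM2r ?invr_ge0 ?(ltW q0)// (le_trans (ler_normB _ _))//.
  rewrite lerD//; rewrite normrM.
    by rewrite ler_piMr// norm_sin_le1.
  by rewrite (ger0_norm (ltW e0)) ler_piMr ?(ltW e0)// norm_cos_le1.
have cF : continuous F.
  by move=> x; apply/differentiable_continuous/derivable1_diffP; case: (dF x).
have cE : continuous E.
  by move=> x; apply/differentiable_continuous/derivable1_diffP; case: (dE x).
rewrite (@ge0_continuous_FTC2y _ f F 0 0)//.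
- rewrite /F /E !mul0r mulr0 oppr0 expR0 sin0 cos0 -EFinB -EFinM; congr EFin.
  by rewrite /poisson; field; rewrite !gt_eqF.
- move=> x x0; rewrite mulr_ge0 ?expR_ge0//; have := @cos_geN1 R (x * d); lra.
- apply: continuous_subspaceT => x; apply: cvgM.
    exact: cE.
  by apply: cvgD; [exact: cvg_cst|exact: continuous_cosM].
- by apply: cvg_at_right_filter; exact: cF.
- by move=> x _; rewrite derive1E; apply: derive_val.
Unshelve. all: by end_near. Qed.

Lemma rint_abelw : rint mu abelw.
Proof.
apply: rint_ge0; [exact: measurable_abelw|exact: abelw_ge0|].
apply: (@le_lt_trans _ _ (\int[mu]_y (abelw y * (1 + cos (y * 0)))%:E)%E); last first.
  by rewrite integral_abelw_1cos ltry.
apply: ge0_le_integral => //.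
- by move=> y _; rewrite lee_fin abelw_ge0.
- by apply/measurable_EFinP; exact: measurable_abelw.
- apply/measurable_EFinP; apply: measurable_funM; first exact: measurable_abelw.
  by apply: measurable_funD => //; apply: continuous_measurable_fun; exact: continuous_cosM.
- by move=> y _; rewrite lee_fin mulr0 cos0 ler_peMr ?abelw_ge0//; lra.
Qed.

Lemma rint_abelwM (f : R -> R) d : measurable_fun setT f -> (forall x, `|f x| <= 1) ->
  rint mu (fun y => abelw y * f (y * d)).
Proof.
move=> mf f1; under [X in rint _ X]eq_fun do rewrite mulrC.
apply: (@rintM_bnd _ _ _ _ _ _ 1) => //; last exact: rint_abelw.
by apply: measurableT_comp => //; exact: measurable_funM.
Qed.

Lemma rint_abelw_cos d : rint mu (fun y => abelw y * cos (y * d)).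
Proof. apply: rint_abelwM; [exact: measurable_cosr|exact: norm_cos_le1]. Qed.

Lemma rint_abelw_sin d : rint mu (fun y => abelw y * sin (y * d)).
Proof. apply: rint_abelwM; [exact: measurable_sinr|exact: norm_sin_le1]. Qed.

Lemma Rint_abelw_cos d : \int[mu]_y (abelw y * cos (y * d)) = poisson eps d.
Proof.
have h0 : \int[mu]_y abelw y = 2 / eps.
  have := integral_abelw_1cos 0.
  have -> : (fun y => (abelw y * (1 + cos (y * 0)))%:E) = (fun y => (2 * abelw y)%:E).
    by apply/funext => y; rewrite mulr0 cos0; congr EFin; ring.
  rewrite rint_EFin; last exact: rintZ rint_abelw.
  move=> [] ; rewrite RintZ; last exact: rint_abelw.
  rewrite /poisson expr0n/= addr0 expr2 invfM mulrA mulfK ?gt_eqF// => h; lra.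
have := integral_abelw_1cos d.
have -> : (fun y => (abelw y * (1 + cos (y * d)))%:E) = (fun y => (abelw y + abelw y * cos (y * d))%:E).
  by apply/funext => y; congr EFin; ring.
rewrite rint_EFin; last by apply: rintD; [exact: rint_abelw|exact: rint_abelw_cos].
move=> []; rewrite RintD ?h0; [|exact: rint_abelw|exact: rint_abelw_cos].
by move=> h; lra.
Qed.

Lemma Rint_abelw_sin d : \int[mu]_y (abelw y * sin (y * d)) = 0.
Proof.
have := (Rint_opp (rint_abelw_sin d)).2.
have -> : (fun x => abelw (- x) * sin (- x * d)) = (fun x => -1 * (abelw x * sin (x * d))).
  by apply/funext => x; rewrite /abelw normrN (mulNr x d) sinN; ring.
rewrite RintZ; last exact: rint_abelw_sin.
by lra.
Qed.

End abel_weight.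

Section abel_limit.
Context d (Y : measurableType d) (R : realType) (p : {measure set Y -> \bar R}).

Lemma limn_einf_le (u : nat -> \bar R) (C : \bar R) :
  (forall n, u n <= C)%E -> (limn_einf u <= C)%E.
Proof.
move=> uC; rewrite limn_einf_lim; apply: lime_le; first exact: is_cvg_einfs.
apply: nearW => n; apply: le_trans (uC n).
by apply: ge_ereal_inf; exists (u n) => //; exists n => /=.
Qed.

Lemma fatou_le (f : nat -> Y -> R) (g : Y -> R) (C : \bar R) :
  (forall n, measurable_fun setT (f n)) -> measurable_fun setT g ->
  (forall n y, 0 <= f n y) -> (forall y, 0 <= g y) ->
  {ae p, forall y, f ^~ y @ \oo --> g y} ->
  (forall n, \int[p]_y (f n y)%:E <= C)%E -> (\int[p]_y (g y)%:E <= C)%E.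
Proof.
move=> mf mg f0 g0 fg fC.
apply: (@le_trans _ _ (\int[p]_y limn_einf (fun n => (f n y)%:E))%E); last first.
  apply: (le_trans (@fatou _ _ _ p setT measurableT (fun n y => (f n y)%:E) _ _)).
  - by move=> n; exact/measurable_EFinP.
  - by move=> n y _; rewrite lee_fin.
  - exact: limn_einf_le.
apply: ae_ge0_le_integral => //.
- by move=> y _; rewrite lee_fin.
- exact/measurable_EFinP.
- move=> y _; rewrite limn_einf_lim; apply: lime_ge; first exact: is_cvg_einfs.
  by apply: nearW => n; apply: le_ereal_inf_tmp => _ [m _ <-]; rewrite lee_fin.
- rewrite (_ : (fun x => _) = (fun x => - limn_esup (fun n => - (f n x)%:E))%E).
    apply: measurableT_comp => //; apply: measurable_fun_limn_esup => n.
    by apply/measurable_EFinP; exact: measurableT_comp.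
  by apply/funext => x; rewrite limn_esupN oppeK.
- apply: filterS fg => y fgy _.
  have /cvg_limn_einf_sup[-> _] : (f n y)%:E @[n --> \oo] --> (g y)%:E.
    by apply: cvg_EFin => //; exact: nearW.
  by [].
Qed.

Lemma measurable_osc d2 (T : measurableType d2) (m : {sigma_finite_measure set T -> \bar R})
    (th : Y -> T -> R) (h : T -> R[i]) :
  measurable_fun setT (fun z : Y * T => th z.1 z.2) ->
  measurable_fun setT (fun k => Rep (h k)) -> measurable_fun setT (fun k => Imp (h k)) ->
  measurable_fun setT (fun y => oscR m (th y) h) /\
  measurable_fun setT (fun y => oscI m (th y) h).
Proof.
move=> mth mr mi.
have mc : measurable_fun setT (fun z : Y * T => cos (th z.1 z.2)).
  by apply: measurableT_comp => //; exact: measurable_cosr.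
have ms : measurable_fun setT (fun z : Y * T => sin (th z.1 z.2)).
  by apply: measurableT_comp => //; exact: measurable_sinr.
have mr2 : measurable_fun setT (fun z : Y * T => Rep (h z.2)) by exact: (measurableT_comp mr measurable_snd).
have mi2 : measurable_fun setT (fun z : Y * T => Imp (h z.2)) by exact: (measurableT_comp mi measurable_snd).
split.
- apply: (@measurable_Rint1 _ _ _ _ _ m (fun z : Y * T => cos (th z.1 z.2) * Rep (h z.2) - sin (th z.1 z.2) * Imp (h z.2))).
  by apply: measurable_funB; apply: measurable_funM.
- apply: (@measurable_Rint1 _ _ _ _ _ m (fun z : Y * T => cos (th z.1 z.2) * Imp (h z.2) + sin (th z.1 z.2) * Rep (h z.2))).
  by apply: measurable_funD; apply: measurable_funM.
Qed.

Lemma measurable_osc2 d2 (T : measurableType d2) (m : {sigma_finite_measure set T -> \bar R})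
    (th : Y -> T -> R) (h : T -> R[i]) :
  measurable_fun setT (fun z : Y * T => th z.1 z.2) ->
  measurable_fun setT (fun k => Rep (h k)) -> measurable_fun setT (fun k => Imp (h k)) ->
  measurable_fun setT (fun y => osc2 m (th y) h).
Proof.
move=> mth mr mi; have [h1 h2] := measurable_osc m mth mr mi.
by apply: measurable_funD; apply: measurable_funX.
Qed.

Lemma cint_meas d2 (T : measurableType d2) (m : {measure set T -> \bar R}) (h : T -> R[i]) :
  cint m h -> measurable_fun setT (fun k => Rep (h k)) /\ measurable_fun setT (fun k => Imp (h k)).
Proof. by move=> [/rint_meas h1 /rint_meas h2]. Qed.

End abel_limit.

Section plancherel_le.
Context (R : realType).
Local Notation mu := (@lebesgue_measure R).

Lemma abelw_cvg (y : R) : (fun n => abelw n.+1%:R^-1 y) @ \oo --> (1 : R).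
Proof.
have c : (fun n => - (n.+1%:R^-1 * `|y|)) @ \oo --> (0 : R).
  rewrite -[X in _ --> X]oppr0 -(mul0r `|y|); apply: cvgN; apply: cvgM; last exact: cvg_cst.
  exact: cvg_harmonic.
rewrite -[X in _ --> X](@expR0 R); apply: (cvg_comp _ _ c); exact: continuous_expR.
Qed.

(* Plancherel's inequality in the variable [phi k]. *)
Lemma osc2_le (phi phi' : R -> R) (h : R -> R[i]) :
  (forall x : R, is_derive x 1 phi (phi' x)) -> continuous phi' ->
  (forall x, 0 <= phi' x) -> cint mu h -> (forall k, phi' k = 0 -> h k = 0) ->
  (\int[mu]_t (osc2 mu (fun k => t * phi k) h)%:E <=
    (2 * pi)%:E * \int[mu]_k (c2 (h k) / phi' k)%:E)%E.
Proof.
move=> dphi cphi' phi0 hi h0.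
have mphi : measurable_fun setT phi.
  apply: continuous_measurable_fun => x.
  by apply/differentiable_continuous/derivable1_diffP; case: (dphi x).
have mth : measurable_fun setT (fun z : R * R => z.1 * phi z.2).
  by apply: measurable_funM => //; exact: (measurableT_comp mphi measurable_snd).
have [mr mi] := cint_meas hi.
have mo : measurable_fun setT (fun t : R => osc2 mu (fun k => t * phi k) h).
  exact: (measurable_osc2 mu mth mr mi).
apply: (@fatou_le _ (measurableTypeR R) R mu (fun n t => abelw n.+1%:R^-1 t * osc2 mu (fun k => t * phi k) h) (fun t : R => osc2 mu (fun k => t * phi k) h)) => //.
- by move=> n; apply: measurable_funM => //; exact: measurable_abelw.
- by move=> n y; rewrite mulr_ge0 ?osc2_ge0 ?abelw_ge0.
- by move=> y; exact: osc2_ge0.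
- apply: aeW => y; rewrite -[X in _ --> X]mul1r; apply: cvgM; last exact: cvg_cst.
  exact: abelw_cvg.
move=> n; set e := n.+1%:R^-1; have e0 : 0 < e by rewrite invr_gt0.
apply: (@TT_schur _ _ _ _ _ mu mu (abelw e) (fun t k => t * phi k) h
   (fun k k' => poisson e (phi k - phi k')) _ _ _ _ _ _ _ _ _ phi') => //.
- by move=> y; exact: abelw_ge0.
- exact: rint_abelw.
- by move=> k k'; rewrite -Rint_abelw_cos//; apply: eq_Rint => y; rewrite mulrBr.
- by move=> k k'; rewrite -(@Rint_abelw_sin _ _ e0 (phi k - phi k')); apply: eq_Rint => y; rewrite mulrBr.
- by move=> k k'; exact: poisson_ge0.
- by move=> k k'; rewrite -poissonN opprB.
- apply: measurableT_comp; first exact: measurable_poisson.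
  by apply: measurable_funB; [exact: (measurableT_comp mphi measurable_fst)|exact: (measurableT_comp mphi measurable_snd)].
- exact: continuous_measurable_fun.
- by rewrite mulr_ge0// pi_ge0.
- move=> k; under eq_integral do rewrite -poissonN opprB.
  exact: poisson_deriv_le.
Qed.

Lemma plancherel_le (h : R -> R[i]) : cint mu h ->
  (\int[mu]_t (osc2 mu (fun k => t * k) h)%:E <= (2 * pi)%:E * \int[mu]_k (c2 (h k))%:E)%E.
Proof.
move=> hi; have -> : (\int[mu]_k (c2 (h k))%:E = \int[mu]_k (c2 (h k) / 1)%:E)%E.
  by apply: eq_integral => k _; rewrite divr1.
apply: (@osc2_le id (fun=> 1)) => //.
- by move=> x; exact: cst_continuous.
- by move=> k /eqP; rewrite oner_eq0.
Qed.

Lemma kato_le (h : R -> R[i]) : cint mu h -> h 0 = 0 ->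
  (\int[mu]_t (osc2 mu (fun k => t * k ^+ 3) h)%:E <=
    (2 * pi)%:E * \int[mu]_k (c2 (h k) / (3 * k ^+ 2))%:E)%E.
Proof.
move=> hi h0; apply: osc2_le => //.
- move=> x; apply: is_derive_eq; rewrite /GRing.scale/=.
  by set y : R := x; change (y * (y * 1 + y * 1) + y * y * 1 = 3 * y ^+ 2); ring.
- by move=> x; apply: cvgM; [exact: cvg_cst|exact: exprn_continuous].
- by move=> x; rewrite mulr_ge0// sqr_ge0.
- by move=> k /eqP; rewrite mulf_eq0 pnatr_eq0/= sqrf_eq0 => /eqP ->.
Qed.

End plancherel_le.

Section bilinear.
Context (R : realType).
Local Notation mu := (@lebesgue_measure R).
Local Notation mu2 := (prodm mu mu).

Lemma poisson_quadratic_le (e c xi : R) : 0 < e ->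
  (\int[mu]_k (poisson e (c - 3 * xi * k ^+ 2) * `|2 * xi * k|)%:E <= (4 / 3 * pi)%:E)%E.
Proof.
move=> e0.
pose g k := poisson e (c - 3 * xi * k ^+ 2) * `|2 * xi * k|.
have cg : continuous g.
  move=> x; apply: cvgM.
    apply: (@continuous_comp _ _ _ (fun k : R => c - 3 * xi * k ^+ 2)); last exact: continuous_poisson.
    apply: cvgB; first exact: cvg_cst.
    by apply: cvgM; [exact: cvg_cst|exact: exprn_continuous].
  by apply: cvg_norm; apply: cvgM; [exact: cvg_cst|exact: cvg_id].
have g0 x : 0 <= g x by rewrite mulr_ge0 ?poisson_ge0.
have mg : measurable_fun setT g by exact: continuous_measurable_fun.
rewrite (@ge0_symfun_integralT _ g)//; last first.
  by move=> x; rewrite /g /= sqrrN mulrN normrN.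
suff : (\int[mu]_(x in [set x | (0 <= x)%R]) (g x)%:E <= (2 / 3 * pi)%:E)%E.
  move=> /(lee_wpmul2l (x := 2%:E)) h; apply: (le_trans (h _)); first by rewrite lee_fin.
  by rewrite -EFinM lee_fin; have := pi_ge0 R; lra.
rewrite integral_mkcond; apply: integral_sup_segments.
- have m0 : measurable [set x : R | 0 <= x] by rewrite -set_itvcy.
  apply/(measurable_restrictT _ m0).
  by apply: measurable_funTS; apply/measurable_EFinP.
- by move=> x; rewrite patchE; case: ifPn => // _; rewrite lee_fin.
- move=> n; rewrite -integral_mkcondr.
  have -> : `[(- n%:R)%R, n%:R] `&` [set x : R | 0 <= x] = `[0, n%:R]%classic.
    apply/seteqP; split => x /=; rewrite !in_itv/=.
      by move=> [/andP[_ ->] ->].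
    by move=> /andP[x0 ->]; rewrite x0 andbT (le_trans _ x0)// oppr_le0.
  pose s : R := if 0 <= xi then 1 else -1.
  have sxi : `|xi| = s * xi.
    by rewrite /s; case: ifPn => [/ger0_norm ->|]; rewrite ?mul1r// -ltNge => /ltr0_norm ->; rewrite mulN1r.
  have ss : s * s = 1 by rewrite /s; case: ifPn => _; ring.
  apply: (@le_trans _ _ (\int[mu]_(x in `[0%R, n%:R]) ((1/3)%:E * (poisson e (3 * `|xi| * x ^+ 2 - s * c) * (6 * `|xi| * x))%:E))%E).
    rewrite le_eqVlt; apply/orP; left; apply/eqP; apply: eq_integral => x.
    rewrite inE/= in_itv/= => /andP[x0 _]; rewrite -EFinM; congr EFin.
    rewrite /g !normrM (ger0_norm x0) (ger0_norm (ler0n R 2)).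
    have -> : poisson e (3 * `|xi| * x ^+ 2 - s * c) = poisson e (c - 3 * xi * x ^+ 2).
      rewrite /poisson; congr (_ / (_ + _)).
      have -> : 3 * `|xi| * x ^+ 2 - s * c = (- s) * (c - 3 * xi * x ^+ 2) by rewrite sxi; ring.
      by rewrite exprMn sqrrN expr2 ss mul1r.
    by field.
  rewrite ge0_integralZl//; last 2 first.
  - apply/measurable_funTS; apply/measurable_EFinP; apply: measurable_funM.
      apply: measurableT_comp; first exact: measurable_poisson.
      by apply: measurable_funB => //; apply: measurable_funM => //; exact: measurable_funX.
    exact: measurable_funM.
  - move=> x /=; rewrite in_itv/= => /andP[x0 _]; rewrite lee_fin.
    by apply: mulr_ge0; [exact: poisson_ge0|rewrite !mulr_ge0].
  have := @poisson_FTC_le R e (s * c) (fun x => 6 * `|xi| * x) (fun x => 3 * `|xi| * x ^+ 2) 0 n%:R e0 (ler0n _ _).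
  move=> /(_ _ _)/(lee_wpmul2l (x := (1/3)%:E)) h.
  apply: (le_trans (h _ _ _)).
  + by rewrite lee_fin; lra.
  + move=> x; have -> : (fun x => 3 * `|xi| * x ^+ 2) = ((3 * `|xi|) \*: (@GRing.exp R ^~ 2)) by [].
    apply: is_derive_eq; rewrite /GRing.scale/=.
    by set y : R := x; change (3 * `|xi| * (y * 1 + y * 1) = 6 * `|xi| * y); ring.
  + by move=> x; apply: cvgM; [exact: cvg_cst|exact: cvg_id].
  + by rewrite -EFinM lee_fin; have := pi_ge0 R; lra.
Qed.

Lemma poisson_bilinear_le (e a b : R) : 0 < e ->
  (\int[mu2]_k (poisson e (a - (k.1 - k.2)) * poisson e (b - (k.1 ^+ 3 - k.2 ^+ 3)) *
     `|k.1 ^+ 2 - k.2 ^+ 2|)%:E <= (8 / 3 * pi ^+ 2)%:E)%E.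
Proof.
move=> e0.
pose G (k : R * R) := poisson e (a - (k.1 - k.2)) * poisson e (b - (k.1 ^+ 3 - k.2 ^+ 3)) *
     `|k.1 ^+ 2 - k.2 ^+ 2|.
have mP (f : R * R -> R) : measurable_fun setT f -> measurable_fun setT (fun z => poisson e (f z)).
  by move=> mf; apply: measurableT_comp => //; exact: measurable_poisson.
have mG : measurable_fun setT G.
  apply: measurable_funM; first apply: measurable_funM; first apply: mP.
  - by apply: measurable_funB => //; exact: measurable_funB.
  - by apply: mP; apply: measurable_funB => //; apply: measurable_funB; exact: measurable_funX.
  - by apply: measurableT_comp => //; apply: measurable_funB; exact: measurable_funX.
have G0 z : 0 <= G z.
  by apply: mulr_ge0 => //; apply: mulr_ge0; exact: poisson_ge0.
pose H (z : R * R) := G (z.1 + z.2, z.2).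
have mH : measurable_fun setT H.
  apply: (measurableT_comp mG); apply: measurable_fun_pair => //; exact: measurable_funD.
have mGE : measurable_fun setT (EFin \o G) by exact/measurable_EFinP.
rewrite -[leLHS]/(\int[mu2]_k (G k)%:E)%E [in leLHS]/prodm (@fubini_tonelli2 _ _ _ _ _ mu mu (EFin \o G))//.
rewrite /fubini_G.
have -> : (\int[mu]_y \int[mu]_x (G (x, y))%:E = \int[mu]_y \int[mu]_x (H (x, y))%:E)%E.
  apply: eq_integral => y _; rewrite (@ge0_integral_translate _ y)//=.
    by apply/measurable_EFinP; exact: (measurableT_comp mG (pair2_measurable y)).
  by move=> x; rewrite lee_fin.
have mHE : measurable_fun setT (EFin \o H) by exact/measurable_EFinP.
have HE0 z : (0 <= (EFin \o H) z)%E by rewrite lee_fin; exact: G0.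
rewrite -[X in (X <= _)%E](@fubini_tonelli _ _ _ _ _ mu mu (EFin \o H) mHE HE0)/=.
apply: (@le_trans _ _ (\int[mu]_x ((4 / 3 * pi)%:E * (poisson e (x - a) * 1)%:E))%E).
  apply: ge0_le_integral => //.
  - by move=> x _; apply: integral_ge0 => y _; exact: (HE0 (x, y)).
  - apply: (@measurable_fun_fubini_tonelli_F _ _ _ _ _ mu (EFin \o H)) => //.
  - apply: emeasurable_funM => //; apply/measurable_EFinP; apply: measurable_funM => //.
    apply: measurableT_comp; first exact: measurable_poisson.
    exact: measurable_funB.
  move=> x _.
  under eq_integral => y _.
    rewrite /H /G /= (_ : x + y - y = x); last by ring.
    rewrite -mulrA EFinM; over.
  rewrite ge0_integralZl//; last 3 first.
  - apply/measurable_EFinP; apply: measurable_funM.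
      apply: measurableT_comp; first exact: measurable_poisson.
      by apply: measurable_funB => //; apply: measurable_funB; apply: measurable_funX => //; exact: measurable_funD.
    by apply: measurableT_comp => //; apply: measurable_funB; apply: measurable_funX => //; exact: measurable_funD.
  - by move=> y _; rewrite lee_fin mulr_ge0 ?poisson_ge0.
  - by rewrite lee_fin poisson_ge0.
  rewrite mulr1 -poissonN opprB muleC; apply: lee_wpmul2r; first by rewrite lee_fin poisson_ge0.
  rewrite (@ge0_integral_translate _ (- (x / 2)))//; last 2 first.
  - apply/measurable_EFinP; apply: measurable_funM.
      apply: measurableT_comp; first exact: measurable_poisson.
      by apply: measurable_funB => //; apply: measurable_funB; apply: measurable_funX => //; exact: measurable_funD.
    by apply: measurableT_comp => //; apply: measurable_funB; apply: measurable_funX => //; exact: measurable_funD.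
  - by move=> y; rewrite lee_fin mulr_ge0 ?poisson_ge0.
  under eq_integral => y _.
    rewrite (_ : b - ((x + (y - x / 2)) ^+ 3 - (y - x / 2) ^+ 3) = (b - x ^+ 3 / 4) - 3 * x * y ^+ 2); last by field.
    rewrite (_ : (x + (y - x / 2)) ^+ 2 - (y - x / 2) ^+ 2 = 2 * x * y); last by field.
    over.
  exact: poisson_quadratic_le.
rewrite ge0_integralZl//; last 3 first.
- apply/measurable_EFinP; apply: measurable_funM => //.
  apply: measurableT_comp; first exact: measurable_poisson.
  exact: measurable_funB.
- by move=> y _; rewrite lee_fin mulr_ge0 ?poisson_ge0.
- by rewrite lee_fin mulr_ge0// pi_ge0.
have := @poisson_deriv_le R e a (fun=> 1) id e0.
move=> h; apply: le_trans (lee_wpmul2l _ (h _ _ _)) _ => //.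
- by rewrite lee_fin mulr_ge0// pi_ge0.
- by move=> x; exact: cst_continuous.
- by rewrite -EFinM (_ : 4 / 3 * pi * (2 * pi) = 8 / 3 * pi ^+ 2)//; field.
Qed.

Definition phase2 (y : R * R) (k : R * R) : R :=
  y.2 * (k.1 - k.2) + y.1 * (k.1 ^+ 3 - k.2 ^+ 3).

Lemma bilinear_le (H : R * R -> R[i]) : cint mu2 H ->
  (forall k, k.1 ^+ 2 = k.2 ^+ 2 -> H k = 0) ->
  (\int[mu2]_y (osc2 mu2 (phase2 y) H)%:E <=
    (8 / 3 * pi ^+ 2)%:E * \int[mu2]_k (c2 (H k) / `|k.1 ^+ 2 - k.2 ^+ 2|)%:E)%E.
Proof.
move=> hi h0.
have m1 : measurable_fun setT (fun k : R * R => k.1 - k.2) by exact: measurable_funB.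
have m3 : measurable_fun setT (fun k : R * R => k.1 ^+ 3 - k.2 ^+ 3).
  by apply: measurable_funB; exact: measurable_funX.
have mth : measurable_fun setT (fun z : (R * R) * (R * R) => phase2 z.1 z.2).
  apply: measurable_funD; apply: measurable_funM.
  - exact: (measurableT_comp measurable_snd measurable_fst).
  - exact: (measurableT_comp m1 measurable_snd).
  - exact: (measurableT_comp measurable_fst measurable_fst).
  - exact: (measurableT_comp m3 measurable_snd).
have [mr mi] := cint_meas hi.
have mo : measurable_fun setT (fun y : R * R => osc2 mu2 (phase2 y) H).
  exact: (measurable_osc2 mu2 mth mr mi).
pose w n (y : R * R) := abelw n.+1%:R^-1 y.1 * abelw n.+1%:R^-1 y.2.
have mw n : measurable_fun setT (w n).
  by apply: measurable_funM; apply: measurableT_comp => //; exact: measurable_abelw.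
apply: (@fatou_le _ _ R mu2 (fun n y => w n y * osc2 mu2 (phase2 y) H) (fun y => osc2 mu2 (phase2 y) H)) => //.
- by move=> n; exact: (measurable_funM (mw n) mo).
- by move=> n y; rewrite !mulr_ge0 ?osc2_ge0 ?abelw_ge0.
- by move=> y; exact: osc2_ge0.
- apply: aeW => y; rewrite -[X in _ --> X]mul1r; apply: cvgM; last exact: cvg_cst.
  by rewrite -[X in _ --> X]mul1r; apply: cvgM; exact: abelw_cvg.
move=> n; rewrite /w; set e := n.+1%:R^-1; have e0 : 0 < e by rewrite invr_gt0.
have ic (a b : R) : rint mu2 (fun y : R * R => (abelw e y.1 * cos (y.1 * a)) * (abelw e y.2 * cos (y.2 * b))).
  by apply: (rint_prod (rint_abelw_cos e0 a) (rint_abelw_cos e0 b)).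
have isn (a b : R) : rint mu2 (fun y : R * R => (abelw e y.1 * sin (y.1 * a)) * (abelw e y.2 * sin (y.2 * b))).
  by apply: (rint_prod (rint_abelw_sin e0 a) (rint_abelw_sin e0 b)).
have ics (a b : R) : rint mu2 (fun y : R * R => (abelw e y.1 * cos (y.1 * a)) * (abelw e y.2 * sin (y.2 * b))).
  by apply: (rint_prod (rint_abelw_cos e0 a) (rint_abelw_sin e0 b)).
have isc (a b : R) : rint mu2 (fun y : R * R => (abelw e y.1 * sin (y.1 * a)) * (abelw e y.2 * cos (y.2 * b))).
  by apply: (rint_prod (rint_abelw_sin e0 a) (rint_abelw_cos e0 b)).
have mW : measurable_fun setT (fun k : R * R => `|k.1 ^+ 2 - k.2 ^+ 2|).
  by apply: measurableT_comp => //; apply: measurable_funB; exact: measurable_funX.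
pose K (k k' : R * R) := poisson e ((k.1 - k.2) - (k'.1 - k'.2)) *
   poisson e ((k.1 ^+ 3 - k.2 ^+ 3) - (k'.1 ^+ 3 - k'.2 ^+ 3)).
apply: (@TT_schur _ _ _ _ _ mu2 mu2 (fun y => abelw e y.1 * abelw e y.2) phase2 H
   K _ _ _ _ _ _ _ _ _ (fun k => `|k.1 ^+ 2 - k.2 ^+ 2|)) => //.
- by move=> y; rewrite mulr_ge0 ?abelw_ge0.
- exact: (rint_prod (rint_abelw e0) (rint_abelw e0)).
- move=> k k'; pose a := k.1 ^+ 3 - k.2 ^+ 3 - (k'.1 ^+ 3 - k'.2 ^+ 3); pose b := k.1 - k.2 - (k'.1 - k'.2).
  transitivity (\int[mu2]_y ((abelw e y.1 * cos (y.1 * a)) * (abelw e y.2 * cos (y.2 * b)) -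
      (abelw e y.1 * sin (y.1 * a)) * (abelw e y.2 * sin (y.2 * b)))).
    apply: eq_Rint => y; have -> : phase2 y k - phase2 y k' = y.1 * a + y.2 * b by rewrite /phase2 /a /b; ring.
    by rewrite cosD; ring.
  rewrite RintB//; rewrite /prodm (Rint_prodM (rint_abelw_cos e0 a) (rint_abelw_cos e0 b)).
  rewrite (Rint_prodM (rint_abelw_sin e0 a) (rint_abelw_sin e0 b)) !Rint_abelw_cos// !Rint_abelw_sin//.
  by rewrite mulr0 subr0 mulrC.
- move=> k k'; pose a := k.1 ^+ 3 - k.2 ^+ 3 - (k'.1 ^+ 3 - k'.2 ^+ 3); pose b := k.1 - k.2 - (k'.1 - k'.2).
  transitivity (\int[mu2]_y ((abelw e y.1 * sin (y.1 * a)) * (abelw e y.2 * cos (y.2 * b)) +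
      (abelw e y.1 * cos (y.1 * a)) * (abelw e y.2 * sin (y.2 * b)))).
    apply: eq_Rint => y; have -> : phase2 y k - phase2 y k' = y.1 * a + y.2 * b by rewrite /phase2 /a /b; ring.
    by rewrite sinD; ring.
  rewrite RintD//; rewrite /prodm (Rint_prodM (rint_abelw_sin e0 a) (rint_abelw_cos e0 b)).
  rewrite (Rint_prodM (rint_abelw_cos e0 a) (rint_abelw_sin e0 b)) !Rint_abelw_sin//.
  by rewrite mulr0 mul0r addr0.
- by move=> k k'; rewrite mulr_ge0 ?poisson_ge0.
- by move=> k k'; rewrite /K; congr (_ * _); rewrite -poissonN opprB.
- have mP (f : (R * R) * (R * R) -> R) : measurable_fun setT f -> measurable_fun setT (fun z => poisson e (f z)).
    by move=> mf; apply: measurableT_comp => //; exact: measurable_poisson.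
  apply: measurable_funM; apply: mP; apply: measurable_funB.
  + exact: (measurableT_comp m1 measurable_fst).
  + exact: (measurableT_comp m1 measurable_snd).
  + exact: (measurableT_comp m3 measurable_fst).
  + exact: (measurableT_comp m3 measurable_snd).
- by move=> k /eqP; rewrite normr_eq0 subr_eq0 => /eqP; exact: h0.
- by rewrite mulr_ge0// sqr_ge0.
- by move=> k; exact: poisson_bilinear_le.
Qed.

End bilinear.

(** * The refined Strichartz inequality *)

Section complex_parts.
Context (R : realType).
Implicit Types z w : R[i].

Lemma ReD z w : Rep (z + w) = Rep z + Rep w. Proof. by case: z; case: w. Qed.
Lemma ImD z w : Imp (z + w) = Imp z + Imp w. Proof. by case: z; case: w. Qed.
Lemma ReN z : Rep (- z) = - Rep z. Proof. by case: z. Qed.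
Lemma ImN z : Imp (- z) = - Imp z. Proof. by case: z. Qed.
Lemma ReB z w : Rep (z - w) = Rep z - Rep w. Proof. by rewrite ReD ReN. Qed.
Lemma ImB z w : Imp (z - w) = Imp z - Imp w. Proof. by rewrite ImD ImN. Qed.
Lemma ReM z w : Rep (z * w) = Rep z * Rep w - Imp z * Imp w.
Proof. by case: z; case: w. Qed.
Lemma ImM z w : Imp (z * w) = Rep z * Imp w + Imp z * Rep w.
Proof. by case: z => a b; case: w => c d /=; ring. Qed.

Lemma c2_0 : c2 (0 : R[i]) = 0. Proof. by rewrite /c2/= expr0n addr0. Qed.

Lemma c2M z w : c2 (z * w) = c2 z * c2 w.
Proof. by rewrite /c2 ReM ImM; ring. Qed.

Lemma c2N z : c2 (- z) = c2 z. Proof. by rewrite /c2 ReN ImN !sqrrN. Qed.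

Lemma c2Z (r : R) z : c2 (r%:C%C * z) = r ^+ 2 * c2 z.
Proof. by rewrite c2M; congr (_ * _); rewrite /c2/= expr0n addr0. Qed.

Lemma c2_eq0 z : c2 z = 0 -> z = 0.
Proof.
case: z => a b /eqP; rewrite /c2/= paddr_eq0 ?sqr_ge0// !sqrf_eq0.
by move=> /andP[/eqP -> /eqP ->].
Qed.

Lemma c2D_le z w : c2 (z + w) <= 2 * c2 z + 2 * c2 w.
Proof.
rewrite /c2 ReD ImD; have := sqr_ge0 (Rep z - Rep w); have := sqr_ge0 (Imp z - Imp w).
nra.
Qed.

End complex_parts.

Section measurable_modulus.
Context d (T : measurableType d) (R : realType).
Implicit Types g h : T -> R[i].

Lemma measurable_c2 h : measurable_fun setT (fun x => Rep (h x)) ->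
  measurable_fun setT (fun x => Imp (h x)) -> measurable_fun setT (fun x => c2 (h x)).
Proof. by move=> mr mi; apply: measurable_funD; exact: measurable_funX. Qed.

Lemma measurable_c2B g h : measurable_fun setT (fun x => Rep (g x)) ->
  measurable_fun setT (fun x => Imp (g x)) -> measurable_fun setT (fun x => Rep (h x)) ->
  measurable_fun setT (fun x => Imp (h x)) -> measurable_fun setT (fun x => c2 (g x - h x)).
Proof.
move=> gr gi hr hi; apply: measurable_c2; [under eq_fun do rewrite ReB|under eq_fun do rewrite ImB];
  exact: measurable_funB.
Qed.

End measurable_modulus.

Section cut_tensor.
Context (T : Type) (R : realType).
Implicit Types (h : T -> R[i]).

Definition cut (P : T -> bool) h k : R[i] := if P k then h k else 0.

Lemma c2_cut P h k : c2 (cut P h k) = if P k then c2 (h k) else 0.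
Proof. by rewrite /cut; case: ifP => //; rewrite c2_0. Qed.

Lemma cutC (P Q : T -> bool) h : (forall k, Q k = ~~ P k) ->
  h = (fun k => cut P h k + cut Q h k).
Proof.
by move=> PQ; apply/funext => k; rewrite /cut PQ; case: (P k); rewrite /= ?addr0 ?add0r.
Qed.

Definition tens h (k : T * T) : R[i] :=
  Complex (Rep (h k.1) * Rep (h k.2) + Imp (h k.1) * Imp (h k.2))
          (Imp (h k.1) * Rep (h k.2) - Rep (h k.1) * Imp (h k.2)).

Lemma c2_tens h k : c2 (tens h k) = c2 (h k.1) * c2 (h k.2).
Proof. by rewrite /c2/=; ring. Qed.

End cut_tensor.

Section csquare_integrable.
Context d (T : measurableType d) (R : realType) (m : {measure set T -> \bar R}).
Implicit Types (g h : T -> R[i]) (th : T -> R).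

Definition csq h := sqint m (fun k => Rep (h k)) /\ sqint m (fun k => Imp (h k)).
Definition cnsq h : R := nsq m (fun k => Rep (h k)) + nsq m (fun k => Imp (h k)).

Lemma cnsq_ge0 h : 0 <= cnsq h.
Proof. by rewrite addr_ge0 ?nsq_ge0. Qed.

Lemma rint_c2 h : csq h -> rint m (fun k => c2 (h k)).
Proof. by move=> [[_ h1] [_ h2]]; exact: rintD. Qed.

Lemma cnsqE h : csq h -> (\int[m]_k (c2 (h k))%:E)%E = (cnsq h)%:E.
Proof.
move=> hh; rewrite rint_EFin; last exact: rint_c2.
by case: hh => [[_ h1] [_ h2]]; rewrite /cnsq /nsq -RintD.
Qed.

Lemma csqP h : measurable_fun setT (fun k => Rep (h k)) ->
  measurable_fun setT (fun k => Imp (h k)) ->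
  (\int[m]_k (c2 (h k))%:E < +oo)%E -> csq h.
Proof.
move=> mr mi hl; have mc : measurable_fun setT (fun k => c2 (h k)).
  by apply: measurable_funD; exact: measurable_funX.
split; apply: sqintP => //; apply: le_lt_trans hl; apply: ge0_le_integral => //.
- by move=> k _; rewrite lee_fin sqr_ge0.
- by apply/measurable_EFinP; exact: measurable_funX.
- exact/measurable_EFinP.
- by move=> k _; rewrite lee_fin lerDl sqr_ge0.
- by move=> k _; rewrite lee_fin sqr_ge0.
- by apply/measurable_EFinP; exact: measurable_funX.
- exact/measurable_EFinP.
- by move=> k _; rewrite lee_fin lerDr sqr_ge0.
Qed.

Lemma csq_meas h : csq h -> measurable_fun setT (fun k => Rep (h k)) /\
  measurable_fun setT (fun k => Imp (h k)).
Proof. by move=> [[h1 _] [h2 _]]. Qed.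

Lemma csqD g h : csq g -> csq h -> csq (fun k => g k + h k).
Proof.
move=> [g1 g2] [h1 h2]; split.
- by under [X in sqint _ X]eq_fun do rewrite ReD; exact: sqintD.
- by under [X in sqint _ X]eq_fun do rewrite ImD; exact: sqintD.
Qed.

Lemma csqB g h : csq g -> csq h -> csq (fun k => g k - h k).
Proof.
move=> [g1 g2] [h1 h2]; split.
- by under [X in sqint _ X]eq_fun do rewrite ReB; exact: sqintB.
- by under [X in sqint _ X]eq_fun do rewrite ImB; exact: sqintB.
Qed.

Lemma oscRD th g h : measurable_fun setT th -> cint m g -> cint m h ->
  oscR m th (fun k => g k + h k) = oscR m th g + oscR m th h.
Proof.
move=> mth gi hi; rewrite /oscR -RintD; [|exact: rint_oscR|exact: rint_oscR].
by apply: eq_Rint => k; rewrite ReD ImD; ring.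
Qed.

Lemma oscID th g h : measurable_fun setT th -> cint m g -> cint m h ->
  oscI m th (fun k => g k + h k) = oscI m th g + oscI m th h.
Proof.
move=> mth gi hi; rewrite /oscI -RintD; [|exact: rint_oscI|exact: rint_oscI].
by apply: eq_Rint => k; rewrite ReD ImD; ring.
Qed.

Lemma oscRB th g h : measurable_fun setT th -> cint m g -> cint m h ->
  oscR m th (fun k => g k - h k) = oscR m th g - oscR m th h.
Proof.
move=> mth gi hi; rewrite /oscR -RintB; [|exact: rint_oscR|exact: rint_oscR].
by apply: eq_Rint => k; rewrite ReB ImB; ring.
Qed.

Lemma oscIB th g h : measurable_fun setT th -> cint m g -> cint m h ->
  oscI m th (fun k => g k - h k) = oscI m th g - oscI m th h.
Proof.
move=> mth gi hi; rewrite /oscI -RintB; [|exact: rint_oscI|exact: rint_oscI].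
by apply: eq_Rint => k; rewrite ReB ImB; ring.
Qed.

Lemma cintD g h : cint m g -> cint m h -> cint m (fun k => g k + h k).
Proof.
move=> [g1 g2] [h1 h2]; split.
- by rewrite (_ : _ \o _ = fun k => Rep (g k) + Rep (h k)); [exact: rintD|apply/funext => k; exact: ReD].
- by rewrite (_ : _ \o _ = fun k => Imp (g k) + Imp (h k)); [exact: rintD|apply/funext => k; exact: ImD].
Qed.

Lemma cintB g h : cint m g -> cint m h -> cint m (fun k => g k - h k).
Proof.
move=> [g1 g2] [h1 h2]; split.
- by rewrite (_ : _ \o _ = fun k => Rep (g k) - Rep (h k)); [exact: rintB|apply/funext => k; exact: ReB].
- by rewrite (_ : _ \o _ = fun k => Imp (g k) - Imp (h k)); [exact: rintB|apply/funext => k; exact: ImB].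
Qed.

Lemma measurable_cut P h : measurable_fun setT P ->
  measurable_fun setT (fun k => Rep (h k)) -> measurable_fun setT (fun k => Imp (h k)) ->
  measurable_fun setT (fun k => Rep (cut P h k)) /\ measurable_fun setT (fun k => Imp (cut P h k)).
Proof.
move=> mP mr mi; split.
- rewrite (_ : (fun k => _) = fun k => if P k then Rep (h k) else 0).
    exact: measurable_fun_ifT.
  by apply/funext => k; rewrite /cut; case: ifP.
- rewrite (_ : (fun k => _) = fun k => if P k then Imp (h k) else 0).
    exact: measurable_fun_ifT.
  by apply/funext => k; rewrite /cut; case: ifP.
Qed.

Lemma cint_cut P h : measurable_fun setT P -> cint m h -> cint m (cut P h).
Proof.
move=> mP hi; have [mr mi] := cint_meas hi; have [m1 m2] := measurable_cut mP mr mi.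
case: hi => h1 h2; split; [apply: (rint_le m1 (rint_abs h1))|apply: (rint_le m2 (rint_abs h2))] => k;
  by rewrite /cut /=; case: ifP => //= _; rewrite normr0.
Qed.

Lemma csq_cut P h : measurable_fun setT P -> csq h -> csq (cut P h).
Proof.
move=> mP hi; have [mr mi] := csq_meas hi; have [m1 m2] := measurable_cut mP mr mi.
apply: csqP => //.
apply: (@le_lt_trans _ _ (\int[m]_k (c2 (h k))%:E)%E); last by rewrite cnsqE// ltry.
apply: ge0_le_integral => //.
- by move=> k _; rewrite lee_fin c2_ge0.
- by apply/measurable_EFinP; apply: measurable_funD; exact: measurable_funX.
- by apply/measurable_EFinP; apply: measurable_funD; exact: measurable_funX.
- by move=> k _; rewrite lee_fin c2_cut; case: ifP => // _; exact: c2_ge0.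
Qed.

Lemma cnsq_cut_le P h : measurable_fun setT P -> csq h -> cnsq (cut P h) <= cnsq h.
Proof.
move=> mP hi; have hc := csq_cut mP hi.
rewrite -lee_fin -!cnsqE//; apply: ge0_le_integral => //.
- by move=> k _; rewrite lee_fin c2_ge0.
- by apply/measurable_EFinP; exact: rint_meas (rint_c2 hc).
- by apply/measurable_EFinP; exact: rint_meas (rint_c2 hi).
- by move=> k _; rewrite lee_fin c2_cut; case: ifP => // _; exact: c2_ge0.
Qed.

End csquare_integrable.

Section tensor.
Context d (T : measurableType d) (R : realType) (m : {sigma_finite_measure set T -> \bar R}).
Implicit Types (h : T -> R[i]) (th : T -> R).

Lemma cint_tens h : cint m h -> cint (prodm m m) (tens h).
Proof.
move=> [hr hi]; split.
- exact: (rintD (rint_prod hr hr) (rint_prod hi hi)).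
- exact: (rintB (rint_prod hi hr) (rint_prod hr hi)).
Qed.

Lemma osc2_tens th h : measurable_fun setT th -> cint m h ->
  osc2 m th h = oscR (prodm m m) (fun k => th k.1 - th k.2) (tens h).
Proof.
move=> mth hi; have hA := rint_oscR mth hi; have hB := rint_oscI mth hi.
rewrite /osc2 !expr2 -(Rint_prodM hA hA) -(Rint_prodM hB hB).
rewrite -(RintD (rint_prod hA hA) (rint_prod hB hB)).
by apply: eq_Rint => k; rewrite cosB sinB /=; ring.
Qed.

End tensor.

Section refined_strichartz.
Context (R : realType).
Local Notation mu := (@lebesgue_measure R).
Local Notation mu2 := (prodm mu mu).
Implicit Types (h : R -> R[i]).

Definition phase1 (y : R * R) (k : R) : R := y.2 * k + y.1 * k ^+ 3.

Lemma measurable_phase1 : measurable_fun setT (fun z : (R * R) * R => phase1 z.1 z.2).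
Proof.
apply: measurable_funD; apply: measurable_funM => //.
- exact: (measurableT_comp measurable_snd measurable_fst).
- exact: (measurableT_comp measurable_fst measurable_fst).
- by apply: measurable_funX.
Qed.

Lemma measurable_phase1r y : measurable_fun setT (phase1 y).
Proof.
by apply: measurable_funD; apply: measurable_funM => //; apply: measurable_funX.
Qed.

Lemma phase2E y k : phase2 y k = phase1 y k.1 - phase1 y k.2.
Proof. by rewrite /phase2 /phase1; ring. Qed.

Lemma measurable_lt_norm (N : R) : measurable_fun setT (fun k : R => `|k| < N).
Proof. by apply: measurable_fun_ltr => //; exact: measurableT_comp. Qed.

Lemma measurable_le_norm (N : R) : measurable_fun setT (fun k : R => N <= `|k|).
Proof. by apply: measurable_fun_ler => //; exact: measurableT_comp. Qed.

Lemma csq_supp_cint h (K : R) : csq mu h -> (forall k, K < `|k| -> h k = 0) -> cint mu h.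
Proof.
move=> [[mr h1] [mi h2]] hK.
have i1 : rint mu (fun k : R => \1_(`[- K, K]%classic) k) by exact: integrable_indic_itv.
have H (f : R -> R) : measurable_fun setT f -> rint mu (fun k => f k ^+ 2) ->
    (forall k, K < `|k| -> f k = 0) -> rint mu f.
  move=> mf f2 f0; apply: (@rint_le _ _ _ mu f _ mf (rintD i1 f2)) => k.
  rewrite indicE; have [kK|kK] := ltP K `|k|.
    by rewrite f0// normr0 addr_ge0 ?sqr_ge0.
  rewrite mem_set/=; last by rewrite in_itv/= -ler_norml.
  by rewrite -(real_normK (num_real (f k))); have := sqr_ge0 (`|f k| - 1); nra.
by split; apply: H => // k kK; rewrite /= hK.
Qed.

Lemma integral_pred d (T : measurableType d) (m : {measure set T -> \bar R}) (P : T -> bool) : measurable_fun setT P ->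
  (\int[m]_k ((P k)%:R%:E) = m [set k | P k])%E.
Proof.
move=> mP; have mS : measurable [set k | P k].
  by have := mP measurableT [set true]; rewrite setTI => /(_ _); apply.
transitivity (\int[m]_k (\1_[set k | P k] k)%:E)%E; last first.
  by rewrite integral_indic// setIT.
apply: eq_integral => k _; rewrite indicE; congr (_%:R%:E).
by case Pk: (P k); [rewrite mem_set|rewrite memNset//= Pk].
Qed.

Lemma lebesgue_integral_pred (P : R -> bool) : measurable_fun setT P ->
  (\int[mu]_k ((P k)%:R%:E) = mu [set k | P k])%E.
Proof. exact: (@integral_pred _ _ mu P). Qed.

Lemma large_summand (p q p' q' s : R) : s < (p + p') ^+ 2 + (q + q') ^+ 2 ->
  p ^+ 2 + q ^+ 2 <= s / 4 -> s / 4 <= p' ^+ 2 + q' ^+ 2.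
Proof. by have := sqr_ge0 (p - p'); have := sqr_ge0 (q - q'); nra. Qed.

Section one_function.
Variables (h : R -> R[i]) (K M b : R).
Hypothesis hh : csq mu h.
Hypothesis hK : forall k, K < `|k| -> h k = 0.
Hypothesis M0 : 0 < M.
Hypothesis hM : forall N y, 0 < N ->
  osc2 mu (phase1 y) (cut (fun k : R => `|k| < N) h) <= M * N.
Hypothesis b0 : 0 < b.
Hypothesis hb : cnsq mu h <= b.

Let hi : cint mu h. Proof. exact: csq_supp_cint hK. Qed.
Let mr : measurable_fun setT (fun k => Rep (h k)). Proof. by case: (cint_meas hi). Qed.
Let mi : measurable_fun setT (fun k => Imp (h k)). Proof. by case: (cint_meas hi). Qed.

(* For [s] comparable to |E h(y)|^2, the frequencies below [Ns s] are negligible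
   by [hM], and so are the near-diagonal pairs in the expansion of the square;
   the remaining pairs [H s] fall under the bilinear estimate. *)
Let Ns (s : R) := s / (4 * M).
Let ls (s : R) := s / (32 * b).
Let g (s : R) : R -> R[i] := cut (fun k : R => Ns s <= `|k|) h.
Let far s (k : R * R) : bool := ls s <= `| `|k.1| - `|k.2| |.
Let near s (k : R * R) : bool := `| `|k.1| - `|k.2| | < ls s.
Let H s : R * R -> R[i] := cut (far s) (tens (g s)).

Let mdist : measurable_fun setT (fun k : R * R => `| `|k.1| - `|k.2| |).
Proof.
apply: measurableT_comp => //.
by apply: measurable_funB; apply: measurableT_comp.
Qed.

Let mfar s : measurable_fun setT (far s).
Proof. exact: measurable_fun_ler. Qed.

Let mnear s : measurable_fun setT (near s).
Proof. exact: measurable_fun_ltr. Qed.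

Let cint_g s : cint mu (g s).
Proof. by apply: cint_cut hi; exact: measurable_le_norm. Qed.

Let csq_g s : csq mu (g s).
Proof. by apply: csq_cut hh; exact: measurable_le_norm. Qed.

Let cint_tg s : cint mu2 (tens (g s)).
Proof. exact: (cint_tens (cint_g s)). Qed.

Let cint_H s : cint mu2 (H s).
Proof. exact: (@cint_cut _ _ _ mu2 _ _ (mfar s) (cint_tg s)). Qed.

Let mphase2 (y : R * R) : measurable_fun setT (phase2 y).
Proof.
rewrite (_ : phase2 y = fun k => phase1 y k.1 - phase1 y k.2).
  by apply: measurable_funB; apply: measurableT_comp => //; exact: measurable_phase1r.
by apply/funext => k; exact: phase2E.
Qed.

Let measure_near (k l : R) : 0 <= l ->
  (mu [set k' : R | (`| `|k| - `|k'| | < l)%R] <= (4 * l)%:E)%E.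
Proof.
move=> l0.
apply: (@le_trans _ _ (mu (ball (`|k|) l `|` ball (- `|k|) l))).
  apply: le_outer_measure => k' /= kl.
  have [k0|k0] := leP 0 k'; [left|right]; rewrite /ball/=.
    by rewrite (ger0_norm k0) in kl.
  by rewrite (ltr0_norm k0) opprK in kl; rewrite -normrN opprB addrC opprK.
apply: (le_trans (measureU2 _ _ _)) => //; [exact: measurable_ball|exact: measurable_ball|].
change (mu (ball (`|k|)%R l) + mu (ball (- `|k|)%R l) <= (4 * l)%:E)%E.
have e c : mu (ball c l) = (l *+ 2)%:E by exact: lebesgue_measure_ball.
by rewrite !e -EFinD lee_fin mulr2n; lra.
Qed.

Let near_le s (y : R * R) : 0 < s ->
  `|oscR mu2 (phase2 y) (cut (near s) (tens (g s)))| <= s / 8.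
Proof.
move=> s0; set G := g s; have Gi : cint mu G := cint_g s.
have Gq : csq mu G := csq_g s.
have ci : cint mu2 (cut (near s) (tens G)) := @cint_cut _ _ _ mu2 _ _ (mnear s) (cint_tg s).
have l0 : 0 <= ls s by rewrite divr_ge0 ?mulr_ge0// ltW.
have mc : measurable_fun setT (fun k : R => c2 (G k)) := rint_meas (rint_c2 Gq).
have ri := @rint_oscR _ _ _ mu2 _ _ (mphase2 y) ci.
apply: (le_trans (Rint_abs ri)); rewrite -lee_fin -(rint_EFin (rint_abs ri)).
pose q1 (k : R * R) : R := c2 (G k.1) * (near s k)%:R.
pose q2 (k : R * R) : R := c2 (G k.2) * (near s k)%:R.
have mn : measurable_fun setT (fun k : R * R => (near s k)%:R : R).
  rewrite (_ : (fun k => _) = fun k => if near s k then 1 else 0); first exact: measurable_fun_ifT.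
  by apply/funext => k; case: near.
have mq1 : measurable_fun setT q1.
  by apply: measurable_funM => //; exact: (measurableT_comp mc measurable_fst).
have mq2 : measurable_fun setT q2.
  by apply: measurable_funM => //; exact: (measurableT_comp mc measurable_snd).
have q10 k : 0 <= q1 k by apply: mulr_ge0; [exact: c2_ge0|exact: ler0n].
have q20 k : 0 <= q2 k by apply: mulr_ge0; [exact: c2_ge0|exact: ler0n].
have mE1 : measurable_fun setT (EFin \o q1) by exact/measurable_EFinP.
have mE2 : measurable_fun setT (EFin \o q2) by exact/measurable_EFinP.
have qE10 k : (0 <= (EFin \o q1) k)%E by rewrite lee_fin; exact: q10.
have qE20 k : (0 <= (EFin \o q2) k)%E by rewrite lee_fin; exact: q20.
have mcE : measurable_fun setT (fun k : R => (c2 (G k))%:E) by exact/measurable_EFinP.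
have Gb : (\int[mu]_k ((4 * ls s)%:E * (c2 (G k))%:E) <= (s / 8)%:E)%E.
  rewrite ge0_integralZl//; last 2 first.
  - by move=> k _; rewrite lee_fin c2_ge0.
  - by rewrite lee_fin mulr_ge0.
  rewrite cnsqE// -EFinM lee_fin.
  have h1 : cnsq mu G <= b by apply: le_trans hb; exact: (@cnsq_cut_le _ _ _ mu _ _ (measurable_le_norm (Ns s)) hh).
  have h2 : 4 * ls s * cnsq mu G <= 4 * ls s * b by apply: ler_wpM2l => //; rewrite mulr_ge0.
  apply: (le_trans h2); rewrite /ls le_eqVlt; apply/orP; left; apply/eqP; field.
  by rewrite gt_eqF.
have fib (P : R -> bool) (c : R) : measurable_fun setT P -> 0 <= c ->
    (mu [set k | P k] <= (4 * ls s)%:E)%E ->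
    (\int[mu]_k (c * (P k)%:R)%:E <= (4 * ls s)%:E * c%:E)%E.
  move=> mP c0 mb; under eq_integral do rewrite EFinM.
  rewrite ge0_integralZl//; last first.
    apply/measurable_EFinP; rewrite (_ : (fun k => _) = fun k => if P k then 1 else 0); first exact: measurable_fun_ifT.
    by apply/funext => k; case: (P k).
  by rewrite lebesgue_integral_pred// muleC; apply: lee_wpmul2r; rewrite ?lee_fin.
have I1 : (\int[mu2]_k (q1 k)%:E <= (s / 8)%:E)%E.
  rewrite [in leLHS]/prodm (@fubini_tonelli1 _ _ _ _ _ mu mu (EFin \o q1) mE1 qE10).
  apply: le_trans Gb; apply: ge0_le_integral => //.
  - by move=> k _; apply: integral_ge0 => z _; exact: qE10.
  - exact: (@measurable_fun_fubini_tonelli_F _ _ _ _ _ mu (EFin \o q1)).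
  - by apply: emeasurable_funM.
  - move=> k _; rewrite /fubini_F/=; refine (fib (fun z => near s (k, z)) (c2 (G k)) _ (c2_ge0 _) _).
      exact: (measurableT_comp (mnear s) (pair1_measurable k)).
    exact: measure_near.
have I2 : (\int[mu2]_k (q2 k)%:E <= (s / 8)%:E)%E.
  rewrite [in leLHS]/prodm (@fubini_tonelli2 _ _ _ _ _ mu mu (EFin \o q2) mE2 qE20).
  apply: le_trans Gb; apply: ge0_le_integral => //.
  - by move=> k _; apply: integral_ge0 => z _; exact: qE20.
  - exact: (@measurable_fun_fubini_tonelli_G _ _ _ _ _ mu (EFin \o q2)).
  - by apply: emeasurable_funM.
  - move=> k _; rewrite /fubini_G/=; refine (fib (fun z => near s (z, k)) (c2 (G k)) _ (c2_ge0 _) _).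
    + exact: (measurableT_comp (mnear s) (pair2_measurable k)).
    + have := @measure_near k _ l0; congr (mu _ <= _)%E.
      by apply/funext => k'; rewrite /near /= distrC.
apply: (@le_trans _ _ (\int[mu2]_k (2^-1%:E * ((q1 k)%:E + (q2 k)%:E)))%E).
  apply: ge0_le_integral => //.
  - by apply/measurable_EFinP; exact: rint_meas (rint_abs ri).
  - by apply: emeasurable_funM => //; exact: (emeasurable_funD mE1 mE2).
  move=> k _; rewrite -EFinD -EFinM lee_fin /q1 /q2 /cut.
  case: (near s k); last by rewrite /= !mulr0 subrr normr0 addr0 mulr0.
  have -> : c2 (G k.1) * 1%:R = c2 (G k.1) by rewrite mulr1.
  have -> : c2 (G k.2) * 1%:R = c2 (G k.2) by rewrite mulr1.
  have := c2_tens G k; set p := Rep _; set q := Imp _; rewrite {1}/c2 -/p -/q.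
  have := cos2Dsin2 (phase2 y k); have := c2_ge0 (G k.1); have := c2_ge0 (G k.2).
  set C := cos _; set S := sin _; move: (c2 (G k.1)) (c2 (G k.2)) => u v v0 u0 cs e.
  rewrite -(ler_pXn2r (n := 2)) ?nnegrE//; last by rewrite mulr_ge0 ?addr_ge0.
  rewrite real_normK ?num_real//.
  have h1 : (C * p - S * q) ^+ 2 <= (C ^+ 2 + S ^+ 2) * (p ^+ 2 + q ^+ 2).
    by have := sqr_ge0 (C * q + S * p); nra.
  rewrite cs mul1r e in h1; apply: (le_trans h1).
  by have := sqr_ge0 (u - v); nra.
rewrite ge0_integralZl//; last 2 first.
- exact: (emeasurable_funD mE1 mE2).
- by move=> k _; apply: adde_ge0; [exact: qE10|exact: qE20].
rewrite ge0_integralD//; last 2 first.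
- by move=> k _; exact: qE10.
- by move=> k _; exact: qE20.
apply: (@le_trans _ _ (2^-1%:E * ((s / 8)%:E + (s / 8)%:E))%E).
  by apply: lee_wpmul2l; [rewrite lee_fin|exact: leeD].
by rewrite -EFinD -EFinM lee_fin; lra.
Qed.

Let far_ge s (y : R * R) : 0 < s -> s < osc2 mu (phase1 y) h ->
  s ^+ 2 / 64 <= osc2 mu2 (phase2 y) (H s).
Proof.
move=> s0 sv.
pose lo := cut (fun k : R => `|k| < Ns s) h.
have cl : cint mu lo by apply: cint_cut hi; exact: measurable_lt_norm.
have e1 : h = fun k => lo k + g s k.
  by apply: cutC => k; rewrite leNgt.
have Ns0 : 0 < Ns s by rewrite divr_gt0// mulr_gt0.
have lob : osc2 mu (phase1 y) lo <= s / 4.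
  apply: (le_trans (hM y Ns0)); rewrite /Ns le_eqVlt; apply/orP; left; apply/eqP; field.
  by rewrite gt_eqF.
have mp := measurable_phase1r y.
have hig : s / 4 <= osc2 mu (phase1 y) (g s).
  move: sv lob; rewrite {1}e1 /osc2 oscRD// oscID//.
  exact: large_summand.
move: hig; rewrite osc2_tens//.
have -> : (fun k => phase1 y k.1 - phase1 y k.2) = phase2 y.
  by apply/funext => k; rewrite phase2E.
have e2 : tens (g s) = fun k => cut (near s) (tens (g s)) k + H s k.
  by apply: cutC => k; rewrite /far /near leNgt.
rewrite [in X in X -> _]e2.
have cn : cint mu2 (cut (near s) (tens (g s))) := @cint_cut _ _ _ mu2 _ _ (mnear s) (cint_tg s).
rewrite (@oscRD _ _ _ mu2 _ _ _ (mphase2 y) cn (cint_H s)).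
have := near_le y s0; rewrite ler_norml => /andP[_ n1] n2.
rewrite /osc2; have p8 : s / 8 <= oscR mu2 (phase2 y) (H s) by lra.
have aux (p q : R) : s / 8 <= p -> s ^+ 2 / 64 <= p ^+ 2 + q ^+ 2.
  by move=> h1; have := sqr_ge0 q; have : 0 < s by []; nra.
exact: aux p8.
Qed.

Let c2_H s k : c2 (H s k) =
  if [&& Ns s <= `|k.1|, Ns s <= `|k.2| & far s k] then c2 (h k.1) * c2 (h k.2) else 0.
Proof.
rewrite /H c2_cut c2_tens /g !c2_cut.
by case: (far s k); case: (Ns s <= `|k.1|); case: (Ns s <= `|k.2|); rewrite //= ?mulr0 ?mul0r.
Qed.

Let mE : measurable_fun setT (fun y : R * R => osc2 mu (phase1 y) h).
Proof. exact: (measurable_osc2 mu measurable_phase1 mr mi). Qed.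

Let mR3 (f : (R * (R * R)) * (R * R) -> R) : measurable_fun setT f ->
  measurable_fun setT (fun z : R * (R * R) => \int[mu2]_k f (z, k)).
Proof. by move=> mf; exact: (@measurable_Rint1 _ _ _ _ R mu2 f). Qed.

Let p3 : measurable_fun setT (fun z : (R * (R * R)) * (R * R) => phase2 z.1.2 z.2).
Proof.
rewrite (_ : (fun z => _) = fun z : (R * (R * R)) * (R * R) => phase1 z.1.2 z.2.1 - phase1 z.1.2 z.2.2).
  have m1 : measurable_fun setT (fun z : (R * (R * R)) * (R * R) => (z.1.2, z.2.1)).
    apply: measurable_fun_pair.
      exact: (measurableT_comp measurable_snd measurable_fst).
    exact: (measurableT_comp measurable_fst measurable_snd).
  have m2 : measurable_fun setT (fun z : (R * (R * R)) * (R * R) => (z.1.2, z.2.2)).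
    apply: measurable_fun_pair.
      exact: (measurableT_comp measurable_snd measurable_fst).
    exact: (measurableT_comp measurable_snd measurable_snd).
  apply: measurable_funB.
    exact: (measurableT_comp measurable_phase1 m1).
  exact: (measurableT_comp measurable_phase1 m2).
by apply/funext => z; exact: phase2E.
Qed.

Let mH : measurable_fun setT (fun z : R * (R * R) => Rep (H z.1 z.2)) /\
  measurable_fun setT (fun z : R * (R * R) => Imp (H z.1 z.2)).
Proof.
have mN : measurable_fun setT (fun z : R * (R * R) => Ns z.1) by apply: measurable_funM.
have ml : measurable_fun setT (fun z : R * (R * R) => ls z.1) by apply: measurable_funM.
have k1 : measurable_fun setT (fun z : R * (R * R) => z.2.1).
  exact: (measurableT_comp measurable_fst measurable_snd).
have k2 : measurable_fun setT (fun z : R * (R * R) => z.2.2).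
  exact: (measurableT_comp measurable_snd measurable_snd).
have c1 : measurable_fun setT (fun z : R * (R * R) => Ns z.1 <= `|z.2.1|).
  by apply: measurable_fun_ler => //; exact: measurableT_comp.
have cc2 : measurable_fun setT (fun z : R * (R * R) => Ns z.1 <= `|z.2.2|).
  by apply: measurable_fun_ler => //; exact: measurableT_comp.
have c3 : measurable_fun setT (fun z : R * (R * R) => far z.1 z.2).
  by apply: measurable_fun_ler => //; exact: (measurableT_comp mdist measurable_snd).
pose r1 (z : R * (R * R)) : R := if Ns z.1 <= `|z.2.1| then Rep (h z.2.1) else 0.
pose i1 (z : R * (R * R)) : R := if Ns z.1 <= `|z.2.1| then Imp (h z.2.1) else 0.
pose r2 (z : R * (R * R)) : R := if Ns z.1 <= `|z.2.2| then Rep (h z.2.2) else 0.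
pose i2 (z : R * (R * R)) : R := if Ns z.1 <= `|z.2.2| then Imp (h z.2.2) else 0.
have mr1 : measurable_fun setT r1.
  by apply: measurable_fun_ifT => //; exact: (measurableT_comp mr k1).
have mi1 : measurable_fun setT i1.
  by apply: measurable_fun_ifT => //; exact: (measurableT_comp mi k1).
have mr2 : measurable_fun setT r2.
  by apply: measurable_fun_ifT => //; exact: (measurableT_comp mr k2).
have mi2 : measurable_fun setT i2.
  by apply: measurable_fun_ifT => //; exact: (measurableT_comp mi k2).
split.
- rewrite (_ : (fun z => _) = fun z => if far z.1 z.2 then r1 z * r2 z + i1 z * i2 z else 0).
    by apply: measurable_fun_ifT => //; apply: measurable_funD; exact: measurable_funM.
  apply/funext => z; rewrite /H /g /cut /r1 /r2 /i1 /i2.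
  by case: (far _ _) => //=; case: (_ <= _); case: (_ <= _).
- rewrite (_ : (fun z => _) = fun z => if far z.1 z.2 then i1 z * r2 z - r1 z * i2 z else 0).
    by apply: measurable_fun_ifT => //; apply: measurable_funB; exact: measurable_funM.
  apply/funext => z; rewrite /H /g /cut /r1 /r2 /i1 /i2.
  by case: (far _ _) => //=; case: (_ <= _); case: (_ <= _).
Qed.

Let mosc3 : measurable_fun setT (fun z : R * (R * R) => osc2 mu2 (phase2 z.2) (H z.1)).
Proof.
have [m1 m2] := mH.
have q : measurable_fun setT (fun z : (R * (R * R)) * (R * R) => (z.1.1, z.2)).
  apply: measurable_fun_pair => //; exact: (measurableT_comp measurable_fst measurable_fst).
have m1' : measurable_fun setT (fun z : (R * (R * R)) * (R * R) => Rep (H z.1.1 z.2)) by exact: (measurableT_comp m1 q).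
have m2' : measurable_fun setT (fun z : (R * (R * R)) * (R * R) => Imp (H z.1.1 z.2)) by exact: (measurableT_comp m2 q).
have mc : measurable_fun setT (fun z : (R * (R * R)) * (R * R) => cos (phase2 z.1.2 z.2)).
  by apply: measurableT_comp => //; exact: measurable_cosr.
have ms : measurable_fun setT (fun z : (R * (R * R)) * (R * R) => sin (phase2 z.1.2 z.2)).
  by apply: measurableT_comp => //; exact: measurable_sinr.
apply: measurable_funD; apply: measurable_funX.
- apply: (mR3 (f := fun z => cos (phase2 z.1.2 z.2) * Rep (H z.1.1 z.2) - sin (phase2 z.1.2 z.2) * Imp (H z.1.1 z.2))).
  by apply: measurable_funB; exact: measurable_funM.
- apply: (mR3 (f := fun z => cos (phase2 z.1.2 z.2) * Imp (H z.1.1 z.2) + sin (phase2 z.1.2 z.2) * Rep (H z.1.1 z.2))).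
  by apply: measurable_funD; exact: measurable_funM.
Qed.

Let pos (s : R) : R := if 0 < s then s else 0.

Let mpos : measurable_fun setT pos.
Proof. by apply: measurable_fun_ifT => //; exact: measurable_fun_ltr. Qed.

Let pos_ge0 s : 0 <= pos s. Proof. by rewrite /pos; case: ltP => // /ltW. Qed.

Let mslice y : measurable_fun setT (fun s : R => osc2 mu2 (phase2 y) (H s)).
Proof. exact: (measurableT_comp mosc3 (pair2_measurable y)). Qed.

Let layer y : (((osc2 mu (phase1 y) h) ^+ 4)%:E <=
  1024%:E * \int[mu]_s (pos s * osc2 mu2 (phase2 y) (H s))%:E)%E.
Proof.
set v := osc2 mu (phase1 y) h.
have v0 : 0 <= v by exact: osc2_ge0.
have mI : measurable_fun setT (fun s : R => (pos s * osc2 mu2 (phase2 y) (H s))%:E).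
  by apply/measurable_EFinP; apply: measurable_funM.
have I0 s : (0 <= (pos s * osc2 mu2 (phase2 y) (H s))%:E)%E.
  by rewrite lee_fin; apply: mulr_ge0 => //; exact: osc2_ge0.
pose P (s : R) := (v / 2 < s) && (s < v).
have mP : measurable_fun setT P.
  by apply: measurable_and; exact: measurable_fun_ltr.
have mPR : measurable_fun setT (fun s : R => (P s)%:R%:E : \bar R).
  apply/measurable_EFinP; rewrite (_ : (fun k => _) = fun k => if P k then 1 else 0); first exact: measurable_fun_ifT.
  by apply/funext => k; case: (P k).
have [c [vc cE]] : exists c : R, 0 <= c /\ v ^+ 3 / 512 = c.
  by exists (v ^+ 3 / 512); split=> [|//]; apply: divr_ge0; [exact: exprn_ge0|exact: ler0n].
apply: (@le_trans _ _ (1024%:E * \int[mu]_s (c%:E * (P s)%:R%:E))%E); last first.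
  apply: lee_wpmul2l; first by rewrite lee_fin ler0n.
  apply: ge0_le_integral => //.
  - by move=> s _; apply: mule_ge0; rewrite lee_fin.
  - by apply: emeasurable_funM.
  move=> s _; rewrite -EFinM lee_fin /P; case: andP => [[s1 s2]|_]; last first.
    by rewrite mulr0; have := I0 s; rewrite lee_fin.
  have s0 : 0 < s by apply: le_lt_trans s1; rewrite divr_ge0.
  have aux w : s ^+ 2 / 64 <= w -> c * 1 <= s * w.
    move=> w1; have w2 : v ^+ 2 / 256 <= w by apply: le_trans w1; nra.
    rewrite mulr1 -cE; have -> : v ^+ 3 / 512 = v / 2 * (v ^+ 2 / 256) by field.
    by apply: ler_pM; [exact: divr_ge0|apply: divr_ge0; [exact: sqr_ge0|exact: ler0n]|exact: ltW s1|exact: w2].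
  by rewrite /pos s0; exact: (aux _ (far_ge s0 s2)).
rewrite ge0_integralZl//.
  have -> : (\int[mu]_s ((P s)%:R%:E) = (v / 2)%:E)%E.
    rewrite lebesgue_integral_pred//.
    have -> : [set k | P k] = `]v / 2, v[%classic.
      by apply/seteqP; split => k /=; rewrite /P in_itv/=.
    by rewrite lebesgue_measure_itv/= lte_fin; case: ltP => [_|v2]; rewrite -?EFinB; congr EFin; lra.
  by rewrite -!EFinM lee_fin -cE le_eqVlt; apply/orP; left; apply/eqP; field.
Qed.

Let scale_integral k :
  (\int[mu]_s (pos s * (c2 (H s k) / `|k.1 ^+ 2 - k.2 ^+ 2|))%:E <=
    (64 * M * b * (c2 (h k.1) * c2 (h k.2)))%:E)%E.
Proof.
set D := `|k.1 ^+ 2 - k.2 ^+ 2|; set w := c2 (h k.1) * c2 (h k.2).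
pose d := `| `|k.1| - `|k.2| |.
have w0 : 0 <= w by apply: mulr_ge0; exact: c2_ge0.
have D0 : 0 <= D by exact: normr_ge0.
have DE : D = d * (`|k.1| + `|k.2|).
  rewrite /D /d -[X in _ * X](ger0_norm (addr_ge0 (normr_ge0 k.1) (normr_ge0 k.2))) -normrM.
  by congr `|_|; rewrite -(real_normK (num_real k.1)) -(real_normK (num_real k.2)); ring.
pose m := Num.min (4 * M * `|k.1|) (Num.min (4 * M * `|k.2|) (32 * b * d)).
have m0 : 0 <= m.
  have b00 := ltW b0; have M00 := ltW M0.
  by rewrite !le_min; apply/and3P; split; apply: mulr_ge0; rewrite ?normr_ge0// mulr_ge0.
pose P (s : R) := (0 < s) && (s <= m).
have mP : measurable_fun setT P.
  by apply: measurable_and; [exact: measurable_fun_ltr|exact: measurable_fun_ler].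
have mPR : measurable_fun setT (fun s : R => (P s)%:R%:E : \bar R).
  apply/measurable_EFinP; rewrite (_ : (fun k => _) = fun k => if P k then 1 else 0); first exact: measurable_fun_ifT.
  by apply/funext => s; case: (P s).
have [mRe mIm] := mH.
have mc : measurable_fun setT (fun s : R => c2 (H s k)).
  apply: measurable_funD; apply: measurable_funX.
    exact: (measurableT_comp mRe (pair2_measurable k)).
  exact: (measurableT_comp mIm (pair2_measurable k)).
apply: (@le_trans _ _ (\int[mu]_s ((m * (w / D))%:E * (P s)%:R%:E))%E).
  apply: ge0_le_integral => //.
  - move=> s _; rewrite lee_fin; apply: mulr_ge0 => //.
    by apply: divr_ge0 => //; exact: c2_ge0.
  - apply/measurable_EFinP; apply: measurable_funM => //.
    by apply: measurable_funM.
  - by apply: emeasurable_funM.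
  have nn s : 0 <= m * (w / D) * (P s)%:R.
    by apply: mulr_ge0 (ler0n _ _); apply: mulr_ge0 => //; exact: divr_ge0.
  move=> s _; rewrite -EFinM lee_fin /pos c2_H.
  case: ltP => [s0|]; last first.
    by move=> _; rewrite mul0r.
  case: and3P => [[a1 a2 a3]|_]; last first.
    by rewrite mul0r mulr0.
  have sm : s <= m.
    rewrite !le_min; apply/and3P; split.
    - by move: a1; rewrite /Ns ler_pdivrMr ?mulr_gt0// mulrC.
    - by move: a2; rewrite /Ns ler_pdivrMr ?mulr_gt0// mulrC.
    - by move: a3; rewrite /far /ls ler_pdivrMr ?mulr_gt0// mulrC.
  rewrite /P s0 sm mulr1; apply: ler_wpM2r => //.
  by rewrite divr_ge0.
rewrite ge0_integralZl//; last first.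
  by rewrite lee_fin mulr_ge0// divr_ge0.
have -> : (\int[mu]_s ((P s)%:R%:E) = m%:E)%E.
  rewrite lebesgue_integral_pred//.
  have -> : [set s | P s] = `]0, m]%classic.
    by apply/seteqP; split => s /=; rewrite /P in_itv/=.
  by rewrite lebesgue_measure_itv/= lte_fin; case: ltP => [_|v2]; rewrite -?EFinB; congr EFin; lra.
rewrite -EFinM lee_fin.
have [->|Dn] := eqVneq D 0.
  have b00 := ltW b0; have M00 := ltW M0.
  by rewrite invr0 !mulr0 mul0r mulr_ge0// mulr_ge0// mulr_ge0.
have Dp : 0 < D by rewrite lt_neqAle eq_sym Dn.
rewrite (_ : m * (w / D) * m = (m * m) * w / D); last by field.
rewrite ler_pdivrMr// [leRHS]mulrAC; apply: ler_wpM2r => //.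
have m1 : m <= 4 * M * `|k.1| by rewrite ge_min lexx.
have m2 : m <= 4 * M * `|k.2| by rewrite !ge_min lexx orbT.
have m3 : m <= 32 * b * d by rewrite !ge_min lexx !orbT.
have h1 := ler_pM m0 m0 m1 m3; have h2 := ler_pM m0 m0 m2 m3.
rewrite DE; apply: (@le_trans _ _ ((4 * M * `|k.1| * (32 * b * d) + 4 * M * `|k.2| * (32 * b * d)) / 2)).
  by lra.
by rewrite le_eqVlt; apply/orP; left; apply/eqP; field.
Qed.

Lemma refined_strichartz :
  (\int[mu2]_y ((osc2 mu (phase1 y) h) ^+ 4)%:E <=
    (1024 * (8 / 3 * pi ^+ 2) * 64 * M * b ^+ 3)%:E)%E.
Proof.
pose C : R := 8 / 3 * pi ^+ 2.
have C0 : 0 <= C by apply: mulr_ge0; [apply: divr_ge0|apply: sqr_ge0].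
have cE : (0 <= 1024%:E :> \bar R)%E by rewrite lee_fin; exact: ler0n.
have pos0 := pos_ge0.
pose F (z : R * (R * R)) : R := pos z.1 * osc2 mu2 (phase2 z.2) (H z.1).
have mF : measurable_fun setT F.
  by apply: measurable_funM => //; exact: (measurableT_comp mpos measurable_fst).
have F0 z : 0 <= F z by apply: mulr_ge0 => //; exact: osc2_ge0.
have mFE : measurable_fun setT (EFin \o F) by exact/measurable_EFinP.
have FE0 z : (0 <= (EFin \o F) z)%E by rewrite lee_fin.
pose G (z : R * (R * R)) : R := pos z.1 * (c2 (H z.1 z.2) / `|z.2.1 ^+ 2 - z.2.2 ^+ 2|).
have [mRe mIm] := mH.
have mG : measurable_fun setT G.
  apply: measurable_funM; first exact: (measurableT_comp mpos measurable_fst).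
  apply: measurable_funM.
    by apply: measurable_funD; apply: measurable_funX.
  have m1 : measurable_fun setT (fun k : R * R => `|k.1 ^+ 2 - k.2 ^+ 2|^-1).
    apply: (measurable_fun_invr); apply: measurableT_comp => //.
    by apply: measurable_funB; exact: measurable_funX.
  exact: (measurableT_comp m1 measurable_snd).
have G0 z : 0 <= G z by apply: mulr_ge0 => //; apply: divr_ge0 => //; exact: c2_ge0.
have mGE : measurable_fun setT (EFin \o G) by exact/measurable_EFinP.
have GE0 z : (0 <= (EFin \o G) z)%E by rewrite lee_fin.
have L1 : (\int[mu2]_y ((osc2 mu (phase1 y) h) ^+ 4)%:E <=
    1024%:E * \int[mu2]_y \int[mu]_s (EFin \o F) (s, y))%E.
  rewrite -ge0_integralZl//; last 2 first.
  - exact: (@measurable_fun_fubini_tonelli_G _ _ _ _ _ mu (EFin \o F)).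
  - by move=> y _; apply: integral_ge0.
  apply: ge0_le_integral; first exact: measurableT.
  - by move=> y _; rewrite lee_fin exprn_ge0// osc2_ge0.
  - by apply/measurable_EFinP; apply: measurable_funX; exact: mE.
  - apply: emeasurable_funM => //.
    exact: (@measurable_fun_fubini_tonelli_G _ _ _ _ _ mu (EFin \o F)).
  - by move=> y _; exact: layer.
have L2 : (\int[mu]_s \int[mu2]_y (EFin \o F) (s, y) <=
    C%:E * \int[mu]_s \int[mu2]_k (EFin \o G) (s, k))%E.
  rewrite -ge0_integralZl//; last 2 first.
  - exact: (@measurable_fun_fubini_tonelli_F _ _ _ _ _ mu2 (EFin \o G)).
  - by move=> s _; apply: integral_ge0.
  apply: ge0_le_integral; first exact: measurableT.
  - by move=> s _; apply: integral_ge0.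
  - exact: (@measurable_fun_fubini_tonelli_F _ _ _ _ _ mu2 (EFin \o F)).
  - apply: emeasurable_funM => //.
    exact: (@measurable_fun_fubini_tonelli_F _ _ _ _ _ mu2 (EFin \o G)).
  move=> s _; rewrite /F /G /=.
  have [s0|s0] := ltP 0 s; last first.
    have -> : pos s = 0 by rewrite /pos ltNge s0.
    rewrite integral0_eq; last by move=> y _; rewrite mul0r.
    by apply: mule_ge0; [rewrite lee_fin|apply: integral_ge0 => k _; rewrite mul0r].
  under eq_integral do rewrite EFinM.
  under [in leRHS]eq_integral do rewrite EFinM.
  rewrite ge0_integralZl//; last 3 first.
  - by apply/measurable_EFinP; exact: (measurableT_comp mosc3 (pair1_measurable s)).
  - by move=> y _; rewrite lee_fin osc2_ge0.
  - by rewrite lee_fin.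
  rewrite ge0_integralZl//; last 3 first.
  - apply/measurable_EFinP.
    have m1 : measurable_fun setT (fun k : R * R => `|k.1 ^+ 2 - k.2 ^+ 2|^-1).
      apply: (measurable_fun_invr); apply: measurableT_comp => //.
      by apply: measurable_funB; exact: measurable_funX.
    apply: measurable_funM => //; apply: measurable_funD; apply: measurable_funX.
      exact: (measurableT_comp mRe (pair1_measurable s)).
    exact: (measurableT_comp mIm (pair1_measurable s)).
  - by move=> k _; rewrite lee_fin; apply: divr_ge0 => //; exact: c2_ge0.
  - by rewrite lee_fin.
  rewrite muleCA; apply: lee_wpmul2l; first by rewrite lee_fin.
  apply: bilinear_le; first exact: cint_H.
  move=> k ek; have lp : 0 < ls s by rewrite divr_gt0// mulr_gt0.
  rewrite /H /cut /far; have -> : `|k.1| = `|k.2|.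
    by apply/eqP; rewrite -(eqrXn2 (n := 2))// !real_normK ?num_real// ek.
  by rewrite subrr normr0 leNgt lp.
have mcc : measurable_fun setT (fun k : R => (c2 (h k))%:E).
  by apply/measurable_EFinP; exact: rint_meas (rint_c2 hh).
have W : (\int[mu2]_k (c2 (h k.1) * c2 (h k.2))%:E <= (b * b)%:E)%E.
  have ri := rint_c2 hh.
  have -> : (\int[mu2]_k (c2 (h k.1) * c2 (h k.2))%:E = (\int[mu]_k c2 (h k) * \int[mu]_k c2 (h k))%:E)%E.
    exact: etrans (rint_EFin (rint_prod ri ri)) (congr1 EFin (Rint_prodM ri ri)).
  rewrite lee_fin.
  have e : \int[mu]_k c2 (h k) = cnsq mu h by rewrite -[RHS]/(fine (cnsq mu h)%:E) -cnsqE.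
  by rewrite e; apply: ler_pM => //; rewrite -e; apply: Rintegral_ge0 => k _; exact: c2_ge0.
have L3 : (\int[mu2]_k \int[mu]_s (EFin \o G) (s, k) <=
    (64 * M * b)%:E * \int[mu2]_k (c2 (h k.1) * c2 (h k.2))%:E)%E.
  have c0 : 0 <= 64 * M * b by apply: mulr_ge0; [apply: mulr_ge0|]; rewrite ?ltW.
  have mw : measurable_fun setT (fun k : R * R => (c2 (h k.1) * c2 (h k.2))%:E).
    by apply/measurable_EFinP; exact: rint_meas (rint_prod (rint_c2 hh) (rint_c2 hh)).
  have w0 (k : R * R) : (0 <= (c2 (h k.1) * c2 (h k.2))%:E)%E.
    by rewrite lee_fin; apply: mulr_ge0; exact: c2_ge0.
  rewrite -ge0_integralZl//.
  apply: ge0_le_integral => //.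
  - by move=> k _; apply: integral_ge0.
  - exact: (@measurable_fun_fubini_tonelli_G _ _ _ _ _ mu (EFin \o G)).
  - by apply: emeasurable_funM.
  - by move=> k _; rewrite -EFinM; exact: scale_integral.
apply: (le_trans L1).
rewrite -(@fubini_tonelli _ _ _ _ _ mu mu2 (EFin \o F) mFE FE0).
apply: (le_trans (lee_wpmul2l cE L2)).
rewrite (@fubini_tonelli _ _ _ _ _ mu mu2 (EFin \o G) mGE GE0).
have C0E : (0 <= C%:E)%E by rewrite lee_fin.
apply: (le_trans (lee_wpmul2l cE (lee_wpmul2l C0E L3))).
have c0E : (0 <= (64 * M * b)%:E)%E.
  by rewrite lee_fin; apply: mulr_ge0; [apply: mulr_ge0|]; rewrite ?ltW.
apply: (le_trans (lee_wpmul2l cE (lee_wpmul2l C0E (lee_wpmul2l c0E W)))).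
rewrite -!EFinM lee_fin /C le_eqVlt; apply/orP; left; apply/eqP; ring.
Qed.

End one_function.
End refined_strichartz.

(** * The Fourier transform on L^2 *)

Section inner_product.
Context d (T : measurableType d) (R : realType) (m : {measure set T -> \bar R}).
Implicit Types (g h : T -> R[i]) (th : T -> R).

Definition cip g h : R :=
  ip m (fun k => Rep (g k)) (fun k => Rep (h k)) + ip m (fun k => Imp (g k)) (fun k => Imp (h k)).

Definition oscC th h : R[i] := Complex (oscR m th h) (oscI m th h).

Lemma c2_oscC th h : c2 (oscC th h) = osc2 m th h. Proof. by []. Qed.

Definition modul th h k : R[i] :=
  Complex (cos (th k) * Rep (h k) - sin (th k) * Imp (h k))
          (cos (th k) * Imp (h k) + sin (th k) * Rep (h k)).

Lemma c2_modul th h k : c2 (modul th h k) = c2 (h k).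
Proof.
rewrite /c2/=; have := cos2Dsin2 (th k).
move: (cos _) (sin _) (Rep _) (Imp _) => c s p q e.
by rewrite -[RHS]mul1r -e; ring.
Qed.

Lemma oscC_modul th ph h : oscC (fun k => th k + ph k) h = oscC th (modul ph h).
Proof.
by rewrite /oscC; congr Complex; apply: eq_Rint => k; rewrite cosD sinD /=; ring.
Qed.

Lemma cut_modul P th h : cut P (modul th h) = modul th (cut P h).
Proof.
apply/funext => k; rewrite /cut /modul; case: ifP => //= _.
by rewrite !mulr0 subrr addr0.
Qed.

Lemma cint_modul th h : measurable_fun setT th -> cint m h -> cint m (modul th h).
Proof. by move=> mth hi; split; [exact: rint_oscR|exact: rint_oscI]. Qed.

Lemma csq_modul th h : measurable_fun setT th -> csq m h -> csq m (modul th h).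
Proof.
move=> mth hh; have [mr mi] := csq_meas hh.
have mc : measurable_fun setT (fun k => cos (th k)).
  by apply: measurableT_comp => //; exact: measurable_cosr.
have ms : measurable_fun setT (fun k => sin (th k)).
  by apply: measurableT_comp => //; exact: measurable_sinr.
apply: csqP; rewrite /=.
- by apply: measurable_funB; exact: measurable_funM.
- by apply: measurable_funD; exact: measurable_funM.
- by under eq_integral do rewrite c2_modul; rewrite cnsqE// ltry.
Qed.

Lemma cnsq_modul th h : measurable_fun setT th -> csq m h -> cnsq m (modul th h) = cnsq m h.
Proof.
move=> mth hh; apply: EFin_inj; rewrite -!cnsqE//; last exact: csq_modul.
by apply: eq_integral => k _; rewrite c2_modul.
Qed.

Lemma cipC g h : cip g h = cip h g. Proof. by rewrite /cip ipC (ipC m (fun k => Imp (g k))). Qed.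

Lemma cipDr f g h : csq m f -> csq m g -> csq m h ->
  cip f (fun k => g k + h k) = cip f g + cip f h.
Proof.
move=> [f1 f2] [g1 g2] [h1 h2]; rewrite /cip.
under [X in ip m _ X]eq_fun do rewrite ReD.
under [X in _ + ip m _ X]eq_fun do rewrite ImD.
by rewrite !ipDr//; ring.
Qed.

Lemma ReZ (s : R) (z : R[i]) : Rep (s%:C%C * z) = s * Rep z.
Proof. by rewrite ReM /=; ring. Qed.

Lemma ImZ (s : R) (z : R[i]) : Imp (s%:C%C * z) = s * Imp z.
Proof. by rewrite ImM /=; ring. Qed.

Lemma csqZ (s : R) h : csq m h -> csq m (fun k => s%:C%C * h k).
Proof.
move=> [h1 h2]; split.
- by under [X in sqint _ X]eq_fun do rewrite ReZ; exact: sqintZ.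
- by under [X in sqint _ X]eq_fun do rewrite ImZ; exact: sqintZ.
Qed.

Lemma cintZ (s : R) h : cint m h -> cint m (fun k => s%:C%C * h k).
Proof.
move=> [h1 h2]; split.
- by rewrite (_ : _ \o _ = fun k => s * Rep (h k)); [exact: rintZ|apply/funext => k; exact: ReZ].
- by rewrite (_ : _ \o _ = fun k => s * Imp (h k)); [exact: rintZ|apply/funext => k; exact: ImZ].
Qed.

Lemma cipZr (s : R) g h : csq m g -> csq m h -> cip g (fun k => s%:C%C * h k) = s * cip g h.
Proof.
move=> [g1 g2] [h1 h2]; rewrite /cip.
under [X in ip m _ X]eq_fun do rewrite ReZ.
under [X in _ + ip m _ X]eq_fun do rewrite ImZ.
by rewrite !ipZr//; ring.
Qed.

Lemma cnsqD g h : csq m g -> csq m h ->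
  cnsq m (fun k => g k + h k) = cnsq m g + 2 * cip g h + cnsq m h.
Proof.
move=> [g1 g2] [h1 h2]; rewrite /cip /cnsq.
under [X in nsq m X]eq_fun do rewrite ReD.
under [X in _ + nsq m X]eq_fun do rewrite ImD.
by rewrite !nsqD//; ring.
Qed.

Lemma cnsqZ (s : R) h : csq m h -> cnsq m (fun k => s%:C%C * h k) = s ^+ 2 * cnsq m h.
Proof.
move=> [h1 h2]; rewrite /cnsq.
under [X in nsq m X]eq_fun do rewrite ReZ.
under [X in _ + nsq m X]eq_fun do rewrite ImZ.
by rewrite !nsqZ//; ring.
Qed.

Lemma cnsqB g h : csq m g -> csq m h ->
  cnsq m (fun k => g k - h k) = cnsq m g - 2 * cip g h + cnsq m h.
Proof.
move=> [g1 g2] [h1 h2]; rewrite /cip /cnsq.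
under [X in nsq m X]eq_fun do rewrite ReB.
under [X in _ + nsq m X]eq_fun do rewrite ImB.
by rewrite !nsqB//; ring.
Qed.

Lemma cip_sqr_le g h : csq m g -> csq m h -> cip g h ^+ 2 <= cnsq m g * cnsq m h.
Proof.
move=> [g1 g2] [h1 h2]; rewrite /cip /cnsq.
have := cauchy_schwarz g1 h1; have := cauchy_schwarz g2 h2.
have := nsq_ge0 m (fun k => Rep (g k)); have := nsq_ge0 m (fun k => Imp (g k)).
have := nsq_ge0 m (fun k => Rep (h k)); have := nsq_ge0 m (fun k => Imp (h k)).
move: (nsq _ _) (nsq _ _) (nsq _ _) (nsq _ _) (ip _ _ _) (ip _ _ _) => d' c b a q p.
move=> d0 c0 b0 a0 q2 p2.
have h0 : (2 * (p * q)) ^+ 2 <= (a * d' + b * c) ^+ 2.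
  have h3 : p ^+ 2 * q ^+ 2 <= (c * a) * (d' * b) by apply: ler_pM => //; exact: sqr_ge0.
  have := sqr_ge0 (a * d' - b * c); nra.
have h4 : 2 * (p * q) <= a * d' + b * c.
  have nn : 0 <= a * d' + b * c by rewrite addr_ge0// mulr_ge0.
  rewrite leNgt; apply/negP => lt1.
  have := ltr_pXn2r (n := 2) isT; move=> /(_ _ (a * d' + b * c) (2 * (p * q))).
  rewrite !nnegrE nn (ltW (le_lt_trans nn lt1)) => /(_ isT isT); rewrite lt1.
  by rewrite ltNge h0.
nra.
Qed.

Lemma cnsq_split (P : T -> bool) h : measurable_fun setT P -> csq m h ->
  cnsq m h = cnsq m (cut P h) + cnsq m (cut (fun k => ~~ P k) h).
Proof.
move=> mP hh; have mN : measurable_fun setT (fun k => ~~ P k) by exact: measurable_neg.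
have c1 := csq_cut mP hh; have c2' := csq_cut mN hh.
have e : h = fun k => cut P h k + cut (fun k => ~~ P k) h k by apply: cutC.
rewrite {1}e cnsqD// (_ : cip _ _ = 0) ?mulr0 ?addr0// /cip /ip.
rewrite (@eq_Rint _ _ _ m _ (fun=> 0)); last by move=> k; rewrite /cut; case: (P k); rewrite /= ?mul0r ?mulr0.
rewrite (@eq_Rint _ _ _ m (fun k => Imp _ * _) (fun=> 0)); last by move=> k; rewrite /cut; case: (P k); rewrite /= ?mul0r ?mulr0.
by rewrite Rintegral_cst// mul0r addr0.
Qed.

End inner_product.

Section four.
Context (R : realType).
Local Notation mu := (@lebesgue_measure R).
Local Notation mu2 := (prodm mu mu).
Implicit Types (g h : R -> R[i]).

Definition four h (x : R) : R[i] := oscC mu (fun k => x * k) h.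

Let mxk : measurable_fun setT (fun z : R * R => z.1 * z.2).
Proof. exact: measurable_funM. Qed.

Lemma measurable_four h : cint mu h ->
  measurable_fun setT (fun x => Rep (four h x)) /\ measurable_fun setT (fun x => Imp (four h x)).
Proof. by move=> hi; have [mr mi] := cint_meas hi; exact: (measurable_osc mu mxk mr mi). Qed.

Lemma csq_four h : cint mu h -> csq mu h -> csq mu (four h).
Proof.
move=> hi hh; have [m1 m2] := measurable_four hi.
apply: csqP => //; apply: le_lt_trans (plancherel_le hi) _.
by rewrite cnsqE// -EFinM ltry.
Qed.

Lemma cnsq_four_le h : cint mu h -> csq mu h -> cnsq mu (four h) <= 2 * pi * cnsq mu h.
Proof.
move=> hi hh; rewrite -lee_fin -cnsqE; last exact: csq_four.
by rewrite EFinM -cnsqE//; exact: plancherel_le.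
Qed.

Let mphase x : measurable_fun setT (fun k : R => x * k).
Proof. exact: measurable_funM. Qed.

Lemma fourD g h x : cint mu g -> cint mu h ->
  four (fun k => g k + h k) x = four g x + four h x.
Proof. move=> gi hi; change (Complex (oscR mu (fun k => x * k) (fun k => g k + h k)) (oscI mu (fun k => x * k) (fun k => g k + h k)) =
  Complex (oscR mu (fun k => x * k) g + oscR mu (fun k => x * k) h) (oscI mu (fun k => x * k) g + oscI mu (fun k => x * k) h)).
exact: (f_equal2 (@Complex R) (@oscRD _ _ _ mu _ _ _ (mphase x) gi hi) (@oscID _ _ _ mu _ _ _ (mphase x) gi hi)). Qed.

Lemma fourB g h x : cint mu g -> cint mu h ->
  four (fun k => g k - h k) x = four g x - four h x.
Proof. move=> gi hi; change (Complex (oscR mu (fun k => x * k) (fun k => g k - h k)) (oscI mu (fun k => x * k) (fun k => g k - h k)) =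
  Complex (oscR mu (fun k => x * k) g - oscR mu (fun k => x * k) h) (oscI mu (fun k => x * k) g - oscI mu (fun k => x * k) h)).
exact: (f_equal2 (@Complex R) (@oscRB _ _ _ mu _ _ _ (mphase x) gi hi) (@oscIB _ _ _ mu _ _ _ (mphase x) gi hi)). Qed.

Lemma fourZ (s : R) h x : cint mu h ->
  four (fun k => s%:C%C * h k) x = s%:C%C * four h x.
Proof.
move=> hi; rewrite /four /oscC; apply/eqP; rewrite eq_complex ReZ ImZ/=.
rewrite /oscR /oscI -!RintZ; [|exact: rint_oscI|exact: rint_oscR].
by apply/andP; split; apply/eqP; apply: eq_Rint => k; rewrite ReZ ImZ; ring.
Qed.

Definition itv_fun (z : R[i]) (a b : R) : R -> R[i] := cut (fun k : R => (a <= k) && (k <= b)) (fun=> z).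

Lemma measurable_itv (a b : R) : measurable_fun setT (fun k : R => (a <= k) && (k <= b)).
Proof. by apply: measurable_and; exact: measurable_fun_ler. Qed.

Lemma rint_itv (z a b : R) : rint mu (fun k : R => if (a <= k) && (k <= b) then z else 0).
Proof.
have i1 : rint mu (fun k : R => z * \1_(`[a, b]%classic) k).
  by apply: rintZ; exact: integrable_indic_itv.
rewrite (_ : (fun k => _) = fun k : R => z * \1_(`[a, b]%classic) k)//.
apply/funext => k; rewrite indicE; case: ifPn => ab.
  by rewrite mem_set ?mulr1//= in_itv.
by rewrite memNset ?mulr0//= in_itv/=; exact/negP.
Qed.

Lemma cint_itv z a b : cint mu (itv_fun z a b).
Proof.
split; rewrite /itv_fun /cut.
- rewrite (_ : _ \o _ = fun k : R => if (a <= k) && (k <= b) then Rep z else 0); first exact: rint_itv.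
  by apply/funext => k /=; case: ifP.
- rewrite (_ : _ \o _ = fun k : R => if (a <= k) && (k <= b) then Imp z else 0); first exact: rint_itv.
  by apply/funext => k /=; case: ifP.
Qed.

Lemma csq_itv z a b : csq mu (itv_fun z a b).
Proof.
have [h1 h2] := cint_meas (cint_itv z a b).
split; split => //; rewrite /itv_fun /cut.
- rewrite (_ : (fun k => _) = fun k : R => if (a <= k) && (k <= b) then Rep z ^+ 2 else 0); first exact: rint_itv.
  by apply/funext => k /=; case: ifP; rewrite //= expr0n.
- rewrite (_ : (fun k => _) = fun k : R => if (a <= k) && (k <= b) then Imp z ^+ 2 else 0); first exact: rint_itv.
  by apply/funext => k /=; case: ifP; rewrite //= expr0n.
Qed.

Lemma cvg_atan_scale (c : R) : 0 < c -> (fun n => 2 * atan (c / n.+1%:R^-1)) @ \oo --> (pi : R).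
Proof.
move=> c0; have -> : (pi : R) = 2 * (pi / 2) by field.
apply: cvgM; first exact: cvg_cst.
apply: (cvg_comp _ _ _ (@cvgy_atan R)).
apply/cvgryPge => A; near=> n; rewrite invrK.
rewrite -ler_pdivrMl// mulrC; apply: le_trans (ler_norm _) _.
have : `|A / c| <= n%:R by near: n; exact: nbhs_infty_ger.
by move/le_trans; apply; rewrite ler_nat.
Unshelve. all: by end_near. Qed.

(* Integrating the Poisson kernel over an interval gives differences of arctangents,
   which tend to [2 * pi] at interior points. *)
Lemma plancherel_itv z a b :
  2 * pi * cnsq mu (itv_fun z a b) <= cnsq mu (four (itv_fun z a b)).
Proof.
set h := itv_fun z a b; have hi : cint mu h := cint_itv z a b; have hh : csq mu h := csq_itv z a b.
have fh := csq_four hi hh.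
pose P (k : R) := (a <= k) && (k <= b).
pose S (k : R) := (a < k) && (k < b).
have mS : measurable_fun setT S by apply: measurable_and; exact: measurable_fun_ltr.
have cz := c2_ge0 z.
pose A (n : nat) (k : R) : R := 2 * atan ((b - k) / n.+1%:R^-1) - 2 * atan ((a - k) / n.+1%:R^-1).
have mA n : measurable_fun setT (A n).
  have mat (c : R) : measurable_fun setT (fun k : R => 2 * atan ((c - k) / n.+1%:R^-1)).
    apply: measurable_funM => //.
    apply: (measurableT_comp (f := @atan R)).
      by apply: continuous_measurable_fun => x; exact: continuous_atan.
    by apply: measurable_funM => //; exact: measurable_funB.
  exact: measurable_funB.
have A0 n k : S k -> 0 <= A n k.
  move=> /andP[ak kb]; rewrite subr_ge0 ler_pM2l//; apply: ltW; apply: lt_atan.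
  rewrite ltr_pM2r; last by rewrite invr_gt0 invr_gt0.
  by rewrite ltrD2r (lt_trans ak).
have hRe k : Rep (h k) = if P k then Rep z else 0 by rewrite /h /itv_fun /cut /= -/(P k); case: ifP.
have hIm k : Imp (h k) = if P k then Imp z else 0 by rewrite /h /itv_fun /cut /= -/(P k); case: ifP.
have inner n k : P k -> \int[mu]_k' (poisson n.+1%:R^-1 (k - k') *
    (Rep (h k) * Rep (h k') + Imp (h k) * Imp (h k'))) = c2 z * A n k.
  move=> Pk; have ab : a <= b by case/andP: Pk => /le_trans; apply.
  have e0 : 0 < n.+1%:R^-1 :> R by rewrite invr_gt0.
  have F := @poisson_FTC R _ k (fun=> 1) id a b e0 ab (fun x => is_derive_id x 1) (@cst_continuous _ _ (1 : R)).
  have -> : A n k = \int[mu]_(x in `[a, b]) (poisson n.+1%:R^-1 (x - k) * 1).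
    by apply: EFin_inj; rewrite /Rintegral F.
  have I : mu.-integrable `[a, b] (EFin \o (fun x => poisson n.+1%:R^-1 (x - k) * 1)).
    apply: continuous_compact_integrable; first exact: segment_compact.
    apply: continuous_subspaceT => x; apply: cvgM; last exact: cvg_cst.
    apply: (@continuous_comp _ _ _ (fun x => x - k)); last exact: continuous_poisson.
    by apply: cvgB; [exact: cvg_id|exact: cvg_cst].
  rewrite -RintegralZl// [RHS]Rintegral_mkcond; apply: eq_Rint => x.
  rewrite !hRe !hIm Pk patchE; case: ifPn => Px.
    rewrite mem_set/= ?in_itv//= mulr1 -poissonN opprB /c2; ring.
  rewrite memNset/= ?in_itv//=; last exact/negP.
  by rewrite !mulr0 addr0 mulr0.
have outer n k : ~~ P k -> \int[mu]_k' (poisson n.+1%:R^-1 (k - k') *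
    (Rep (h k) * Rep (h k') + Imp (h k) * Imp (h k'))) = 0.
  move=> /negbTE Pk; rewrite (@eq_Rint _ _ _ mu _ (fun=> 0)); first by rewrite Rintegral_cst// mul0r.
  by move=> k'; rewrite hRe hIm Pk; ring.
have mf n : measurable_fun setT (fun k : R => if S k then c2 z * A n k else 0).
  by apply: measurable_fun_ifT => //; exact: measurable_funM.
have key n : (\int[mu]_k (if S k then c2 z * A n k else 0)%:E <= (cnsq mu (four h))%:E)%E.
  have e0 : 0 < n.+1%:R^-1 :> R by rewrite invr_gt0.
  have wi := rint_abelw e0.
  have w0 y : 0 <= abelw (n.+1%:R^-1 : R) y by exact: abelw_ge0.
  have HK (k k' : R) : \int[mu]_y (abelw n.+1%:R^-1 y * cos (y * k - y * k')) = poisson n.+1%:R^-1 (k - k').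
    by rewrite -Rint_abelw_cos//; apply: eq_Rint => y; rewrite mulrBr.
  have HS (k k' : R) : \int[mu]_y (abelw n.+1%:R^-1 y * sin (y * k - y * k')) = 0.
    by rewrite -(@Rint_abelw_sin _ _ e0 (k - k')); apply: eq_Rint => y; rewrite mulrBr.
  have T1 := @TT_identity _ _ _ _ _ mu mu (abelw n.+1%:R^-1) (fun y k => y * k) h _ w0 wi mxk hi HK HS.
  have T2 := @TT_rint2 _ _ _ _ _ mu mu (abelw n.+1%:R^-1) (fun y k => y * k) h _ w0 wi mxk hi HK HS.
  have T3 := rint_Rint1 T2.
  move: T1; rewrite /prodm (Rint_fubini1 T2) => T1.
  apply: (@le_trans _ _ (\int[mu]_k (\int[mu]_k' (poisson n.+1%:R^-1 (k - k') *
      (Rep (h k) * Rep (h k') + Imp (h k) * Imp (h k'))))%:E)%E).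
    apply: ge0_le_integral => //.
    - by move=> k _; rewrite lee_fin; case: ifP => // Sk; rewrite mulr_ge0// A0.
    - by apply/measurable_EFinP; exact: mf.
    - by apply/measurable_EFinP; exact: rint_meas T3.
    move=> k _; rewrite lee_fin; case: ifP => [/andP[ak kb]|Sk].
      by rewrite inner// /P !ltW.
    have [Pk|/outer ->//] := boolP (P k).
    rewrite inner//; apply: mulr_ge0 => //.
    case/andP: Pk => ak kb; rewrite subr_ge0 ler_pM2l//; apply: le_atan.
    by rewrite ler_pM2r ?invr_gt0// lerD2r (le_trans ak).
  rewrite rint_EFin// -T1 -cnsqE//.
  have mo : measurable_fun setT (fun y : R => osc2 mu (fun k => y * k) h).
    by have [mr mi] := cint_meas hi; exact: (measurable_osc2 mu mxk mr mi).
  have wle y : abelw (n.+1%:R^-1 : R) y * osc2 mu (fun k => y * k) h <= osc2 mu (fun k => y * k) h.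
    rewrite ler_piMl ?osc2_ge0// /abelw -expR0 ler_expR oppr_le0.
    by rewrite mulr_ge0// ltW.
  have ro : rint mu (fun y : R => osc2 mu (fun k => y * k) h) by exact: (rint_c2 fh).
  have rw : rint mu (fun y => abelw n.+1%:R^-1 y * osc2 mu (fun k => y * k) h).
    apply: (@rint_le _ _ _ mu _ _ _ ro).
      by apply: measurable_funM => //; exact: measurable_abelw.
    by move=> y; rewrite ger0_norm// mulr_ge0// osc2_ge0.
  by rewrite (rint_EFin ro) lee_fin; apply: Rint_le.
have mg : measurable_fun setT (fun k : R => if S k then c2 z * (2 * pi) else 0).
  by apply: measurable_fun_ifT.
have lim := @fatou_le _ (measurableTypeR R) R mu (fun n k => if S k then c2 z * A n k else 0)
   (fun k : R => if S k then c2 z * (2 * pi) else 0) (cnsq mu (four h))%:E.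
have {}lim : (\int[mu]_k (if S k then c2 z * (2 * pi) else 0)%:E <= (cnsq mu (four h))%:E)%E.
  apply: lim => //.
  - by move=> n y; case: ifP => // Sy; apply: mulr_ge0 => //; exact: A0.
  - by move=> y; case: ifP => // Sy; apply: mulr_ge0 => //; rewrite mulr_ge0// pi_ge0.
  apply: aeW => k /=; rewrite /A; case: ifP => [/andP[ak kb]|_]; last exact: cvg_cst.
  apply: cvgM; first exact: cvg_cst.
  have -> : 2 * pi = pi + pi :> R by ring.
  rewrite (_ : (fun n => _) = fun n => 2 * atan ((b - k) / n.+1%:R^-1) + 2 * atan ((k - a) / n.+1%:R^-1)).
    by apply: cvgD; apply: cvg_atan_scale; rewrite subr_gt0.
  apply/funext => n; have -> : (a - k) / n.+1%:R^-1 = - ((k - a) / n.+1%:R^-1).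
    by rewrite -mulNr opprB.
  by rewrite atanN mulrN opprK.
rewrite -lee_fin; apply: le_trans lim.
rewrite EFinM -cnsqE//.
have e1 : (\int[mu]_k (c2 (h k))%:E = (c2 z)%:E * mu `[a, b])%E.
  have mP : measurable_fun setT P by exact: measurable_itv.
  transitivity (\int[mu]_k ((c2 z)%:E * (P k)%:R%:E))%E.
    apply: eq_integral => k _; rewrite -EFinM; congr EFin.
    by rewrite /h /itv_fun c2_cut -/(P k); case: (P k); rewrite ?mulr1 ?mulr0.
  rewrite ge0_integralZl//; last first.
    by apply/measurable_EFinP; rewrite (_ : (fun k => _) = fun k => if P k then 1 else 0); [exact: measurable_fun_ifT|apply/funext => k; case: (P k)].
  rewrite lebesgue_integral_pred//; congr (_ * mu _)%E.
have e2 : (\int[mu]_k (if S k then c2 z * (2 * pi) else 0)%:E = (2 * pi)%:E * ((c2 z)%:E * mu `]a, b[))%E.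
  transitivity (\int[mu]_k ((2 * pi * c2 z)%:E * (S k)%:R%:E))%E.
    apply: eq_integral => k _; rewrite -EFinM; congr EFin.
    by case: (S k); rewrite ?mulr1 ?mulr0// mulrC.
  rewrite ge0_integralZl//; last 2 first.
  - by apply/measurable_EFinP; rewrite (_ : (fun k => _) = fun k => if S k then 1 else 0); [exact: measurable_fun_ifT|apply/funext => k; case: (S k)].
  - by rewrite lee_fin mulr_ge0// mulr_ge0// pi_ge0.
  rewrite EFinM -muleA lebesgue_integral_pred//; congr (_ * (_ * mu _))%E.
by rewrite e1 e2 !lebesgue_measure_itv.
Qed.

Definition defect h : R := 2 * pi * cnsq mu h - cnsq mu (four h).

Definition defectB g h : R := 2 * pi * cip mu g h - cip mu (four g) (four h).

Lemma defect_ge0 h : cint mu h -> csq mu h -> 0 <= defect h.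
Proof. by move=> hi hh; rewrite subr_ge0; exact: cnsq_four_le. Qed.

Lemma defect_itv z a b : defect (itv_fun z a b) = 0.
Proof.
apply/eqP; rewrite eq_le defect_ge0 ?andbT; [|exact: cint_itv|exact: csq_itv].
by rewrite subr_le0; exact: plancherel_itv.
Qed.

Lemma defectBE g h : cint mu g -> csq mu g -> cint mu h -> csq mu h -> defect h = 0 ->
  defectB g h = 0.
Proof.
move=> gi gg hi hh h0.
have [fg fh] := (csq_four gi gg, csq_four hi hh).
have aux (G C H fG fC fH : R) : 2 * pi * H - fH = 0 ->
    (forall s, 0 <= 2 * pi * (G + 2 * (s * C) + s ^+ 2 * H) - (fG + 2 * (s * fC) + s ^+ 2 * fH)) ->
    2 * pi * C - fC = 0.
  move=> H0 Hs; pose D := 2 * pi * C - fC; rewrite -/D; apply/eqP/negPn/negP => n0.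
  have := Hs (- (2 * pi * G - fG + 1) / (2 * D)); set s := (X in X ^+ 2).
  have -> : 2 * pi * (G + 2 * (s * C) + s ^+ 2 * H) - (fG + 2 * (s * fC) + s ^+ 2 * fH) =
    2 * pi * G - fG + s * (2 * D) + s ^+ 2 * (2 * pi * H - fH) by rewrite /D; ring.
  rewrite H0 mulr0 addr0 /s divfK ?mulf_neq0 ?pnatr_eq0//; lra.
apply: (aux (cnsq mu g) _ _ (cnsq mu (four g)) _ _ h0) => s.
have sh := csqZ s hh; have := defect_ge0 (cintD gi (cintZ s hi)) (csqD gg sh).
rewrite /defect; have -> : four (fun k => g k + s%:C%C * h k) = (fun x => four g x + s%:C%C * four h x).
  by apply/funext => x; rewrite fourD ?fourZ//; exact: cintZ.
by rewrite !cnsqD ?cipZr ?cnsqZ//; exact: csqZ.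
Qed.

Lemma ae_eq0_itv (q : R -> R) : rint mu q ->
  (forall a b : R, \int[mu]_k (if (a <= k) && (k <= b) then q k else 0) = 0) ->
  {ae mu, forall x, q x = 0}.
Proof.
move=> qi q0.
have H (n : nat) : {ae mu, forall x, - n%:R < x -> q x = 0}.
  have F0 (y : R) : \int[mu]_(t in [set` Interval (BLeft (- n%:R : R)) (BRight y)]) q t = 0.
    rewrite Rintegral_mkcond -[RHS](q0 (- n%:R) y); apply: eq_Rint => k.
    rewrite patchE; case: ifPn => [/set_mem|/negP P]; first by rewrite /= in_itv/= => ->.
    by case: ifP => // ny; exfalso; apply: P; rewrite mem_set//= in_itv.
  have D := @FTC1 R q (BLeft (- n%:R : R)) _ _.
  have D1 : (forall y : R, mu.-integrable [set` Interval (BLeft (- n%:R : R)) (BRight y)] (EFin \o q)).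
    by move=> y; apply: integrableS qi.
  have D2 : locally_integrable [set: R] q.
    by apply: open_integrable_locally => //; exact: openT.
  have := D D1 D2 => /=; apply: filterS; first exact: (ae_filter_ringOfSetsType mu).
  move=> x Hx nx.
  have [_ <-] := Hx nx.
  rewrite (_ : (fun y => _) = cst 0); last by apply/funext => y; exact: F0.
  by rewrite derive1_cst.
have := ae_foralln H; apply: filterS => x Hx.
apply: (Hx (Num.truncn `|x|).+1).
rewrite ltrNl; apply: le_lt_trans (truncnS_gt _); rewrite -normrN; exact: ler_norm.
Qed.

Section defect_vanishes.
Variables (h : R -> R[i]) (K : R).
Hypothesis hh : csq mu h.
Hypothesis hK : forall k, K < `|k| -> h k = 0.

Let hi : cint mu h. Proof. exact: csq_supp_cint hK. Qed.

Let PK (k : R) : bool := (- K <= k) && (k <= K).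

Let mPK : measurable_fun setT PK. Proof. exact: measurable_itv. Qed.

Let e (z : R[i]) (b : R -> R) : R -> R[i] :=
  cut PK (fun k => Complex (Rep z * b k) (Imp z * b k)).

Let csq_e z b : sqint mu b -> csq mu (e z b).
Proof. by move=> hb; apply: csq_cut => //; split; exact: sqintZ. Qed.

Let cint_e z b : sqint mu b -> cint mu (e z b).
Proof.
move=> hb; apply: (csq_supp_cint (K := K)); first exact: csq_e.
move=> k Kk; rewrite /e /cut /PK -ler_norml leNgt Kk//.
Qed.

Let eD z b b' : e z (fun x => b x + b' x) = fun k => e z b k + e z b' k.
Proof.
apply/funext => k; rewrite /e /cut; case: ifP => _; last by rewrite addr0.
by rewrite !mulrDr.
Qed.

Let eZ z s b : e z (fun x => s * b x) = fun k => s%:C%C * e z b k.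
Proof.
apply/funext => k; rewrite /e /cut; case: ifP => _; last by rewrite mulr0.
by apply/eqP; rewrite eq_complex ReZ ImZ /=; apply/andP; split; apply/eqP; ring.
Qed.

Lemma defect_bound (x y a b c d w v : R) : x ^+ 2 <= a * b -> y ^+ 2 <= c * d ->
  c * d <= 2 * pi * a * (2 * pi * b) -> a * b <= a * (w * v) ->
  (2 * pi * x - y) ^+ 2 <= 16 * pi ^+ 2 * a * w * v.
Proof.
move=> b1 b2 c4 c5.
have d1 : (2 * pi * x - y) ^+ 2 <= 8 * pi ^+ 2 * x ^+ 2 + 2 * y ^+ 2.
  by have := sqr_ge0 (2 * pi * x + y); lra.
have d2 : 8 * pi ^+ 2 * x ^+ 2 <= 8 * pi ^+ 2 * (a * b).
  by apply: ler_wpM2l => //; rewrite mulr_ge0// sqr_ge0.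
have d3 : 16 * pi ^+ 2 * (a * b) <= 16 * pi ^+ 2 * (a * (w * v)).
  by apply: ler_wpM2l => //; rewrite mulr_ge0// sqr_ge0.
have d4 : 2 * pi * a * (2 * pi * b) = 4 * pi ^+ 2 * (a * b) by ring.
by lra.
Qed.

Lemma defectBD f g g' : cint mu f -> csq mu f -> cint mu g -> csq mu g -> cint mu g' -> csq mu g' ->
  defectB f (fun k => g k + g' k) = defectB f g + defectB f g'.
Proof.
move=> fi ff gi gg gi' gg'; rewrite /defectB.
have -> : four (fun k => g k + g' k) = fun x => four g x + four g' x.
  by apply/funext => x; exact: fourD.
have [f1 f2 f3] := And3 (csq_four fi ff) (csq_four gi gg) (csq_four gi' gg').
by rewrite (cipDr ff gg gg') (cipDr f1 f2 f3) mulrDr opprD addrACA.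
Qed.

Lemma defectBZ f s g : cint mu f -> csq mu f -> cint mu g -> csq mu g ->
  defectB f (fun k => s%:C%C * g k) = s * defectB f g.
Proof.
move=> fi ff gi gg; rewrite /defectB.
have -> : four (fun k => s%:C%C * g k) = fun x => s%:C%C * four g x.
  by apply/funext => x; exact: fourZ.
have [f1 f2] := (csq_four fi ff, csq_four gi gg).
by rewrite !cipZr//; ring.
Qed.

Let L_eq0 z b : sqint mu b -> defectB h (e z b) = 0.
Proof.
have h0 := cnsq_ge0 mu h; have z0 := c2_ge0 z.
have cnsq_e b' : sqint mu b' -> cnsq mu (e z b') <= c2 z * nsq mu b'.
  move=> sb; have sb2 : sqint mu (fun x => Rep z * b' x) by exact: sqintZ.
  have sb3 : sqint mu (fun x => Imp z * b' x) by exact: sqintZ.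
  have cb : csq mu (fun k => Complex (Rep z * b' k) (Imp z * b' k)) by split.
  have := @cnsq_cut_le _ _ _ mu PK _ mPK cb; rewrite -/(e z b') => /le_trans; apply.
  by rewrite /cnsq /= !nsqZ// /c2; lra.
pose M : R := 16 * pi ^+ 2 * cnsq mu h * c2 z.
have M0 : 0 <= M by rewrite /M mulr_ge0// mulr_ge0// mulr_ge0// sqr_ge0.
have LD (f g : R -> R) : sqint mu f -> sqint mu g ->
    defectB h (e z (fun x => f x + g x)) = defectB h (e z f) + defectB h (e z g).
  by move=> sf sg; rewrite eD; apply: defectBD => //; [exact: cint_e|exact: csq_e|exact: cint_e|exact: csq_e].
have LZ s f : sqint mu f -> defectB h (e z (fun x => s * f x)) = s * defectB h (e z f).
  by move=> sf; rewrite eZ; apply: defectBZ => //; [exact: cint_e|exact: csq_e].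
have LM f : sqint mu f -> defectB h (e z f) ^+ 2 <= M * nsq mu f.
  move=> sf; have ef := cnsq_e _ sf; have ei := cint_e z sf; have es := csq_e z sf.
  have fh := csq_four hi hh; have fe := csq_four ei es.
  have b1 := cip_sqr_le hh es; have b2 := cip_sqr_le fh fe.
  have c1 := cnsq_four_le hi hh; have c3 := cnsq_four_le ei es.
  have p1 := cnsq_ge0 mu (four h); have p2 := cnsq_ge0 mu (four (e z f)).
  have c4 := ler_pM p1 p2 c1 c3.
  have c5 := ler_wpM2l h0 ef.
  by rewrite /defectB /M; exact: defect_bound b1 b2 c4 c5.
have [q sq Lq] := @riesz _ (measurableTypeR R) R mu (fun b => defectB h (e z b)) M M0 LD LZ LM.
pose q' k := if PK k then q k else 0.
have mq : measurable_fun setT q by case: sq.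
have rq' : rint mu q'.
  apply: (@rint_le _ _ _ mu _ (fun k => (if PK k then 1 else 0) + q k ^+ 2)).
  - exact: measurable_fun_ifT.
  - by apply: rintD; [exact: rint_itv|case: sq].
  move=> k; rewrite /q'; case: ifP => _; last by rewrite normr0 add0r sqr_ge0.
  by rewrite -(real_normK (num_real (q k))); have := sqr_ge0 (`|q k| - 1); nra.
have sI a c : sqint mu (fun k : R => if (a <= k) && (k <= c) then 1 else 0 : R).
  split; first exact: rint_meas (rint_itv 1 a c).
  rewrite (_ : (fun k => _) = fun k : R => if (a <= k) && (k <= c) then 1 else 0 : R); first exact: rint_itv.
  by apply/funext => k; case: ifP; rewrite ?expr1n ?expr0n.
have q'0 : {ae mu, forall k, q' k = 0}.
  apply: ae_eq0_itv => // a c.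
  transitivity (ip mu q (fun k : R => if (Num.max a (- K) <= k) && (k <= Num.min c K) then 1 else 0)).
    apply: eq_Rint => k; rewrite /q' /PK ge_max le_min.
    by case: (a <= k); case: (k <= c); case: (- K <= k); case: (k <= K); rewrite /= ?mulr1 ?mulr0.
  rewrite Lq//.
  have -> : e z (fun k : R => if (Num.max a (- K) <= k) && (k <= Num.min c K) then 1 else 0) =
      itv_fun z (Num.max a (- K)) (Num.min c K).
    apply/funext => k; rewrite /e /itv_fun /cut /PK ge_max le_min.
    case: z {z0 cnsq_e M M0 LD LZ LM Lq} => z1 z2.
    by case: (a <= k); case: (k <= c); case: (- K <= k); case: (k <= K); rewrite /= ?mulr1 ?mulr0.
  by apply: defectBE => //; [exact: cint_itv|exact: csq_itv|exact: defect_itv].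
move=> sb; have eb : e z b = e z (fun k => if PK k then b k else 0).
  by apply/funext => k; rewrite /e /cut; case: ifP.
have sb' : sqint mu (fun k => if PK k then b k else 0).
  case: sb => mb ib; have mb' : measurable_fun setT (fun k => if PK k then b k else 0) by exact: measurable_fun_ifT.
  split => //; apply: (@rint_le _ _ _ mu _ _ _ ib); first exact: measurable_funX.
  by move=> k; rewrite ger0_norm ?sqr_ge0//; case: ifP => // _; rewrite expr0n /= sqr_ge0.
rewrite eb -Lq// /ip.
rewrite /Rintegral (_ : (\int[mu]_x _)%E = 0%E)//.
rewrite -(@integral0 _ _ _ mu setT); apply: ae_eq_integral => //.
  apply/measurable_EFinP; apply: measurable_funM => //; by case: sb'.
apply: filterS q'0; first exact: (ae_filter_ringOfSetsType mu).
move=> k; rewrite /q' => qk _; congr EFin.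
by case: ifP qk => _ qk; rewrite ?qk ?mul0r ?mulr0.
Qed.

Lemma plancherel_supp : cnsq mu (four h) = 2 * pi * cnsq mu h.
Proof.
have [mr mi] := csq_meas hh; have [hr hI] := hh.
have e1 : h = fun k => e 1 (fun k => Rep (h k)) k + e 'i%C (fun k => Imp (h k)) k.
  apply/funext => k; rewrite /e /cut /PK -ler_norml; case: leP => [_|Kk]; last by rewrite hK// addr0.
  by apply/eqP; rewrite eq_complex ReD ImD /= !mul1r !mul0r addr0 add0r !eqxx.
have : defectB h h = 0.
  rewrite [X in defectB _ X]e1 defectBD//; [|exact: cint_e|exact: csq_e|exact: cint_e|exact: csq_e].
  by rewrite !L_eq0// addr0.
rewrite /defectB.
have cipE f : cip mu f f = cnsq mu f.
  by rewrite /cip /cnsq /ip /nsq; congr (_ + _); apply: eq_Rint => x; rewrite expr2.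
rewrite !cipE; lra.
Qed.

End defect_vanishes.

End four.

Section complex_limits.
Context d (T : measurableType d) (R : realType) (m : {measure set T -> \bar R}).
Implicit Types (g h : T -> R[i]).

Definition cflim (f : nat -> T -> R[i]) x : R[i] :=
  Complex (flim (fun j x => Rep (f j x)) x) (flim (fun j x => Imp (f j x)) x).

Lemma fast_cL2_cvg (f : nat -> T -> R[i]) : (forall j, csq m (f j)) ->
  (forall j, cnsq m (fun x => f j.+1 x - f j x) <= 16^-1 ^+ j) ->
  csq m (cflim f) /\ forall j, cnsq m (fun x => f j x - cflim f x) <= 16 * 4^-1 ^+ j.
Proof.
move=> hf df.
have e j : cnsq m (fun x => f j.+1 x - f j x) =
    nsq m (fun x => Rep (f j.+1 x) - Rep (f j x)) + nsq m (fun x => Imp (f j.+1 x) - Imp (f j x)).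
  by rewrite /cnsq; congr (_ + _); apply: eq_Rint => x; rewrite ?ReB ?ImB.
have [] := @fast_L2_cvg _ _ _ m (fun j x => Rep (f j x)).
- by move=> j; case: (hf j).
- by move=> j; apply: le_trans (df j); rewrite e lerDl nsq_ge0.
move=> s1 b1 _; have [] := @fast_L2_cvg _ _ _ m (fun j x => Imp (f j x)).
- by move=> j; case: (hf j).
- by move=> j; apply: le_trans (df j); rewrite e lerDr nsq_ge0.
move=> s2 b2 _; split=> // j.
rewrite (_ : cnsq _ _ = nsq m (fun x => Rep (f j x) - Rep (cflim f x)) + nsq m (fun x => Imp (f j x) - Imp (cflim f x))).
  by apply: (le_trans (lerD (b1 j) (b2 j))); lra.
by rewrite /cnsq; congr (_ + _); apply: eq_Rint => x; rewrite ?ReB ?ImB.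
Qed.

Lemma cnsqD_le g h : csq m g -> csq m h ->
  cnsq m (fun k => g k + h k) <= 2 * cnsq m g + 2 * cnsq m h.
Proof.
move=> hg hh; rewrite cnsqD//.
have := cnsq_ge0 m (fun k => g k - h k); rewrite cnsqB//; lra.
Qed.

Lemma cnsqB_le g h : csq m g -> csq m h ->
  cnsq m (fun k => g k - h k) <= 2 * cnsq m g + 2 * cnsq m h.
Proof.
move=> hg hh; rewrite cnsqB//.
have := cnsq_ge0 m (fun k => g k + h k); rewrite cnsqD//; lra.
Qed.

Lemma cip_self h : cip m h h = cnsq m h.
Proof. by rewrite /cip /cnsq /ip /nsq; congr (_ + _); apply: eq_Rint => x; rewrite expr2. Qed.

End complex_limits.

Section extension.
Context (R : realType).
Local Notation mu := (@lebesgue_measure R).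
Implicit Types (g h : R -> R[i]).

Definition trunc (n : nat) h : R -> R[i] := cut (fun k : R => `|k| <= n%:R) h.
Definition tail (n : nat) h : R -> R[i] := cut (fun k : R => ~~ (`|k| <= n%:R)) h.

Lemma measurable_norm_le (n : nat) : measurable_fun setT (fun k : R => `|k| <= n%:R).
Proof. by apply: measurable_fun_ler => //; exact: measurableT_comp. Qed.

Lemma csq_trunc n h : csq mu h -> csq mu (trunc n h).
Proof. by apply: csq_cut; exact: measurable_norm_le. Qed.

Lemma csq_tail n h : csq mu h -> csq mu (tail n h).
Proof. by apply: csq_cut; apply: measurable_neg; exact: measurable_norm_le. Qed.

Lemma trunc_supp n h k : n%:R < `|k| -> trunc n h k = 0.
Proof. by rewrite /trunc /cut leNgt => ->. Qed.

Lemma cint_trunc n h : csq mu h -> cint mu (trunc n h).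
Proof. by move=> hh; apply: (csq_supp_cint (csq_trunc n hh)); exact: trunc_supp. Qed.

Lemma cnsq_trunc_tail n h : csq mu h -> cnsq mu h = cnsq mu (trunc n h) + cnsq mu (tail n h).
Proof. by move=> hh; exact: (@cnsq_split _ _ _ mu _ _ (measurable_norm_le n) hh). Qed.

Lemma trunc_tail n h : h = fun k => trunc n h k + tail n h k.
Proof. exact: cutC. Qed.

Lemma cnsq_tail_cvg h : csq mu h -> (fun n => cnsq mu (tail n h)) @ \oo --> (0 : R).
Proof.
move=> hh; have ci := rint_c2 hh.
pose f n (k : R) : \bar R := (c2 (tail n h k))%:E.
have [] := @dominated_convergence _ (measurableTypeR R) R mu setT measurableT f (cst 0%E)
  (fun k => (c2 (h k))%:E).
- by move=> n; apply/measurable_EFinP; exact: rint_meas (rint_c2 (csq_tail n hh)).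
- exact: measurable_cst.
- apply: aeW => k _; apply: cvg_near_cst; exists (Num.truncn `|k|).+1 => // n /= kn.
  rewrite /f /tail /cut (_ : `|k| <= n%:R) ?c2_0//.
  by apply: ltW; apply: lt_le_trans (truncnS_gt _) _; rewrite ler_nat.
- exact: ci.
- apply: aeW => k n _; rewrite /f gee0_abs ?lee_fin ?c2_ge0// /tail c2_cut.
  by case: ifP => // _; exact: c2_ge0.
move=> _ _; rewrite integral0 => H.
have -> : (fun n => cnsq mu (tail n h)) = (fun n => fine (\int[mu]_k f n k)%E).
  by apply/funext => n; rewrite cnsqE//; exact: csq_tail.
exact: (fine_cvg H).
Qed.

Lemma cnsq_truncB n p h : csq mu h ->
  cnsq mu (fun k => trunc n h k - trunc p h k) <= cnsq mu (tail n h) + cnsq mu (tail p h).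
Proof.
move=> hh; have h1 := csqB (csq_trunc n hh) (csq_trunc p hh).
have h2 := csq_tail n hh; have h3 := csq_tail p hh.
have m2 : measurable_fun setT (fun k => (c2 (tail n h k))%:E).
  by apply/measurable_EFinP; exact: rint_meas (rint_c2 h2).
have m3 : measurable_fun setT (fun k => (c2 (tail p h k))%:E).
  by apply/measurable_EFinP; exact: rint_meas (rint_c2 h3).
have m1 : measurable_fun setT (fun k => (c2 (trunc n h k - trunc p h k))%:E).
  by apply/measurable_EFinP; exact: rint_meas (rint_c2 h1).
have : (\int[mu]_k (c2 (trunc n h k - trunc p h k))%:E <=
    \int[mu]_k ((c2 (tail n h k))%:E + (c2 (tail p h k))%:E))%E; last first.
  rewrite ge0_integralD//; [|by move=> k _; rewrite lee_fin c2_ge0|by move=> k _; rewrite lee_fin c2_ge0].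
  by rewrite (cnsqE h1) (cnsqE h2) (cnsqE h3) -EFinD lee_fin.
apply: ge0_le_integral => //.
- by move=> k _; rewrite lee_fin c2_ge0.
- exact: emeasurable_funD.
move=> k _; rewrite -EFinD lee_fin /trunc /tail /cut; have := c2_ge0 (h k).
by case: ifP => _; case: ifP => _; rewrite /= ?subrr ?subr0 ?sub0r /c2 ?ReN ?ImN /= ?sqrrN; lra.
Qed.

Lemma fast_tail h : csq mu h -> exists n_ : nat -> nat,
  forall j, (j <= n_ j)%N /\ cnsq mu (tail (n_ j) h) <= 16^-1 ^+ j / 16.
Proof.
move=> hh; have H j : exists n, (j <= n)%N /\ cnsq mu (tail n h) <= 16^-1 ^+ j / 16.
  have e0 : 0 < 16^-1 ^+ j / 16 :> R by rewrite divr_gt0// exprn_gt0.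
  have /cvgrPdist_le/(_ _ e0) [n _ Hn] := cnsq_tail_cvg hh.
  exists (maxn n j); split; first exact: leq_maxr.
  by have := Hn (maxn n j) (leq_maxl _ _); rewrite sub0r normrN ger0_norm// cnsq_ge0.
by exists (fun j => projT1 (cid (H j))) => j; exact: (projT2 (cid (H j))).
Qed.

Section four_limit.
Variables (h : R -> R[i]) (n_ : nat -> nat) (th : R -> R).
Hypothesis hh : csq mu h.
Hypothesis hN : forall j, (j <= n_ j)%N /\ cnsq mu (tail (n_ j) h) <= 16^-1 ^+ j / 16.
Hypothesis mth : measurable_fun setT th.

Let hn j : cnsq mu (tail (n_ j) h) <= 16^-1 ^+ j / 16.
Proof. by case: (hN j). Qed.

Let g := modul th h.
Let gg : csq mu g. Proof. exact: csq_modul. Qed.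
Let F n := four (trunc n g).
Let U := cflim (fun j => F (n_ j)).

Let tailE n : cnsq mu (tail n g) = cnsq mu (tail n h).
Proof. by rewrite /tail cut_modul; apply: cnsq_modul => //; exact: csq_tail. Qed.

Let csqF n : csq mu (F n).
Proof. by apply: csq_four; [exact: cint_trunc|exact: csq_trunc]. Qed.

Let FB n p : cnsq mu (fun x => F n x - F p x) <= 8 * (cnsq mu (tail n h) + cnsq mu (tail p h)).
Proof.
have cn := cint_trunc n gg; have cp := cint_trunc p gg.
have -> : (fun x => F n x - F p x) = four (fun k => trunc n g k - trunc p g k).
  by apply/funext => x; rewrite /F fourB.
apply: (le_trans (cnsq_four_le (cintB cn cp) (csqB (csq_trunc n gg) (csq_trunc p gg)))).
apply: ler_pM; rewrite ?cnsq_ge0// ?mulr_ge0 ?pi_ge0//.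
  have := pihalf_lt2 R; lra.
by rewrite -!tailE; exact: cnsq_truncB.
Qed.

Lemma four_limit : csq mu U /\ (fun n => cnsq mu (fun x => F n x - U x)) @ \oo --> (0 : R).
Proof.
have [j|cU bU] := fast_cL2_cvg (fun j => csqF (n_ j)).
  apply: (le_trans (FB _ _)); have := hn j; have := hn j.+1; rewrite exprS.
  have : 0 <= 16^-1 ^+ j :> R by rewrite exprn_ge0.
  lra.
split=> //; apply/cvgrPdist_le => e e0.
have [j Hj] : exists j, 32 * 4^-1 ^+ j + 16 * 16^-1 ^+ j / 16 <= e / 2 :> R.
  have c4 : (fun n => 4^-1 ^+ n : R) @ \oo --> (0 : R).
    by apply: cvg_expr; rewrite ger0_norm// invf_lt1// ltr1n.
  have e1 : 0 < e / 66 by rewrite divr_gt0.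
  have /cvgrPdist_le/(_ _ e1) [n _ /(_ n (leqnn n))] := c4.
  rewrite sub0r normrN ger0_norm ?exprn_ge0// => h4; exists n.
  have : 16^-1 ^+ n <= 4^-1 ^+ n :> R by rewrite lerXn2r ?nnegrE// lef_pV2 ?posrE// ler_nat.
  lra.
have e1 : 0 < e / 32 by rewrite divr_gt0.
have /cvgrPdist_le/(_ _ e1) := cnsq_tail_cvg hh.
apply: filterS => n; rewrite !sub0r !normrN !ger0_norm ?cnsq_ge0// => tn.
have -> : (fun x => F n x - U x) = fun x => (F n x - F (n_ j) x) + (F (n_ j) x - U x).
  by apply/funext => x; rewrite addrA subrK.
have h1 := csqB (csqF n) (csqF (n_ j)); have h2 := csqB (csqF (n_ j)) cU.
apply: (le_trans (cnsqD_le h1 h2)).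
have := FB n (n_ j); have := bU j; have := hn j.
have : 0 <= 16^-1 ^+ j :> R by rewrite exprn_ge0.
lra.
Qed.

End four_limit.

Section inversion.

Let mxk : measurable_fun setT (fun z : R * R => z.1 * z.2).
Proof. exact: measurable_funM. Qed.

Lemma csq_opp g : csq mu g -> csq mu (fun x => g (- x)) /\ cnsq mu (fun x => g (- x)) = cnsq mu g.
Proof.
move=> hg; have [mr mi] := csq_meas hg; have mc := rint_meas (rint_c2 hg).
have mN : measurable_fun setT (fun x : R => - x) by exact: measurable_funN.
have e : (\int[mu]_x (c2 (g (- x)))%:E = \int[mu]_x (c2 (g x))%:E)%E.
  rewrite [RHS]ge0_integral_opp//; first exact/measurable_EFinP.
  by move=> x; rewrite lee_fin c2_ge0.
have h : csq mu (fun x => g (- x)).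
  apply: csqP; [exact: (measurableT_comp mr mN)|exact: (measurableT_comp mi mN)|].
  by rewrite e cnsqE// ltry.
by split => //; apply: EFin_inj; rewrite -!cnsqE.
Qed.

Lemma four_adjoint f g : cint mu f -> csq mu f -> cint mu g -> csq mu g ->
  cip mu (fun x => four f (- x)) g = cip mu f (four g).
Proof.
move=> fi ff gi gg.
have [ca _] := csq_opp (csq_four fi ff); have cb := csq_four gi gg.
pose Phi (z : R * R) : R :=
  cos (z.1 * z.2) * (Rep (f z.2) * Rep (g z.1) + Imp (f z.2) * Imp (g z.1)) +
  sin (z.1 * z.2) * (Imp (f z.2) * Rep (g z.1) - Rep (f z.2) * Imp (g z.1)).
have Phii : rint (mu \x mu)%E Phi.
  have [fr fI] := fi; have [gr gI] := gi.
  have p1 := rint_prod gr fr; have p2 := rint_prod gI fI.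
  have p3 := rint_prod gr fI; have p4 := rint_prod gI fr.
  apply: rintD; apply: (@rintM_bnd _ _ _ _ _ _ 1).
  - by apply: measurableT_comp => //; exact: measurable_cosr.
  - by move=> x; exact: norm_cos_le1.
  - under [X in rint _ X]eq_fun do rewrite mulrC [X in _ + X]mulrC; exact: (rintD p1 p2).
  - by apply: measurableT_comp => //; exact: measurable_sinr.
  - by move=> x; exact: norm_sin_le1.
  - under [X in rint _ X]eq_fun do rewrite mulrC [X in _ - X]mulrC; exact: (rintB p3 p4).
have L : \int[(mu \x mu)%E]_z Phi z = cip mu (fun x => four f (- x)) g.
  rewrite (Rint_fubini1 Phii) /cip /ip -RintD; last 2 first.
  - by case: ca => c1 _; case: gg => g1 _; exact: sqint_mul.
  - by case: ca => _ c1; case: gg => _ g1; exact: sqint_mul.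
  apply: eq_Rint => x.
  have mp : measurable_fun setT (fun k : R => - x * k) by exact: measurable_funM.
  have rA := @rint_oscR _ _ _ mu _ _ mp fi; have rB := @rint_oscI _ _ _ mu _ _ mp fi.
  rewrite [X in _ = X * _ + _]/= [X in _ = _ + X * _]/= mulrC [X in _ = _ + X]mulrC.
  rewrite -(RintZ _ rA) -(RintZ _ rB) -RintD; [|exact: rintZ|exact: rintZ].
  by apply: eq_Rint => k; rewrite /Phi /= mulNr cosN sinN; ring.
rewrite -L (Rint_fubini2 Phii) /cip /ip -RintD; last 2 first.
- by case: cb => c1 _; case: ff => g1 _; exact: sqint_mul.
- by case: cb => _ c1; case: ff => _ g1; exact: sqint_mul.
apply: eq_Rint => x.
have mp : measurable_fun setT (fun k : R => x * k) by exact: measurable_funM.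
have rA := @rint_oscR _ _ _ mu _ _ mp gi; have rB := @rint_oscI _ _ _ mu _ _ mp gi.
rewrite -(RintZ _ rA) -(RintZ _ rB) -RintD; [|exact: rintZ|exact: rintZ].
by apply: eq_Rint => k; rewrite /Phi /= (mulrC k x); ring.
Qed.

Lemma cnsq_cvg (f : nat -> R -> R[i]) g : (forall n, csq mu (f n)) -> csq mu g ->
  (fun n => cnsq mu (fun x => f n x - g x)) @ \oo --> (0 : R) ->
  (fun n => cnsq mu (f n)) @ \oo --> cnsq mu g /\
  forall h, csq mu h -> (fun n => cip mu h (f n)) @ \oo --> cip mu h g.
Proof.
move=> hf hg fg.
have H h : csq mu h -> (fun n => cip mu h (f n)) @ \oo --> cip mu h g.
  move=> hh; have [hr hI] := hh.
  have nr n : nsq mu (fun x => Rep (f n x) - Rep (g x)) + nsq mu (fun x => Imp (f n x) - Imp (g x)) =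
      cnsq mu (fun x => f n x - g x).
    by rewrite /cnsq; congr (_ + _); apply: eq_Rint => x; rewrite ?ReB ?ImB.
  rewrite cipC; under [X in X @ _ --> _]eq_fun do rewrite cipC.
  apply: cvgD.
  - apply: (@ip_cvg _ (measurableTypeR R) R mu (fun n x => Rep (f n x)) (fun x => Rep (g x))) => //.
    + by move=> j; case: (hf j).
    + by case: hg.
    + apply: (squeeze_cvgr _ (cvg_cst 0) fg); near=> n.
      by rewrite nsq_ge0 -nr lerDl nsq_ge0.
  - apply: (@ip_cvg _ (measurableTypeR R) R mu (fun n x => Imp (f n x)) (fun x => Imp (g x))) => //.
    + by move=> j; case: (hf j).
    + by case: hg.
    + apply: (squeeze_cvgr _ (cvg_cst 0) fg); near=> n.
      by rewrite nsq_ge0 -nr lerDr nsq_ge0.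
split=> //.
have -> : cnsq mu g = 0 + 2 * cip mu g g - cnsq mu g by rewrite cip_self; ring.
rewrite (_ : (fun n => cnsq mu (f n)) =
  fun n => cnsq mu (fun x => f n x - g x) + 2 * cip mu g (f n) - cnsq mu g).
  by apply: cvgB; [apply: cvgD => //; apply: cvgM; [exact: cvg_cst|exact: H]|exact: cvg_cst].
by apply/funext => n; rewrite cnsqB// cipC; ring.
Unshelve. all: by end_near. Qed.

(* With [f] the inverse transform of [h], [F f = h] because
   |F f - h|^2 = |F f|^2 - 2 <F f, h> + |h|^2 = |h|^2 - |f|^2 = 0. *)
Lemma fourier_onto h : csq mu h -> exists f, [/\ csq mu f, cnsq mu f = cnsq mu h &
  (fun n => cnsq mu (fun x => (Num.sqrt (2 * pi))^-1%:C%C * four (trunc n f) (- x) - h x)) @ \oo --> (0 : R)].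
Proof.
move=> hh; have [n_ hn] := fast_tail hh.
have m0 : measurable_fun setT (fun _ : R => 0 : R) by exact: measurable_cst.
have [] := four_limit hh hn m0.
have -> : modul (fun=> 0) h = h.
  apply/funext => k; apply/eqP; rewrite eq_complex /= cos0 sin0.
  by rewrite !mul1r !mul0r subr0 addr0 !eqxx.
set U := cflim _ => cU UC.
set s := (Num.sqrt (2 * pi))^-1.
have pi0 := pi_gt0 R.
have s2 : s ^+ 2 * (2 * pi) = 1.
  rewrite /s exprVn sqr_sqrtr; last by rewrite mulr_ge0// ltW.
  by rewrite mulVf// gt_eqF// mulr_gt0.
have csqF n : csq mu (four (trunc n h)).
  by apply: csq_four; [exact: cint_trunc|exact: csq_trunc].
have [nU ipU] := cnsq_cvg csqF cU UC.
have tn : (fun n => cnsq mu (trunc n h)) @ \oo --> cnsq mu h.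
  rewrite (_ : (fun n => _) = fun n => cnsq mu h - cnsq mu (tail n h)).
    by rewrite -[X in _ --> X]subr0; apply: cvgB; [exact: cvg_cst|exact: cnsq_tail_cvg].
  by apply/funext => n; rewrite (cnsq_trunc_tail n hh) addrK.
have eU : cnsq mu U = 2 * pi * cnsq mu h.
  apply: (cvg_unique (@Rhausdorff R) nU); rewrite /=.
  rewrite (_ : (fun n => _) = fun n => 2 * pi * cnsq mu (trunc n h)).
    by apply: cvgM => //; exact: cvg_cst.
  apply/funext => n; apply: (plancherel_supp (K := n%:R)); first exact: csq_trunc.
  by move=> k; exact: trunc_supp.
pose f x : R[i] := s%:C%C * U x.
have cf : csq mu f by exact: csqZ.
exists f; split => //.
  by rewrite cnsqZ// eU mulrA s2 mul1r.
pose T n x : R[i] := s%:C%C * four (trunc n f) (- x).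
have cT n : csq mu (fun x => four (trunc n f) (- x)).
  by apply: (csq_opp _).1; apply: csq_four; [exact: cint_trunc|exact: csq_trunc].
have nT n : cnsq mu (T n) = cnsq mu (trunc n f).
  rewrite cnsqZ// (csq_opp (csq_four (cint_trunc n cf) (csq_trunc n cf))).2.
  rewrite (plancherel_supp (K := n%:R)); last 2 first.
  - exact: csq_trunc.
  - by move=> k; exact: trunc_supp.
  by rewrite mulrA s2 mul1r.
have iT n : cip mu (T n) h = cnsq mu (trunc n f).
  have l1 : (fun p => cip mu (T n) (trunc p h)) @ \oo --> cip mu (T n) h.
    apply: (cnsq_cvg (fun p => csq_trunc p hh) hh _).2; last exact: csqZ.
    rewrite (_ : (fun p => _) = fun p => cnsq mu (tail p h)); first exact: cnsq_tail_cvg.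
    apply/funext => p; apply: EFin_inj; rewrite -!cnsqE//; last 2 first.
    - exact: csq_tail.
    - by apply: csqB => //; exact: csq_trunc.
    apply: eq_integral => k _; rewrite {2}(trunc_tail p h) opprD addrA subrr sub0r.
    by rewrite c2N.
  apply: (cvg_unique (@Rhausdorff R) l1); rewrite /=.
  have e p : cip mu (T n) (trunc p h) = s * cip mu (trunc n f) (four (trunc p h)).
    have fa : cip mu (fun x => four (trunc n f) (- x)) (trunc p h) = cip mu (trunc n f) (four (trunc p h)).
      by apply: four_adjoint; [exact: cint_trunc|exact: csq_trunc|exact: cint_trunc|exact: csq_trunc].
    rewrite -fa; transitivity (cip mu (trunc p h) (T n)); first exact: cipC.
    transitivity (s * cip mu (trunc p h) (fun x => four (trunc n f) (- x))); last first.
      by apply: (congr1 ( *%R s)); exact: cipC.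
    exact: (@cipZr _ _ _ mu s (trunc p h) (fun x => four (trunc n f) (- x)) (csq_trunc p hh) (cT n)).
  under [X in X @ _ --> _]eq_fun do rewrite e.
  have -> : cnsq mu (trunc n f) = s * cip mu (trunc n f) U.
    rewrite -cipZr//; last exact: csq_trunc.
    rewrite -/f -cip_self /cip /ip; congr (_ + _); apply: eq_Rint => x; rewrite /trunc /cut; case: ifP => //=; by rewrite !mul0r.
  by apply: cvgM; [exact: cvg_cst|apply: ipU; exact: csq_trunc].
rewrite -/(T _) (_ : (fun n => _) = fun n => cnsq mu (tail n f)).
  exact: cnsq_tail_cvg.
apply/funext => n; rewrite cnsqB//; last exact: csqZ.
rewrite nT iT; have : cnsq mu f = cnsq mu h by rewrite cnsqZ// eU mulrA s2 mul1r.
by have := cnsq_trunc_tail n cf; lra.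
Qed.

End inversion.

End extension.

(** * The Airy evolution *)

Section lipschitz.
Context (R : realType).

Lemma lip1 (f df : R -> R) : (forall x : R, is_derive x 1 f (df x)) -> (forall x, `|df x| <= 1) ->
  forall a b : R, `|f a - f b| <= `|a - b|.
Proof.
move=> df1 dfb a b; wlog ab : a b / a <= b.
  move=> H; have [|/ltW] := leP a b; first exact: H.
  by move=> /H; rewrite distrC [X in _ <= X]distrC.
have [|c _ e] := @MVT_segment R f df a b ab.
  apply: continuous_subspaceT => x; apply/differentiable_continuous/derivable1_diffP.
  by case: (df1 x).
by rewrite distrC e normrM (distrC a) ler_piMl.
Qed.

Lemma cos_lip (a b : R) : `|cos a - cos b| <= `|a - b|.
Proof.
apply: (@lip1 _ (fun x => - sin x)) => x; rewrite ?normrN; last exact: norm_sin_le1.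
Qed.

Lemma sin_lip (a b : R) : `|sin a - sin b| <= `|a - b|.
Proof.
by apply: (@lip1 _ (fun x => cos x)) => x; last exact: norm_cos_le1.
Qed.

End lipschitz.

Section pointwise_bounds.
Context d (T : measurableType d) (R : realType) (m : {measure set T -> \bar R}).
Implicit Types (h : T -> R[i]) (th : T -> R).

Lemma measurable_natb (P : T -> bool) : measurable_fun setT P ->
  measurable_fun setT (fun k => (P k)%:R : R).
Proof.
move=> mP; rewrite (_ : (fun k => _) = fun k => if P k then 1 else 0); first exact: measurable_fun_ifT.
by apply/funext => k; case: (P k).
Qed.

(* Cauchy-Schwarz on the support [P]. *)
Lemma lin_le (P : T -> bool) (a b : T -> R) h (V B : R) :
  measurable_fun setT P -> (m [set k | P k] <= V%:E)%E -> csq m h ->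
  measurable_fun setT a -> measurable_fun setT b ->
  (forall k, P k -> a k ^+ 2 + b k ^+ 2 <= B) -> 0 <= B ->
  (\int[m]_k (a k * Rep (cut P h k) + b k * Imp (cut P h k))) ^+ 2 <= B * V * cnsq m h.
Proof.
move=> mP mV hh ma mb abB B0.
pose g := cut P (fun k => Complex (a k) (b k)).
have [m1 m2] := @measurable_cut _ _ R P (fun k => Complex (a k) (b k)) mP ma mb.
have mc : measurable_fun setT (fun k => c2 (g k)).
  by apply: measurable_funD; apply: measurable_funX.
have gB : (\int[m]_k (c2 (g k))%:E <= (B * V)%:E)%E.
  apply: (@le_trans _ _ (\int[m]_k (B%:E * ((P k)%:R)%:E))%E).
    apply: ge0_le_integral => //.
    - by move=> k _; rewrite lee_fin c2_ge0.
    - exact/measurable_EFinP.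
    - by apply: emeasurable_funM => //; apply/measurable_EFinP; exact: measurable_natb.
    - move=> k _; rewrite -EFinM lee_fin /g c2_cut; case: ifP => Pk; last by rewrite mulr0.
      by rewrite mulr1; exact: abB.
  rewrite ge0_integralZl//.
    by rewrite integral_pred// EFinM; apply: lee_wpmul2l; rewrite ?lee_fin.
  by apply/measurable_EFinP; exact: measurable_natb.
have gg : csq m g by apply: csqP => //; apply: le_lt_trans gB _; exact: ltry.
have hc := csq_cut mP hh.
have -> : \int[m]_k (a k * Rep (cut P h k) + b k * Imp (cut P h k)) = cip m g (cut P h).
  rewrite /cip /ip -RintD; last 2 first.
  - by case: gg => g1 _; case: hc => h1 _; exact: sqint_mul.
  - by case: gg => _ g1; case: hc => _ h1; exact: sqint_mul.
  by apply: eq_Rint => k; rewrite /g /cut; case: ifP => //= _; rewrite !mulr0.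
apply: (le_trans (cip_sqr_le gg hc)); apply: ler_pM; rewrite ?cnsq_ge0//.
- by rewrite -lee_fin -cnsqE.
- exact: cnsq_cut_le.
Qed.

Lemma osc2_cut_le (P : T -> bool) th h (V : R) :
  measurable_fun setT P -> (m [set k | P k] <= V%:E)%E -> csq m h ->
  measurable_fun setT th -> osc2 m th (cut P h) <= 2 * V * cnsq m h.
Proof.
move=> mP mV hh mth.
have mc : measurable_fun setT (fun k => cos (th k)).
  by apply: measurableT_comp => //; exact: measurable_cosr.
have ms : measurable_fun setT (fun k => sin (th k)).
  by apply: measurableT_comp => //; exact: measurable_sinr.
have msN : measurable_fun setT (fun k => - sin (th k)) by exact: measurable_funN.
have h1 : oscR m th (cut P h) ^+ 2 <= 1 * V * cnsq m h.
  rewrite (_ : oscR _ _ _ = \int[m]_k (cos (th k) * Rep (cut P h k) + - sin (th k) * Imp (cut P h k))).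
    by apply: lin_le => // k _; rewrite sqrrN cos2Dsin2.
  by apply: eq_Rint => k; rewrite mulNr.
have h2 : oscI m th (cut P h) ^+ 2 <= 1 * V * cnsq m h.
  rewrite (_ : oscI _ _ _ = \int[m]_k (sin (th k) * Rep (cut P h k) + cos (th k) * Imp (cut P h k))).
    by apply: lin_le => // k _; rewrite addrC cos2Dsin2.
  by apply: eq_Rint => k; rewrite addrC.
rewrite /osc2; lra.
Qed.

Lemma osc2B_cut_le (P : T -> bool) th th' h (V e : R) :
  measurable_fun setT P -> (m [set k | P k] <= V%:E)%E -> csq m h -> cint m (cut P h) ->
  measurable_fun setT th -> measurable_fun setT th' ->
  (forall k, P k -> `|th k - th' k| <= e) ->
  c2 (oscC m th (cut P h) - oscC m th' (cut P h)) <= 4 * e ^+ 2 * V * cnsq m h.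
Proof.
move=> mP mV hh hi mth mth' the.
have mcs (t : T -> R) : measurable_fun setT t ->
    measurable_fun setT (fun k => cos (t k)) /\ measurable_fun setT (fun k => sin (t k)).
  by move=> mt; split; apply: measurableT_comp => //; [exact: measurable_cosr|exact: measurable_sinr].
have [c1 s1] := mcs _ mth; have [c2' s2] := mcs _ mth'.
have mdc : measurable_fun setT (fun k => cos (th k) - cos (th' k)) by exact: measurable_funB.
have mds : measurable_fun setT (fun k => sin (th k) - sin (th' k)) by exact: measurable_funB.
have mdsN : measurable_fun setT (fun k => - (sin (th k) - sin (th' k))) by exact: measurable_funN.
have bnd k : P k -> (cos (th k) - cos (th' k)) ^+ 2 + (sin (th k) - sin (th' k)) ^+ 2 <= 2 * e ^+ 2.
  move=> Pk; have e0 : 0 <= e by apply: le_trans (the k Pk).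
  have sq (x : R) : `|x| <= `|th k - th' k| -> x ^+ 2 <= e ^+ 2.
    move=> xe; rewrite -(real_normK (num_real x)) lerXn2r ?nnegrE//.
    exact: le_trans xe (the k Pk).
  have := sq _ (cos_lip (th k) (th' k)); have := sq _ (sin_lip (th k) (th' k)); lra.
have e2 : 0 <= 2 * e ^+ 2 by rewrite mulr_ge0// sqr_ge0.
have h1 : (oscR m th (cut P h) - oscR m th' (cut P h)) ^+ 2 <= 2 * e ^+ 2 * V * cnsq m h.
  rewrite -RintB; [|exact: rint_oscR|exact: rint_oscR].
  rewrite (_ : Rintegral _ _ _ = \int[m]_k ((cos (th k) - cos (th' k)) * Rep (cut P h k) +
      - (sin (th k) - sin (th' k)) * Imp (cut P h k))).
    by apply: lin_le => // k Pk; rewrite sqrrN; exact: bnd.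
  by apply: eq_Rint => k; ring.
have h2 : (oscI m th (cut P h) - oscI m th' (cut P h)) ^+ 2 <= 2 * e ^+ 2 * V * cnsq m h.
  rewrite -RintB; [|exact: rint_oscI|exact: rint_oscI].
  rewrite (_ : Rintegral _ _ _ = \int[m]_k ((sin (th k) - sin (th' k)) * Rep (cut P h k) +
      (cos (th k) - cos (th' k)) * Imp (cut P h k))).
    by apply: lin_le => // k Pk; rewrite addrC; exact: bnd.
  by apply: eq_Rint => k; ring.
rewrite /c2 ReB ImB /=; lra.
Qed.

End pointwise_bounds.

Lemma cvg_exprn (R : realType) (I : Type) (F : set_system I) (FF : Filter F) (f : I -> R) (l : R) n :
  f @ F --> l -> (fun x => f x ^+ n) @ F --> l ^+ n.
Proof. by move=> fl; exact: (cvg_comp _ _ fl (@exprn_continuous _ n l)). Qed.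

Lemma fatou_lim d (Y : measurableType d) (R : realType) (p : {measure set Y -> \bar R})
    (f : nat -> Y -> R) (g : Y -> R) (c : nat -> R) (C : R) :
  (forall n, measurable_fun setT (f n)) -> measurable_fun setT g ->
  (forall n y, 0 <= f n y) -> (forall y, 0 <= g y) ->
  {ae p, forall y, f ^~ y @ \oo --> g y} ->
  (forall n, \int[p]_y (f n y)%:E <= (c n)%:E)%E -> c @ \oo --> C ->
  (\int[p]_y (g y)%:E <= C%:E)%E.
Proof.
move=> mf mg f0 g0 fg fc cC; apply/lee_addgt0Pr => e e0.
have /cvgrPdist_le/(_ _ e0)[N _ HN] := cC.
apply: (@fatou_le _ _ _ p (fun n => f (n + N)%N)) => //.
- apply: filterS fg => y fy.
  by rewrite (@cvg_shiftn N _ (f ^~ y)).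
- move=> n; apply: (le_trans (fc _)); rewrite -EFinD lee_fin.
  by have := HN (n + N)%N (leq_addl _ _); rewrite ler_norml; lra.
Qed.

Section airy_extension.
Context (R : realType).
Local Notation mu := (@lebesgue_measure R).
Local Notation mu2 := (prodm mu mu).
Implicit Types (g h : R -> R[i]).

Definition evo h (y : R * R) : R[i] := oscC mu (phase1 y) h.

Definition cpt h : Prop := exists K : R, forall k, K < `|k| -> h k = 0.

Lemma cpt_cint h : csq mu h -> cpt h -> cint mu h.
Proof. by move=> hh [K hK]; exact: csq_supp_cint hK. Qed.

Lemma cpt_trunc n h : cpt (trunc n h).
Proof. by exists n%:R => k; exact: trunc_supp. Qed.

Lemma cptB g h : cpt g -> cpt h -> cpt (fun k => g k - h k).
Proof.
move=> [K gK] [L hL]; exists (Num.max K L) => k; rewrite gt_max => /andP[Kk Lk].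
by rewrite gK// hL// subrr.
Qed.

Lemma cptZ (s : R) h : cpt h -> cpt (fun k => s%:C%C * h k).
Proof. by move=> [L hL]; exists L => k Lk; rewrite hL// mulr0. Qed.

Lemma evoB g h y : cint mu g -> cint mu h -> evo (fun k => g k - h k) y = evo g y - evo h y.
Proof.
move=> gi hi; have mp := measurable_phase1r y.
by apply/eqP; rewrite eq_complex ReB ImB /evo/= (@oscRB _ _ _ mu _ _ _ mp gi hi) (@oscIB _ _ _ mu _ _ _ mp gi hi) !eqxx.
Qed.

Lemma evoZ (s : R) h y : cint mu h -> evo (fun k => s%:C%C * h k) y = s%:C%C * evo h y.
Proof.
move=> hi; have mp := measurable_phase1r y.
rewrite /evo /oscC; apply/eqP; rewrite eq_complex ReZ ImZ/=.
have rA := @rint_oscR _ _ _ mu _ _ mp hi; have rB := @rint_oscI _ _ _ mu _ _ mp hi.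
rewrite /oscR /oscI -(RintZ _ rA) -(RintZ _ rB).
by apply/andP; split; apply/eqP; apply: eq_Rint => k; rewrite ReZ ImZ; ring.
Qed.

Lemma measurable_evo h : csq mu h ->
  measurable_fun setT (fun y => Rep (evo h y)) /\ measurable_fun setT (fun y => Imp (evo h y)).
Proof. by move=> hh; have [mr mi] := csq_meas hh; exact: (measurable_osc mu (@measurable_phase1 R) mr mi). Qed.

Lemma measurable_c2_evo h : csq mu h -> measurable_fun setT (fun y => c2 (evo h y) ^+ 4).
Proof.
move=> hh; have [m1 m2] := measurable_evo hh.
by apply: measurable_funX; exact: measurable_c2.
Qed.

Lemma measure_lt_norm (N : R) : 0 < N -> (mu [set k : R | (`|k| < N)%R] = (2 * N)%:E)%E.
Proof.
move=> N0; have -> : [set k : R | `|k| < N] = `]- N, N[%classic.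
  by apply/seteqP; split => k /=; rewrite in_itv/= ltr_norml.
rewrite lebesgue_measure_itv/= lte_fin ifT; last lra.
by rewrite -EFinB; congr EFin; lra.
Qed.

Definition strichartz_const : R := 4 * (1024 * (8 / 3 * pi ^+ 2) * 64).

Lemma strichartz_const_gt0 : 0 < strichartz_const.
Proof. by rewrite /strichartz_const; have := exprn_gt0 2 (pi_gt0 R); lra. Qed.

Lemma evo_cut_le N h y : 0 < N -> csq mu h ->
  osc2 mu (phase1 y) (cut (fun k : R => `|k| < N) h) <= 4 * cnsq mu h * N.
Proof.
move=> N0 hh; have mV : (mu [set k : R | (`|k| < N)%R] <= (2 * N)%:E)%E by rewrite measure_lt_norm.
have := @osc2_cut_le _ _ _ mu _ _ _ _ (measurable_lt_norm N) mV hh (measurable_phase1r y).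
by move=> /le_trans; apply; lra.
Qed.

Lemma strichartz_le h b : csq mu h -> cpt h -> 0 < b -> cnsq mu h <= b ->
  (\int[mu2]_y (c2 (evo h y) ^+ 4)%:E <= (strichartz_const * b ^+ 4)%:E)%E.
Proof.
move=> hh [K hK] b0 hb; have M0 : 0 < 4 * b by rewrite mulr_gt0.
have hM N y : 0 < N -> osc2 mu (phase1 y) (cut (fun k : R => `|k| < N) h) <= 4 * b * N.
  move=> N0; apply: (le_trans (evo_cut_le y N0 hh)).
  by rewrite ler_pM2r// ler_pM2l.
have := refined_strichartz hh hK M0 hM b0 hb.
by rewrite /strichartz_const (_ : _ * (4 * b) * _ = 4 * (1024 * (8 / 3 * pi ^+ 2) * 64) * b ^+ 4)//; ring.
Qed.

Lemma rint_evo8 h : csq mu h -> cpt h -> rint mu2 (fun y => c2 (evo h y) ^+ 4).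
Proof.
move=> hh hc; apply: rint_ge0.
- exact: measurable_c2_evo.
- by move=> y; rewrite exprn_ge0// c2_ge0.
- have b0 : 0 < cnsq mu h + 1 by have := cnsq_ge0 mu h; lra.
  have b1 : cnsq mu h <= cnsq mu h + 1 by lra.
  by apply: le_lt_trans (strichartz_le hh hc b0 b1) _; exact: ltry.
Qed.

Definition l8 h : R := \int[mu2]_y (c2 (evo h y) ^+ 4).

Lemma l8E h : csq mu h -> cpt h -> (\int[mu2]_y (c2 (evo h y) ^+ 4)%:E)%E = (l8 h)%:E.
Proof. by move=> hh hc; exact: (rint_EFin (rint_evo8 hh hc)). Qed.

Lemma l8_ge0 h : 0 <= l8 h.
Proof. by apply: Rintegral_ge0 => y _; rewrite exprn_ge0// c2_ge0. Qed.

Lemma l8_le h b : csq mu h -> cpt h -> 0 < b -> cnsq mu h <= b -> l8 h <= strichartz_const * b ^+ 4.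
Proof. by move=> hh hc b0 hb; rewrite -lee_fin -l8E//; exact: strichartz_le. Qed.

Definition unit_l8 : set R := [set l8 h | h in [set h | [/\ csq mu h, cpt h & cnsq mu h = 1]]].
Definition a8 : R := sup unit_l8.

Lemma unit_l8_ub : has_ubound unit_l8.
Proof.
exists (strichartz_const * 1 ^+ 4) => _ [h [hh hc h1] <-].
by apply: l8_le => //; rewrite h1.
Qed.

Lemma l8_le_a8 h : csq mu h -> cpt h -> l8 h <= a8 * cnsq mu h ^+ 4.
Proof.
move=> hh hc; have := cnsq_ge0 mu h; rewrite le_eqVlt => /orP[/eqP h0|h0].
  rewrite -h0 expr0n mulr0; apply/ler_addgt0Pl => e e0; rewrite addr0.
  have S0 := strichartz_const_gt0; pose b := Num.min 1 (e / strichartz_const).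
  have b0 : 0 < b by rewrite lt_min ltr01/= divr_gt0.
  have b1 : b <= 1 by rewrite ge_min lexx.
  have be : b <= e / strichartz_const by rewrite ge_min lexx orbT.
  have hb : cnsq mu h <= b by rewrite -h0 ltW.
  apply: (le_trans (l8_le hh hc b0 hb)); rewrite mulrC -ler_pdivlMr//.
  apply: le_trans be; rewrite exprS ler_piMr//; first exact: ltW.
  by rewrite exprn_ile1// ltW.
pose s := (Num.sqrt (cnsq mu h))^-1.
have s2 : s ^+ 2 = (cnsq mu h)^-1 by rewrite exprVn sqr_sqrtr// ltW.
have h1 := cpt_cint hh hc.
have e : l8 (fun k => s%:C%C * h k) = l8 h / cnsq mu h ^+ 4.
  rewrite mulrC -exprVn -s2 -RintZ; last exact: rint_evo8.
  apply: eq_Rint => y; rewrite evoZ// c2M exprMn; congr (_ * _).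
  by rewrite /c2/= expr0n addr0.
rewrite -ler_pdivrMr ?exprn_gt0// -e; apply: ub_le_sup; first exact: unit_l8_ub.
exists (fun k => s%:C%C * h k) => //; split; [exact: csqZ|exact: cptZ|].
by rewrite cnsqZ// s2 mulVf// gt_eqF.
Qed.

Lemma unit_l8_neq0 : unit_l8 !=set0.
Proof.
pose h : R -> R[i] := itv_fun 1 0 1; have hh : csq mu h := csq_itv 1 0 1.
exists (l8 h); exists h => //; split=> //.
- exists 1 => k k1; rewrite /h /itv_fun /cut; case: ifP => // /andP[k0 k1'].
  by rewrite ger0_norm// ltNge k1' in k1.
- apply: EFin_inj; rewrite -cnsqE//.
  transitivity (\int[mu]_k (((0 <= k) && (k <= 1))%:R%:E))%E.
    by apply: eq_integral => k _; rewrite /h /itv_fun c2_cut /c2 /=; case: ifP => //= _; rewrite expr1n expr0n addr0.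
  rewrite lebesgue_integral_pred; last exact: measurable_itv.
  rewrite (_ : [set k | _] = `[0, 1]%classic); last by apply/seteqP; split => k /=; rewrite in_itv.
  by rewrite lebesgue_measure_itv/= lte_fin ltr01 -EFinB subr0.
Qed.

Lemma a8_ge0 : 0 <= a8.
Proof.
have [x Sx] := unit_l8_neq0; apply: le_trans (ub_le_sup unit_l8_ub Sx).
by case: Sx => h _ <-; exact: l8_ge0.
Qed.

(* Summing [16 ^ (3 j) |d_j|^8] gives almost everywhere convergence. *)
Lemma ae_fast_cvg d (Y : measurableType d) (p : {measure set Y -> \bar R}) (f : nat -> Y -> R) (C : R) :
  (forall j, measurable_fun setT (f j)) -> 0 <= C ->
  (forall j, \int[p]_y ((f j.+1 y - f j y) ^+ 8)%:E <= (C * (16^-1 ^+ j) ^+ 4)%:E)%E ->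
  {ae p, forall y, f ^~ y @ \oo --> flim f y}.
Proof.
move=> mf C0 fC.
pose G y := (\sum_(0 <= j <oo) ((16 ^+ j) ^+ 3 * (f j.+1 y - f j y) ^+ 8)%:E)%E.
have d0 j y : (0 <= ((16 ^+ j) ^+ 3 * (f j.+1 y - f j y) ^+ 8)%:E)%E.
  by rewrite lee_fin; apply: mulr_ge0; [rewrite exprn_ge0// exprn_ge0|rewrite exprn_even_ge0].
have md j : measurable_fun setT (fun y => (f j.+1 y - f j y) ^+ 8).
  by apply: measurable_funX; exact: measurable_funB.
have mdE j : measurable_fun setT (fun y => ((16 ^+ j) ^+ 3 * (f j.+1 y - f j y) ^+ 8)%:E).
  by apply/measurable_EFinP; exact: measurable_funM.
have G0 y : (0 <= G y)%E by apply: nneseries_ge0 => j _ _.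
have mG : measurable_fun setT G by apply: ge0_emeasurable_sum.
have IG : (\int[p]_y G y <= (C * 2)%:E)%E.
  rewrite integral_nneseries//.
  have le1 j : (\int[p]_y ((16 ^+ j) ^+ 3 * (f j.+1 y - f j y) ^+ 8)%:E <= (C * 2^-1 ^+ j)%:E)%E.
    under eq_integral do rewrite EFinM.
    rewrite ge0_integralZl//; last 2 first.
    - exact/measurable_EFinP.
    - by move=> y _; rewrite lee_fin exprn_even_ge0.
    apply: (le_trans (lee_wpmul2l _ (fC j))); first by rewrite lee_fin !exprn_ge0.
    rewrite -EFinM lee_fin mulrCA ler_wpM2l//.
    have -> : (16 ^+ j) ^+ 3 * (16^-1 ^+ j) ^+ 4 = 16^-1 ^+ j :> R.
      rewrite !exprVn; set a : R := 16 ^+ j; have a0 : a != 0 by rewrite expf_neq0.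
      by field.
    by rewrite lerXn2r ?nnegrE// lef_pV2 ?posrE// ler_nat.
  apply: (@le_trans _ _ (\sum_(0 <= j <oo) (C * 2^-1 ^+ j)%:E)%E).
    by apply: lee_nneseries => // j _ _; exact: integral_ge0.
  have -> : (fun n => \sum_(0 <= j < n) (C * 2^-1 ^+ j)%:E)%E =
      (fun n => (series (geometric C 2^-1) n)%:E).
    by apply/funext => n; rewrite sumEFin; congr EFin.
  have c : series (geometric C 2^-1) @ \oo --> (C * (1 - 2^-1)^-1 : R).
    by apply: cvg_geometric_series; rewrite ger0_norm// invf_lt1// ltr1n.
  have cE : (series (geometric C 2^-1) n)%:E @[n --> \oo] --> (C * (1 - 2^-1)^-1 : R)%:E.
    by apply: cvg_EFin => //; exact: nearW.
  rewrite (cvg_lim _ cE)// lee_fin.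
  by rewrite (_ : 1 - 2^-1 = 2^-1) ?invrK//; field.
have Gi : p.-integrable setT G.
  apply/integrableP; split=> //.
  by under eq_integral do rewrite gee0_abs//; rewrite (le_lt_trans IG)// ltry.
apply: filterS (integrable_ae measurableT Gi) => y /(_ Logic.I) Gy.
have s0 : 0 <= 1 + fine (G y) by rewrite addr_ge0// fine_ge0.
have [|l fl _] := @fast_cauchy_cvg R (f ^~ y) _ s0; last by rewrite (flimE fl).
move=> j; have h : (16 ^+ j) ^+ 3 * (f j.+1 y - f j y) ^+ 8 <= fine (G y).
  rewrite -lee_fin fineK//; apply: (le_trans _ (nneseries_lim_ge j.+1 _)) => //.
  by rewrite big_nat_recr//= leeDr// sume_ge0.
pose b : R := 2 ^+ j; have b1 : 1 <= b by apply: exprn_ege1; rewrite ler1n.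
have b0 : 0 < b by apply: lt_le_trans b1.
rewrite exprVn -/b ler_pdivlMr// mulrC -(ler_pXn2r (n := 8))// ?nnegrE; last by rewrite mulr_ge0// ltW.
rewrite exprMn -normrX ger0_norm; last by rewrite exprn_even_ge0.
have e16 : (16 ^+ j) ^+ 3 = b ^+ 12 :> R.
  have e4 : (16 : R) = 2 ^+ 4 by rewrite -natrX.
  by rewrite e4 /b -!exprM; congr (_ ^+ _); lia.
have S0 : 0 <= fine (G y) by rewrite fine_ge0.
apply: (@le_trans _ _ (fine (G y))).
  apply: le_trans h; rewrite e16; apply: ler_wpM2r; first by rewrite exprn_even_ge0.
  by rewrite ler_weXn2l.
apply: (@le_trans _ _ (1 + fine (G y))); first by rewrite lerDr.
by rewrite exprS ler_peMr// exprn_ege1// lerDl.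
Qed.

Section extension.
Variables (h : R -> R[i]) (n_ : nat -> nat).
Hypothesis hh : csq mu h.
Hypothesis hN : forall j, (j <= n_ j)%N /\ cnsq mu (tail (n_ j) h) <= 16^-1 ^+ j / 16.

(* The evolution of a general L^2 function [h]: along a fast truncation sequence
   the compactly supported evolutions converge almost everywhere. *)
Definition ext : R * R -> R[i] := cflim (fun j => evo (trunc (n_ j) h)).

Lemma measurable_ext : measurable_fun setT (fun y => Rep (ext y)) /\
  measurable_fun setT (fun y => Imp (ext y)).
Proof.
by split; apply: measurable_flim => j; have [m1 m2] := measurable_evo (csq_trunc (n_ j) hh).
Qed.

Lemma ext_slice (t : R) : csq mu (fun x => ext (t, x)) /\
  (fun n => cnsq mu (fun x => evo (trunc n h) (t, x) - ext (t, x))) @ \oo --> (0 : R).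
Proof.
have mt : measurable_fun setT (fun k : R => t * k ^+ 3) by apply: measurable_funM => //; exact: measurable_funX.
have [cU UC] := four_limit hh hN mt.
have e n x : four (trunc n (modul (fun k : R => t * k ^+ 3) h)) x = evo (trunc n h) (t, x).
  by rewrite /four /trunc cut_modul -oscC_modul.
have eU : cflim (fun j => four (trunc (n_ j) (modul (fun k : R => t * k ^+ 3) h))) = fun x => ext (t, x).
  have -> : (fun j => four (trunc (n_ j) (modul (fun k : R => t * k ^+ 3) h))) =
      fun j x => evo (trunc (n_ j) h) (t, x).
    by apply/funext => j; apply/funext => x; exact: e.
  by [].
rewrite eU in cU UC; split; first exact: cU.
by under [X in X @ _ --> _]eq_fun do under eq_fun do rewrite -e.
Qed.

Lemma ext_ae : {ae mu2, forall y, (fun j => Rep (evo (trunc (n_ j) h) y)) @ \oo --> Rep (ext y) /\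
  (fun j => Imp (evo (trunc (n_ j) h) y)) @ \oo --> Imp (ext y)}.
Proof.
have S0 := ltW strichartz_const_gt0.
have D j : (\int[mu2]_y (c2 (evo (trunc (n_ j.+1) h) y - evo (trunc (n_ j) h) y) ^+ 4)%:E <=
    (strichartz_const * (16^-1 ^+ j) ^+ 4)%:E)%E.
  have c1 := csq_trunc (n_ j.+1) hh; have c2' := csq_trunc (n_ j) hh.
  under eq_integral => y _ do rewrite -(evoB y (cint_trunc (n_ j.+1) hh) (cint_trunc (n_ j) hh)).
  apply: strichartz_le.
  - exact: csqB.
  - by apply: cptB; exact: cpt_trunc.
  - by rewrite exprn_gt0.
  - apply: (le_trans (cnsq_truncB _ _ hh)).
    have := (hN j).2; have := (hN j.+1).2; rewrite exprS.
    have : 0 <= 16^-1 ^+ j :> R by rewrite exprn_ge0.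
    lra.
have le8 (x y : R) : x ^+ 8 <= (x ^+ 2 + y ^+ 2) ^+ 4.
  by rewrite (exprM x 2 4) lerXn2r ?nnegrE ?addr_ge0 ?sqr_ge0// lerDl sqr_ge0.
have le8' (x y : R) : x ^+ 8 <= (y ^+ 2 + x ^+ 2) ^+ 4 by rewrite addrC.
have mev j := measurable_evo (csq_trunc (n_ j) hh).
have mD j : measurable_fun setT (fun y => c2 (evo (trunc (n_ j.+1) h) y - evo (trunc (n_ j) h) y) ^+ 4).
  have [a1 a2] := mev j; have [b1 b2] := mev j.+1.
  apply: measurable_funX; rewrite /c2.
  under eq_fun do rewrite ReB ImB.
  by apply: measurable_funD; apply: measurable_funX; exact: measurable_funB.
have aR := @ae_fast_cvg _ _ mu2 (fun j y => Rep (evo (trunc (n_ j) h) y)) _ (fun j => (mev j).1) S0.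
have aI := @ae_fast_cvg _ _ mu2 (fun j y => Imp (evo (trunc (n_ j) h) y)) _ (fun j => (mev j).2) S0.
have {}aR : {ae mu2, forall y, (fun j => Rep (evo (trunc (n_ j) h) y)) @ \oo --> Rep (ext y)}.
  apply: aR => j; apply: le_trans (D j); apply: ge0_le_integral => //.
  - by move=> y _; rewrite lee_fin exprn_even_ge0.
  - apply/measurable_EFinP; apply: measurable_funX; apply: measurable_funB; [exact: (mev j.+1).1|exact: (mev j).1].
  - by apply/measurable_EFinP; exact: mD.
  - by move=> y _; rewrite lee_fin /c2 ReB ImB; exact: le8.
have {}aI : {ae mu2, forall y, (fun j => Imp (evo (trunc (n_ j) h) y)) @ \oo --> Imp (ext y)}.
  apply: aI => j; apply: le_trans (D j); apply: ge0_le_integral => //.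
  - by move=> y _; rewrite lee_fin exprn_even_ge0.
  - apply/measurable_EFinP; apply: measurable_funX; apply: measurable_funB; [exact: (mev j.+1).2|exact: (mev j).2].
  - by apply/measurable_EFinP; exact: mD.
  - by move=> y _; rewrite lee_fin /c2 ReB ImB; exact: le8'.
apply: filterS2 aR aI; first exact: (ae_filter_ringOfSetsType mu2).
by [].
Qed.

Lemma ext_B_le g : csq mu g -> cpt g ->
  (\int[mu2]_y (c2 (evo g y - ext y) ^+ 4)%:E <= (a8 * cnsq mu (fun k => g k - h k) ^+ 4)%:E)%E.
Proof.
move=> gg gc; have gi := cpt_cint gg gc.
have ct n := csq_trunc n hh; have gt n := csqB gg (ct n).
have cc : (fun j => cnsq mu (fun k => g k - trunc (n_ j) h k)) @ \oo --> cnsq mu (fun k => g k - h k).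
  apply: (cnsq_cvg (fun j => gt (n_ j)) (csqB gg hh) _).1.
  have tc : (fun j => cnsq mu (tail (n_ j) h)) @ \oo --> (0 : R).
    have c16 : (fun j => 16^-1 ^+ j / 16 : R) @ \oo --> (0 : R).
      rewrite -(mul0r (16^-1 : R)); apply: cvgM; last exact: cvg_cst.
      by apply: cvg_expr; rewrite ger0_norm// invf_lt1// ltr1n.
    apply: (squeeze_cvgr _ (cvg_cst 0) c16); near=> j.
    by rewrite cnsq_ge0 (hN j).2.
  rewrite (_ : (fun n => _) = fun j => cnsq mu (tail (n_ j) h))//.
  apply/funext => j; apply: EFin_inj; have ht := csq_tail (n_ j) hh.
  rewrite -(cnsqE ht) -cnsqE; last by apply: csqB => //; exact: csqB.
  apply: eq_integral => k _; rewrite {2}(trunc_tail (n_ j) h); congr (c2 _)%:E; ring.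
have [m1 m2] := measurable_ext; have [g1 g2] := measurable_evo gg.
apply: (@fatou_lim _ _ _ mu2 (fun j y => c2 (evo g y - evo (trunc (n_ j) h) y) ^+ 4) _
   (fun j => a8 * cnsq mu (fun k => g k - trunc (n_ j) h k) ^+ 4)).
- move=> j; have [b1 b2] := measurable_evo (ct (n_ j)).
  by apply: measurable_funX; exact: measurable_c2B g1 g2 b1 b2.
- by apply: measurable_funX; exact: measurable_c2B g1 g2 m1 m2.
- by move=> j y; rewrite exprn_ge0// c2_ge0.
- by move=> y; rewrite exprn_ge0// c2_ge0.
- apply: filterS ext_ae; first exact: (ae_filter_ringOfSetsType mu2).
  move=> y [yr yi]; apply: cvg_exprn.
  rewrite /c2; under [X in X @ _ --> _]eq_fun do rewrite ReB ImB.
  rewrite ReB ImB; apply: cvgD.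
    by apply: cvg_exprn; apply: cvgB; [exact: cvg_cst|exact: yr].
  by apply: cvg_exprn; apply: cvgB; [exact: cvg_cst|exact: yi].
- move=> j; under eq_integral => y _ do rewrite -(evoB y gi (cint_trunc (n_ j) hh)).
  have gc' : cpt (fun k => g k - trunc (n_ j) h k) by apply: cptB => //; exact: cpt_trunc.
  by rewrite l8E// lee_fin; exact: l8_le_a8.
- by apply: cvgM; [exact: cvg_cst|exact: cvg_exprn].
Unshelve. all: by end_near. Qed.

End extension.

End airy_extension.

(** * Symmetries and compactness *)

Section symmetries.
Context (R : realType).
Local Notation mu := (@lebesgue_measure R).
Local Notation mu2 := (prodm mu mu).
Implicit Types (g h : R -> R[i]).

Lemma ge0_integral2_affine (a c b e : R) (f : R * R -> R) : 0 < a -> 0 < b ->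
  measurable_fun setT f -> (forall y, 0 <= f y) ->
  (\int[mu2]_y (f y)%:E = (a * b)%:E * \int[mu2]_y (f (a * y.1 + c, b * y.2 + e))%:E)%E.
Proof.
move=> a0 b0 mf f0; have mE : measurable_fun setT (EFin \o f) by exact/measurable_EFinP.
have fE0 y : (0 <= (EFin \o f) y)%E by rewrite lee_fin.
pose f' (y : R * R) := f (a * y.1 + c, b * y.2 + e).
have mf' : measurable_fun setT f'.
  apply: (measurableT_comp mf); apply: measurable_fun_pair.
    by apply: measurable_funD => //; exact: measurable_funM.
  by apply: measurable_funD => //; exact: measurable_funM.
have mE' : measurable_fun setT (EFin \o f') by exact/measurable_EFinP.
have fE0' y : (0 <= (EFin \o f') y)%E by rewrite lee_fin /f'.
rewrite [in LHS]/prodm (@fubini_tonelli1 _ _ _ _ _ mu mu (EFin \o f) mE fE0).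
rewrite [in RHS]/prodm (@fubini_tonelli1 _ _ _ _ _ mu mu (EFin \o f') mE' fE0').
have mF : measurable_fun setT (fubini_F mu (EFin \o f)).
  exact: (@measurable_fun_fubini_tonelli_F _ _ _ _ _ mu (EFin \o f)).
have F0 x : (0 <= fubini_F mu (EFin \o f) x)%E by apply: integral_ge0.
have e1 := ge0_integral_affine c a0 mF F0.
rewrite [LHS]e1 EFinM -muleA; congr (_ * _)%E.
rewrite -ge0_integralZl//; last 3 first.
- exact: (@measurable_fun_fubini_tonelli_F _ _ _ _ _ mu (EFin \o f')).
- by move=> x _; apply: integral_ge0.
- by rewrite lee_fin ltW.
apply: eq_integral => x _; rewrite /fubini_F.
rewrite (@ge0_integral_affine _ b e)//.
by apply/measurable_EFinP; exact: (measurableT_comp mf (pair1_measurable _)).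
Qed.

Definition dil (s N : R) h (k : R) : R[i] := s%:C%C * h (N * k).

Lemma oscC_dil (s N : R) (th : R -> R) h : 0 < N -> cint mu h -> measurable_fun setT th ->
  oscC mu (fun k => th (N * k)) (dil s N h) = (s / N)%:C%C * oscC mu th h.
Proof.
move=> N0 hi mth.
have rA := @rint_oscR _ _ _ mu _ _ mth hi; have rB := @rint_oscI _ _ _ mu _ _ mth hi.
have e (f : R -> R) : rint mu f -> \int[mu]_k (s * f (N * k)) = s / N * \int[mu]_k f k.
  move=> fi; have [h1 h2] := Rint_affine 0 N0 fi.
  have e0 : (fun k => f (N * k + 0)) = fun k => f (N * k) by apply/funext => k; rewrite addr0.
  rewrite e0 in h1 h2; rewrite RintZ// h2; field.
  by rewrite gt_eqF.
rewrite /oscC; apply/eqP; rewrite eq_complex ReZ ImZ/=.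
rewrite /oscR /oscI -(e _ rA) -(e _ rB).
by apply/andP; split; apply/eqP; apply: eq_Rint => k; rewrite /dil ReZ ImZ; ring.
Qed.

Lemma csq_dil (s N : R) h : 0 < N -> csq mu h ->
  csq mu (dil s N h) /\ cnsq mu (dil s N h) = s ^+ 2 / N * cnsq mu h.
Proof.
move=> N0 hh; have [mr mi] := csq_meas hh.
have mN : measurable_fun setT (fun k : R => N * k) by exact: measurable_funM.
have mr' : measurable_fun setT (fun k => Rep (dil s N h k)).
  by rewrite /dil; under eq_fun do rewrite ReZ; apply: measurable_funM => //; exact: (measurableT_comp mr mN).
have mi' : measurable_fun setT (fun k => Imp (dil s N h k)).
  by rewrite /dil; under eq_fun do rewrite ImZ; apply: measurable_funM => //; exact: (measurableT_comp mi mN).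
have mc : measurable_fun setT (fun k => c2 (h k)) := rint_meas (rint_c2 hh).
have e : (\int[mu]_k (c2 (dil s N h k))%:E = (s ^+ 2 / N * cnsq mu h)%:E)%E.
  have mcE : measurable_fun setT (fun k => (c2 (h k))%:E) by exact/measurable_EFinP.
  have e1 := @ge0_integral_affine R N 0 (fun k => (c2 (h k))%:E) N0 mcE (fun k => c2_ge0 (h k)).
  rewrite (cnsqE hh) in e1.
  transitivity ((s ^+ 2)%:E * \int[mu]_k (c2 (h (N * k)))%:E)%E.
    rewrite -ge0_integralZl//; last 3 first.
    - by apply/measurable_EFinP; exact: (measurableT_comp mc mN).
    - by move=> k _; rewrite lee_fin c2_ge0.
    - by rewrite lee_fin sqr_ge0.
    by apply: eq_integral => k _; rewrite /dil c2M -EFinM; congr (_ * _)%:E; rewrite /c2/= expr0n addr0.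
  transitivity ((s ^+ 2 / N)%:E * (N%:E * \int[mu]_x (c2 (h (N * x + 0)))%:E))%E; last first.
    by rewrite [RHS]EFinM; congr (_ * _)%E; exact/esym.
  rewrite muleA -EFinM divfK ?gt_eqF//.
  by congr (_ * _)%E; apply: eq_integral => k _; rewrite addr0.
have hc : csq mu (dil s N h) by apply: csqP => //; rewrite e ltry.
by split => //; apply: EFin_inj; rewrite -cnsqE.
Qed.

(* Galilean-type symmetries: dilations and translations in [t] and [x]. *)
Lemma concentrate h (N : R) (y0 : R * R) : 0 < N -> csq mu h -> cpt h ->
  exists g, [/\ csq mu g, cpt g, cnsq mu g = cnsq mu h, l8 g = l8 h &
    osc2 mu (fun=> 0) (cut (fun k : R => `|k| < 1) g) =
    osc2 mu (phase1 y0) (cut (fun k : R => `|k| < N) h) / N].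
Proof.
move=> N0 hh hc; have hi := cpt_cint hh hc.
have mp := @measurable_phase1r R y0.
pose H := modul (phase1 y0) h.
have HH : csq mu H by exact: csq_modul.
have Hi : cint mu H by exact: cint_modul.
have N0' : N != 0 by rewrite gt_eqF.
pose s := Num.sqrt N; have s2 : s ^+ 2 = N by rewrite sqr_sqrtr// ltW.
pose g := dil s N H; have [gg ng] := csq_dil s N0 HH.
have gc : cpt g.
  case: hc => K hK; exists (K / N) => k; rewrite ltr_pdivrMr// => Kk.
  rewrite /g /dil /H /modul hK; last by rewrite normrM (gtr0_norm N0) mulrC.
  by apply/eqP; rewrite eq_complex /= !mulr0 subrr addr0 !mulr0 subrr addr0 !eqxx.
have sN : (s / N) ^+ 2 = N^-1 by rewrite exprMn s2 exprVn; field.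
exists g; split; [exact: gg|exact: gc| | |].
- by rewrite ng s2 divff// mul1r /H cnsq_modul.
- have eg y : evo g y = (s / N)%:C%C * evo h (N ^- 3 * y.1 + y0.1, N^-1 * y.2 + y0.2).
    rewrite /evo /g (_ : phase1 y = fun k => phase1 (N ^- 3 * y.1, N^-1 * y.2) (N * k)); last first.
      by apply/funext => k; rewrite /phase1/=; field.
    rewrite (oscC_dil s N0 Hi (measurable_phase1r (N ^- 3 * y.1, N^-1 * y.2))).
    congr (_ * _); rewrite /H -oscC_modul; congr (oscC _ _ _).
    by apply/funext => k; rewrite /phase1/=; ring.
  have e1 := l8E hh hc; have e2 := l8E (gg : csq mu g) gc.
  apply: EFin_inj; apply: (etrans (esym e2)); apply: (etrans _ e1).
  have N3 : 0 < N ^- 3 by rewrite invr_gt0 exprn_gt0.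
  have N1 : 0 < N^-1 by rewrite invr_gt0.
  rewrite [RHS](ge0_integral2_affine y0.1 y0.2 N3 N1)//; last 2 first.
  - exact: measurable_c2_evo.
  - by move=> y; rewrite exprn_ge0// c2_ge0.
  rewrite -ge0_integralZl//; last 3 first.
  - apply/measurable_EFinP; apply: (measurableT_comp (measurable_c2_evo hh)).
    apply: measurable_fun_pair.
      by apply: measurable_funD => //; exact: measurable_funM.
    by apply: measurable_funD => //; exact: measurable_funM.
  - by move=> y _; rewrite lee_fin exprn_ge0// c2_ge0.
  - by rewrite lee_fin mulr_ge0// ltW.
  apply: eq_integral => y _; rewrite eg c2Z sN -EFinM; congr EFin.
  by rewrite exprMn; congr (_ * _); field.
- have ec : cut (fun k : R => `|k| < 1) g = dil s N (cut (fun k : R => `|k| < N) H).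
    apply/funext => k; rewrite /g /dil /cut normrM (gtr0_norm N0) gtr_pMr//.
    by case: ifP => // _; rewrite mulr0.
  have mlt : measurable_fun setT (fun k : R => `|k| < N) := measurable_lt_norm N.
  have ci : cint mu (cut (fun k : R => `|k| < N) H) by exact: cint_cut.
  have mz : measurable_fun setT (fun _ : R => 0 : R) by exact: measurable_cst.
  rewrite ec -c2_oscC (oscC_dil s N0 ci mz) c2Z sN mulrC; congr (_ / _).
  rewrite /H cut_modul -(@oscC_modul _ _ _ mu (fun=> 0) (phase1 y0)) c2_oscC.
  by rewrite (_ : (fun k => 0 + phase1 y0 k) = phase1 y0)//; apply/funext => k; exact: add0r.
Qed.

End symmetries.

Section pointwise.
Context (R : realType).
Implicit Types (a b : R[i]).

Lemma pow8_far (d : R) : 0 < d -> exists2 C, 0 <= C &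
  forall P B : R, 0 <= P -> 0 <= B -> (P + B) ^+ 8 <= (1 + d) * B ^+ 8 + C * P ^+ 8.
Proof.
move=> d0; pose t := Num.min 1 (d / 255).
have p255 : 0 < 255 :> R by rewrite ltr0n.
have t0 : 0 < t by rewrite lt_min ltr01 (divr_gt0 d0 p255).
have t1 : t <= 1 by rewrite ge_min lexx.
have td : 255 * t <= d by rewrite mulrC -(ler_pdivlMr _ _ p255) ge_min lexx orbT.
have sq (c : R) : 0 <= c -> (1 + c * t) ^+ 2 <= 1 + (2 * c + c ^+ 2) * t.
  move=> c0; have tt : t ^+ 2 <= t by rewrite expr2 ler_piMr// ltW.
  by have := ler_wpM2l (sqr_ge0 c) tt; lra.
have p0 (c : R) : 0 <= c -> 0 <= 1 + c * t by move=> c0; rewrite addr_ge0// mulr_ge0// ltW.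
have t8 : (1 + t) ^+ 8 <= 1 + d.
  have h1 : (1 + t) ^+ 2 <= 1 + 3 * t by have := sq 1 ler01; lra.
  have h2 : (1 + t) ^+ 4 <= 1 + 15 * t.
    rewrite (exprM _ 2 2); apply: (@le_trans _ _ ((1 + 3 * t) ^+ 2)).
      by rewrite lerXn2r// nnegrE ?sqr_ge0// p0.
    by have := sq 3 (ler0n _ _); lra.
  rewrite (exprM _ 4 2); apply: (@le_trans _ _ ((1 + 15 * t) ^+ 2)).
    by rewrite lerXn2r// nnegrE ?exprn_ge0 ?p0// addr_ge0// ltW.
  by have := sq 15 (ler0n _ _); lra.
exists ((1 + t^-1) ^+ 8); first by rewrite exprn_ge0// addr_ge0// invr_ge0 ltW.
move=> P B P0 B0; have [PB|BP] := leP P (t * B).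
  apply: (@le_trans _ _ ((1 + d) * B ^+ 8)); last first.
    by rewrite lerDl mulr_ge0// exprn_ge0// addr_ge0// invr_ge0 ltW.
  apply: (@le_trans _ _ (((1 + t) * B) ^+ 8)).
    have q1 : 0 <= P + B by exact: addr_ge0.
    have q2 : P + B <= (1 + t) * B by lra.
    by rewrite lerXn2r ?nnegrE//; exact: le_trans q2.
  by rewrite exprMn ler_wpM2r// exprn_ge0.
apply: (@le_trans _ _ ((1 + t^-1) ^+ 8 * P ^+ 8)); last first.
  by rewrite lerDr mulr_ge0// ?exprn_ge0// addr_ge0// ltW.
rewrite -exprMn lerXn2r ?nnegrE ?addr_ge0 ?mulr_ge0 ?addr_ge0// ?invr_ge0 ?ltW//.
by rewrite mulrDl mul1r ltrD2l mulrC ltr_pdivlMr// mulrC.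
Qed.

Lemma pow8_near (d e m : R) : 0 < d -> 0 < e -> 0 <= m -> exists2 C, 0 <= C &
  forall P B : R, 0 <= P -> P <= m -> 0 <= B ->
    (P + B) ^+ 8 <= P ^+ 8 + e + C * B ^+ 2 + (1 + d) * B ^+ 8.
Proof.
move=> d0 e0 m0; have [C0 C00 HC] := pow8_far d0.
pose M := 1 + m; have M1 : 1 <= M by rewrite lerDl.
have M0 : 0 < M by apply: lt_le_trans M1.
pose t := Num.min 1 (e / (8 * M ^+ 7)).
have k0 : 0 < 8 * M ^+ 7 by rewrite mulr_gt0// exprn_gt0.
have t0 : 0 < t by rewrite lt_min ltr01/= divr_gt0.
have t1 : t <= 1 by rewrite ge_min lexx.
have te : t * (8 * M ^+ 7) <= e by rewrite -ler_pdivlMr// ge_min lexx orbT.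
pose C := C0 * m ^+ 8 / t ^+ 2.
have CC : 0 <= C by rewrite divr_ge0 ?mulr_ge0 ?exprn_ge0// ltW.
exists C => // P B P0 Pm B0.
have B8 : 0 <= (1 + d) * B ^+ 8 by rewrite mulr_ge0 ?exprn_ge0// addr_ge0// ltW.
have CB : 0 <= C * B ^+ 2 by rewrite mulr_ge0// sqr_ge0.
have P8 : 0 <= P ^+ 8 by rewrite exprn_ge0.
have [Bt|tB] := leP B t.
  suff h : (P + B) ^+ 8 - P ^+ 8 <= e by lra.
  set A := P + B; have A0 : 0 <= A by rewrite addr_ge0.
  have AM : A <= M by rewrite /A /M; lra.
  have PM : P <= M by rewrite /M; lra.
  have pX n : A ^+ n <= M ^+ n /\ P ^+ n <= M ^+ n by split; rewrite lerXn2r ?nnegrE// ltW.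
  have -> : A ^+ 8 - P ^+ 8 = B * (A + P) * ((A ^+ 2 + P ^+ 2) * (A ^+ 4 + P ^+ 4)).
    by rewrite (_ : B = A - P) /A; ring.
  apply: le_trans te; have -> : t * (8 * M ^+ 7) = t * (2 * M) * (2 * M ^+ 2 * (2 * M ^+ 4)) by ring.
  have [a2 b2] := pX 2%N; have [a4 b4] := pX 4%N.
  apply: ler_pM; [|apply: mulr_ge0|apply: ler_pM|apply: ler_pM];
    rewrite ?addr_ge0 ?sqr_ge0 ?exprn_ge0// ?mulr_ge0 ?addr_ge0//; lra.
apply: (le_trans (HC P B P0 B0)).
have h1 : C0 * P ^+ 8 <= C * B ^+ 2.
  apply: (@le_trans _ _ (C0 * m ^+ 8)); first by rewrite ler_wpM2l// lerXn2r ?nnegrE.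
  rewrite /C -mulrA ler_peMr ?mulr_ge0 ?exprn_ge0// mulrC ler_pdivlMr ?exprn_gt0//.
  by rewrite mul1r lerXn2r ?nnegrE// ltW.
lra.
Qed.

Lemma c2D_sqrt a b : c2 (a + b) <= (Num.sqrt (c2 a) + Num.sqrt (c2 b)) ^+ 2.
Proof.
rewrite sqrrD !sqr_sqrtr ?c2_ge0//.
have h : Rep a * Rep b + Imp a * Imp b <= Num.sqrt (c2 a) * Num.sqrt (c2 b).
  rewrite -sqrtrM ?c2_ge0//; apply: le_trans (ler_norm _) _.
  rewrite -sqrtr_sqr ler_sqrt ?mulr_ge0 ?c2_ge0// /c2.
  by have := sqr_ge0 (Rep a * Imp b - Imp a * Rep b); nra.
have -> : c2 (a + b) = c2 a + 2 * (Rep a * Rep b + Imp a * Imp b) + c2 b.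
  by rewrite /c2 ReD ImD; ring.
by rewrite mulr2n; lra.
Qed.

Lemma c2_far (d : R) : 0 < d -> exists2 C, 0 <= C &
  forall a b, c2 (a + b) ^+ 4 <= (1 + d) * c2 b ^+ 4 + C * c2 a ^+ 4.
Proof.
move=> d0; have [C C0 HC] := pow8_far d0; exists C => // a b.
have := HC _ _ (sqrtr_ge0 (c2 a)) (sqrtr_ge0 (c2 b)).
rewrite !(exprM _ 2 4) !sqr_sqrtr ?c2_ge0//; apply: le_trans.
by rewrite lerXn2r ?nnegrE ?c2_ge0 ?sqr_ge0//; exact: c2D_sqrt.
Qed.

Lemma c2_near (d e m : R) : 0 < d -> 0 < e -> 0 <= m -> exists2 C, 0 <= C &
  forall a b, c2 a <= m ^+ 2 ->
    c2 (a + b) ^+ 4 <= c2 a ^+ 4 + e + C * c2 b + (1 + d) * c2 b ^+ 4.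
Proof.
move=> d0 e0 m0; have [C C0 HC] := pow8_near d0 e0 m0; exists C => // a b am.
have am' : Num.sqrt (c2 a) <= m.
  by rewrite -(ger0_norm m0) -sqrtr_sqr ler_sqrt ?sqr_ge0.
have := HC _ _ (sqrtr_ge0 (c2 a)) am' (sqrtr_ge0 (c2 b)).
rewrite !(exprM _ 2 4) !sqr_sqrtr ?c2_ge0//; apply: le_trans.
by rewrite lerXn2r ?nnegrE ?c2_ge0 ?sqr_ge0//; exact: c2D_sqrt.
Qed.

End pointwise.

Section local_compactness.
Context (R : realType).
Local Notation mu := (@lebesgue_measure R).
Local Notation mu2 := (prodm mu mu).
Implicit Types (g h : R -> R[i]).

Definition box (m : R) (y : R * R) : bool := (`|y.1| <= m) && (`|y.2| <= m).

Lemma measurable_box m : measurable_fun setT (box m).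
Proof.
by apply: measurable_and; apply: measurable_fun_ler => //; apply: measurableT_comp.
Qed.

Lemma cpt_tail n h : cpt h -> cpt (tail n h).
Proof. by move=> [L hL]; exists L => k Lk; rewrite /tail /cut hL//; case: ifP. Qed.

Let seg (m : R) (x : R) : bool := `|x| <= m.

Let mseg m : measurable_fun setT (seg m).
Proof. by apply: measurable_fun_ler => //; exact: measurableT_comp. Qed.

Lemma measure_seg (m : R) : 0 <= m -> (mu [set x : R | seg m x] = (2 * m)%:E)%E.
Proof.
move=> m0; have -> : [set x : R | seg m x] = `[- m, m]%classic.
  by apply/seteqP; split => x /=; rewrite in_itv/= /seg ler_norml.
rewrite lebesgue_measure_itv/= lte_fin; case: ltP => [_|m1]; rewrite -?EFinB; congr EFin; lra.
Qed.

Lemma kato_box (n : nat) (m : R) g : (0 < n)%N -> 0 <= m -> csq mu g -> cpt g ->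
  (\int[mu2]_y ((box m y)%:R * c2 (evo (tail n g) y))%:E <=
    (2 * m * (2 * pi * (cnsq mu g / (3 * n%:R ^+ 2))))%:E)%E.
Proof.
move=> n0 m0 gg gc; set w := tail n g.
have wq : csq mu w := csq_tail n gg.
have wi : cint mu w := cpt_cint wq (cpt_tail n gc).
have [m1 m2] := measurable_evo wq.
have mc : measurable_fun setT (fun y => c2 (evo w y)) by exact: measurable_c2.
pose F (y : R * R) : R := (box m y)%:R * c2 (evo w y).
have mF : measurable_fun setT F.
  by apply: measurable_funM => //; apply: measurable_natb; exact: measurable_box.
have mE : measurable_fun setT (EFin \o F) by exact/measurable_EFinP.
have E0 y : (0 <= (EFin \o F) y)%E.
  by rewrite lee_fin /F mulr_ge0// c2_ge0.
have n0' : 0 < n%:R :> R by rewrite ltr0n.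
set V := 2 * pi * (cnsq mu g / (3 * n%:R ^+ 2)).
have V0 : 0 <= V.
  apply: mulr_ge0; first by apply: mulr_ge0 => //; exact: pi_ge0.
  by apply: divr_ge0; [exact: cnsq_ge0|apply: mulr_ge0 => //; exact: sqr_ge0].
have kato x : (\int[mu]_t (c2 (evo w (t, x)))%:E <= V%:E)%E.
  have mx : measurable_fun setT (fun k : R => x * k) by exact: measurable_funM.
  have m0w : modul (fun k : R => x * k) w 0 = 0.
    rewrite /modul /w /tail /cut normr0 ler0n /=.
    by apply/eqP; rewrite eq_complex /= !mulr0 subrr addr0 !eqxx.
  have := @kato_le R (modul (fun k : R => x * k) w) (@cint_modul _ _ _ mu _ _ mx wi) m0w.
  have -> : (\int[mu]_t (osc2 mu (fun k => t * k ^+ 3) (modul (fun k : R => x * k) w))%:E =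
      \int[mu]_t (c2 (evo w (t, x)))%:E)%E.
    apply: eq_integral => t _; rewrite /evo (_ : phase1 (t, x) = fun k => t * k ^+ 3 + x * k).
      by rewrite oscC_modul c2_oscC.
    by apply/funext => k; exact: addrC.
  move=> /le_trans; apply.
  have -> : V%:E = ((2 * pi)%:E * (cnsq mu g / (3 * n%:R ^+ 2))%:E)%E by rewrite -EFinM.
  apply: lee_wpmul2l.
    by rewrite lee_fin mulr_ge0// pi_ge0.
  apply: (@le_trans _ _ (\int[mu]_k ((3 * n%:R ^+ 2)^-1%:E * (c2 (w k))%:E))%E).
    have mcw : measurable_fun setT (fun k => c2 (w k)) := rint_meas (rint_c2 wq).
    apply: ge0_le_integral => //.
    - by move=> k _; rewrite lee_fin divr_ge0 ?c2_ge0// mulr_ge0// sqr_ge0.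
    - under eq_fun do rewrite c2_modul; apply/measurable_EFinP; apply: measurable_funM => //.
      apply: measurable_fun_invr; apply: measurable_funM => //; exact: measurable_funX.
    - by apply: emeasurable_funM => //; exact/measurable_EFinP.
    move=> k _; rewrite c2_modul -EFinM lee_fin mulrC.
    rewrite /w /tail c2_cut; case: ifPn => [nk|_]; last by rewrite !mulr0.
    apply: ler_wpM2r; first exact: c2_ge0.
    have nk' : n%:R <= `|k| by rewrite ltW// ltNge.
    have n2 : n%:R ^+ 2 <= k ^+ 2.
      by rewrite -(real_normK (num_real k)) lerXn2r ?nnegrE// ltW.
    have n20 : 0 < n%:R ^+ 2 :> R by rewrite exprn_gt0.
    have k20 : 0 < k ^+ 2 by exact: lt_le_trans n20 n2.
    have n23 : 0 < 3 * n%:R ^+ 2 :> R by rewrite mulr_gt0.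
    have k23 : 0 < 3 * k ^+ 2 by rewrite mulr_gt0.
    by rewrite (lef_pV2 k23 n23) ler_pM2l.
  rewrite ge0_integralZl//; last 2 first.
  - by apply/measurable_EFinP; exact: rint_meas (rint_c2 wq).
  - by move=> k _; rewrite lee_fin c2_ge0.
  rewrite (cnsqE wq) -EFinM lee_fin mulrC ler_wpM2r//.
  exact: (@cnsq_cut_le _ _ _ mu _ _ (measurable_neg (measurable_norm_le n)) gg).
rewrite [in leLHS]/prodm (@fubini_tonelli2 _ _ _ _ _ mu mu _ mE E0).
apply: (@le_trans _ _ (\int[mu]_x (V%:E * (seg m x)%:R%:E))%E); last first.
  rewrite ge0_integralZl//; last first.
    by apply/measurable_EFinP; exact: (@measurable_natb _ (measurableTypeR R) R _ (mseg m)).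
  by rewrite lebesgue_integral_pred// measure_seg// -EFinM mulrC.
apply: ge0_le_integral => //.
- by move=> x _; apply: integral_ge0 => z _; exact: E0.
- exact: (@measurable_fun_fubini_tonelli_G _ _ _ _ _ mu _ mE E0).
- by apply: emeasurable_funM => //; apply/measurable_EFinP; exact: (@measurable_natb _ (measurableTypeR R) R _ (mseg m)).
move=> x _; rewrite /fubini_G /=.
have mcx : measurable_fun setT (fun t : R => (c2 (evo w (t, x)))%:E).
  by apply/measurable_EFinP; exact: (measurableT_comp mc (pair2_measurable x)).
apply: (@le_trans _ _ (\int[mu]_t ((seg m x)%:R%:E * (c2 (evo w (t, x)))%:E))%E).
  apply: ge0_le_integral => //.
  - by move=> t _; exact: E0.
  - by apply/measurable_EFinP; exact: (measurableT_comp mF (pair2_measurable x)).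
  - by apply: emeasurable_funM.
  move=> t _; rewrite -EFinM lee_fin /F /box /= -/(seg m x).
  by case: (`|t| <= m) => //=; rewrite mul0r mulr_ge0// c2_ge0.
rewrite ge0_integralZl//; last first.
  by move=> t _; rewrite lee_fin c2_ge0.
by rewrite muleC; apply: lee_wpmul2r; rewrite ?lee_fin.
Qed.

Lemma osc_cip (P : R -> bool) (th : R -> R) (V : R) : measurable_fun setT P ->
  (mu [set k | P k] <= V%:E)%E -> measurable_fun setT th ->
  exists p q : R -> R[i], [/\ csq mu p, csq mu q &
    forall g, csq mu g -> oscR mu th (cut P g) = cip mu g p /\ oscI mu th (cut P g) = cip mu g q].
Proof.
move=> mP mV mth.
have mc : measurable_fun setT (fun k => cos (th k)).
  by apply: measurableT_comp => //; exact: measurable_cosr.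
have ms : measurable_fun setT (fun k => sin (th k)).
  by apply: measurableT_comp => //; exact: measurable_sinr.
have test (u v : R -> R) : measurable_fun setT u -> measurable_fun setT v ->
    (forall k, u k ^+ 2 + v k ^+ 2 = 1) -> csq mu (cut P (fun k => Complex (u k) (v k))).
  move=> mu' mv uv; have [m1 m2] := @measurable_cut _ _ R P (fun k => Complex (u k) (v k)) mP mu' mv.
  apply: csqP => //; apply: (@le_lt_trans _ _ (\int[mu]_k ((P k)%:R)%:E)%E).
    apply: ge0_le_integral => //.
    - by move=> k _; rewrite lee_fin c2_ge0.
    - by apply/measurable_EFinP; apply: measurable_funD; apply: measurable_funX.
    - by apply/measurable_EFinP; exact: measurable_natb.
    - by move=> k _; rewrite lee_fin c2_cut /c2/= uv; case: (P k).
  by rewrite lebesgue_integral_pred// (le_lt_trans mV)// ltry.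
exists (cut P (fun k => Complex (cos (th k)) (- sin (th k)))), (cut P (fun k => Complex (sin (th k)) (cos (th k)))).
have cp := test _ _ mc (measurable_funN ms) (fun k => etrans (congr1 (fun x => cos (th k) ^+ 2 + x) (sqrrN _)) (cos2Dsin2 _)).
have cq := test _ _ ms mc (fun k => etrans (addrC _ _) (cos2Dsin2 _)).
split=> // g [g1 g2]; rewrite /cip /ip.
have [p1 p2] := cp; have [q1 q2] := cq.
rewrite -!RintD; [|exact: sqint_mul|exact: sqint_mul|exact: sqint_mul|exact: sqint_mul].
by split; apply: eq_Rint => k; rewrite /cut; case: (P k) => /=; ring.
Qed.

Lemma integral_box (m : R) : 0 <= m -> (\int[mu2]_y ((box m y)%:R)%:E = ((2 * m) ^+ 2)%:E)%E.
Proof.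
move=> m0; have ms : measurable_fun setT (fun x : R => (seg m x)%:R : R) by exact: measurable_natb.
have es : (\int[mu]_x ((seg m x)%:R)%:E = (2 * m)%:E)%E by rewrite lebesgue_integral_pred// measure_seg.
have rs : rint mu (fun x : R => (seg m x)%:R).
  by apply: rint_ge0 => //; rewrite es ltry.
have e : \int[mu]_x (seg m x)%:R = 2 * m by apply: EFin_inj; rewrite -rint_EFin.
have <- : \int[mu]_x (seg m x)%:R * \int[mu]_x (seg m x)%:R = (2 * m) ^+ 2 by rewrite e expr2.
rewrite -(Rint_prodM rs rs) -(rint_EFin (rint_prod rs rs)).
apply: eq_integral => y _; rewrite /box -/(seg m y.1) -/(seg m y.2).
by case: (seg m y.1); case: (seg m y.2); rewrite /= ?mul1r ?mul0r.
Qed.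

Section weak_sequence.
Variables (U : set_system nat) (h_ : nat -> R -> R[i]) (h : R -> R[i]).
Hypothesis UU : UltraFilter U.
Hypothesis hq : forall n, csq mu (h_ n).
Hypothesis hc : forall n, cpt (h_ n).
Hypothesis h1 : forall n, cnsq mu (h_ n) = 1.
Hypothesis hh : csq mu h.
Hypothesis hw : forall g, csq mu g -> (fun n => cip mu (h_ n) g) @ U --> cip mu h g.

Let r n k := h_ n k - h k.

Let rq n : csq mu (r n). Proof. exact: csqB. Qed.

Lemma cnsq_weak_le : cnsq mu h <= 1.
Proof.
have c2' : (fun n => cip mu (h_ n) h ^+ 2) @ U --> cnsq mu h ^+ 2.
  by apply: cvg_exprn; rewrite -cip_self; exact: hw.
have : cnsq mu h ^+ 2 <= cnsq mu h.
  rewrite leNgt; apply/negP => lt1.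
  have /cvgrPdist_lt/(_ (cnsq mu h ^+ 2 - cnsq mu h)) := c2'.
  rewrite subr_gt0 => /(_ lt1) /filter_ex[n].
  have := cip_sqr_le (hq n) hh; rewrite h1 mul1r => le2.
  by rewrite ltr_norml => /andP[_]; rewrite ltrD2l ltrN2 ltNge le2.
have := cnsq_ge0 mu h; move: (cnsq mu h) => a a0 aa.
rewrite leNgt; apply/negP => a1; nra.
Qed.

Lemma cnsq_diff_cvg : (fun n => cnsq mu (r n)) @ U --> 1 - cnsq mu h.
Proof.
have -> : 1 - cnsq mu h = 1 - 2 * cip mu h h + cnsq mu h by rewrite cip_self; ring.
rewrite (_ : (fun n => _) = fun n => 1 - 2 * cip mu (h_ n) h + cnsq mu h).
  apply: cvgD; last exact: cvg_cst.
  apply: cvgB; first exact: cvg_cst.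
  by apply: cvgM; [exact: cvg_cst|exact: hw].
by apply/funext => n; rewrite cnsqB// h1.
Qed.

Lemma cnsq_diff_le n : cnsq mu (r n) <= 4.
Proof. by have := cnsqB_le (hq n) hh; rewrite h1; have := cnsq_weak_le; rewrite /r; lra. Qed.

Lemma osc2_weak_cvg (P : R -> bool) (th : R -> R) (V : R) : measurable_fun setT P ->
  (mu [set k | P k] <= V%:E)%E -> measurable_fun setT th ->
  (fun n => osc2 mu th (cut P (h_ n))) @ U --> osc2 mu th (cut P h) /\
  (fun n => osc2 mu th (cut P (r n))) @ U --> (0 : R).
Proof.
move=> mP mV mth; have [p [q [cp cq pq]]] := osc_cip mP mV mth.
have e g : csq mu g -> osc2 mu th (cut P g) = cip mu g p ^+ 2 + cip mu g q ^+ 2.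
  by move=> gg; rewrite /osc2 (pq g gg).1 (pq g gg).2.
split.
- under [X in X @ _ --> _]eq_fun do rewrite e//.
  by rewrite e//; apply: cvgD; apply: cvg_exprn; exact: hw.
- under [X in X @ _ --> _]eq_fun do rewrite e//.
  have z f : csq mu f -> (fun n => cip mu (r n) f) @ U --> (0 : R).
    move=> cf; rewrite (_ : (fun n => _) = fun n => cip mu (h_ n) f - cip mu h f).
      by rewrite -[X in _ --> X](subrr (cip mu h f)); apply: cvgB; [exact: hw|exact: cvg_cst].
    apply/funext => n; have := cipDr cf (rq n) hh.
    rewrite (_ : (fun k => r n k + h k) = h_ n); last by apply/funext => k; rewrite /r subrK.
    have c1 : cip mu f (h_ n) = cip mu (h_ n) f by exact: cipC.
    have c3 : cip mu f (r n) = cip mu (r n) f by exact: cipC.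
    have c4 : cip mu f h = cip mu h f by exact: cipC.
    by rewrite c1 c3 c4 => ->; rewrite addrK.
  have -> : 0 = (0 : R) ^+ 2 + 0 ^+ 2 by rewrite expr0n addr0.
  by apply: cvgD; apply: cvg_exprn; exact: z.
Qed.

Lemma low_box (L : nat) (m e : R) : 0 < e ->
  \forall n \near U, forall y, box m y -> c2 (evo (trunc L (r n)) y) <= e.
Proof.
move=> e0.
have cb : compact [set y : R * R | box m y].
  rewrite (_ : [set y : R * R | box m y] = `[- m, m]%classic `*` `[- m, m]%classic).
    by apply: compact_setX; exact: segment_compact.
  by apply/seteqP; split => -[t x] /=; rewrite /box /= !in_itv/= !ler_norml => /andP.
pose V : R := 2 * L%:R.
have mV : (mu [set k : R | (`|k| <= L%:R)%R] <= V%:E)%E by rewrite (measure_seg (ler0n _ _)).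
have := (compact_near_coveringP _).1 cb nat U (fun n y => c2 (evo (trunc L (r n)) y) <= e) _.
move=> H; apply: H => y0 _ /=.
have [_ z0] := osc2_weak_cvg (measurable_norm_le L) mV (measurable_phase1r y0).
pose D : R := 2 * (4 * V * 4).
pose del (y : R * R) : R := `|y.2 - y0.2| * L%:R + `|y.1 - y0.1| * L%:R ^+ 3.
have delc : (fun y => D * del y ^+ 2) @ y0 --> (0 : R).
  have -> : 0 = D * (`|y0.2 - y0.2| * L%:R + `|y0.1 - y0.1| * L%:R ^+ 3) ^+ 2.
    by rewrite !subrr normr0 !mul0r addr0 expr0n mulr0.
  apply: cvgM; first exact: cvg_cst.
  apply: cvg_exprn; apply: cvgD; apply: cvgM; try exact: cvg_cst.
    by apply: cvg_norm; apply: cvgB; [exact: cvg_snd|exact: cvg_cst].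
  by apply: cvg_norm; apply: cvgB; [exact: cvg_fst|exact: cvg_cst].
have e2 : 0 < e / 2 by rewrite divr_gt0.
have e4 : 0 < e / 4 by rewrite divr_gt0.
exists ([set y : R * R | D * del y ^+ 2 <= e / 2], [set n | osc2 mu (phase1 y0) (trunc L (r n)) <= e / 4]).
  split.
  - have /cvgrPdist_le/(_ _ e2) := delc; apply: filterS => y /=.
    by rewrite sub0r normrN; exact: le_trans (ler_norm _).
  - have /cvgrPdist_le/(_ _ e4) := z0; apply: filterS => n /=.
    by rewrite sub0r normrN; exact: le_trans (ler_norm _).
move=> [y n] /= [dy Gn].
have -> : evo (trunc L (r n)) y = (evo (trunc L (r n)) y - evo (trunc L (r n)) y0) + evo (trunc L (r n)) y0.
  by rewrite subrK.
apply: (le_trans (c2D_le _ _)).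
have phb k : `|k| <= L%:R -> `|phase1 y k - phase1 y0 k| <= del y.
  move=> kL; have -> : phase1 y k - phase1 y0 k = (y.2 - y0.2) * k + (y.1 - y0.1) * k ^+ 3.
    by rewrite /phase1; ring.
  apply: (le_trans (ler_normD _ _)); rewrite normrM (normrM _ (k ^+ 3)) (normrX 3 k); apply: lerD; apply: ler_wpM2l => //.
  by rewrite lerXn2r ?nnegrE.
have := @osc2B_cut_le _ _ _ mu _ _ _ _ _ _ (measurable_norm_le L) mV (rq n) (cint_trunc L (rq n))
  (measurable_phase1r y) (measurable_phase1r y0) phb.
rewrite -/(evo _ y) -/(evo _ y0) -/(trunc L (r n)) => b1.
have b2 : 4 * del y ^+ 2 * V * cnsq mu (r n) <= 4 * del y ^+ 2 * V * 4.
  apply: ler_wpM2l; last exact: cnsq_diff_le.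
  have V0 : 0 <= V by rewrite /V mulr_ge0.
  by apply: mulr_ge0 V0; apply: mulr_ge0 (sqr_ge0 _).
have b3 : 2 * (4 * del y ^+ 2 * V * 4) = D * del y ^+ 2 by rewrite /D; ring.
have b4 : c2 (evo (trunc L (r n)) y0) <= e / 4 by [].
by have b5 := le_trans b1 b2; lra.
Qed.

Variable n_ : nat -> nat.
Hypothesis hN : forall j, (j <= n_ j)%N /\ cnsq mu (tail (n_ j) h) <= 16^-1 ^+ j / 16.

Local Notation u := (ext h n_).

Let mc n : measurable_fun setT (fun y => c2 (evo (h_ n) y - u y)).
Proof.
have [m1 m2] := measurable_ext n_ hh; have [g1 g2] := measurable_evo (hq n).
exact: measurable_c2B g1 g2 m1 m2.
Qed.

Lemma loc_small (m e : R) : 0 <= m -> 0 < e -> \forall n \near U,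
  (\int[mu2]_y ((box m y)%:R * c2 (evo (h_ n) y - u y))%:E <= e%:E)%E.
Proof.
move=> m0 e0.
have m00 : 0 <= (2 * m) ^+ 2 by exact: sqr_ge0.
pose e1 := e / (4 * ((2 * m) ^+ 2 + 1)).
have d0 : 0 < 4 * ((2 * m) ^+ 2 + 1) by lra.
have e10 : 0 < e1 by rewrite divr_gt0.
have e1m : 2 * e1 * (2 * m) ^+ 2 <= e / 2.
  have : e1 * (4 * ((2 * m) ^+ 2 + 1)) = e by rewrite /e1 divfK// gt_eqF.
  by move: m00; set q := (2 * m) ^+ 2 => q0; lra.
pose W : R := 2 * (2 * m * (2 * pi * (4 / 3))).
have W0 : 0 <= W.
  by rewrite /W; do 2!apply: mulr_ge0 => //; apply: mulr_ge0 => //; apply: mulr_ge0 => //; exact: pi_ge0.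
pose L := (Num.truncn (2 * W / e)).+1.
have L0 : 0 < L%:R :> R by rewrite ltr0n.
have LW : W / L%:R ^+ 2 <= e / 2.
  rewrite ler_pdivrMr ?exprn_gt0//.
  have l1 : 2 * W / e <= L%:R by apply: ltW; exact: truncnS_gt.
  have l2 : L%:R <= L%:R ^+ 2 :> R by rewrite expr2 ler_peMr ?ler1n// ltW.
  have l3 : 2 * W <= L%:R ^+ 2 * e by rewrite -ler_pdivrMr//; exact: le_trans l2.
  by rewrite mulrC; lra.
apply: filterS (low_box L m e10) => n low.
have mb : measurable_fun setT (fun y : R * R => (box m y)%:R : R) by apply: measurable_natb; exact: measurable_box.
pose gj j k := h_ n k - trunc (n_ (j + L)%N) h k.
have gq j : csq mu (gj j) by apply: csqB => //; exact: csq_trunc.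
have gc j : cpt (gj j) by apply: cptB => //; exact: cpt_trunc.
have gn j : cnsq mu (gj j) <= 4.
  have := cnsqB_le (hq n) (csq_trunc (n_ (j + L)%N) hh); rewrite h1.
  have := @cnsq_cut_le _ _ _ mu _ _ (measurable_norm_le (n_ (j + L)%N)) hh.
  by have := cnsq_weak_le; rewrite /gj /trunc; lra.
have mev g : csq mu g -> measurable_fun setT (fun y => c2 (evo g y)).
  by move=> gg; have [m1 m2] := measurable_evo gg; exact: measurable_c2.
have ev j y : evo (gj j) y = evo (h_ n) y - evo (trunc (n_ (j + L)%N) h) y.
  by apply: evoB; [exact: cpt_cint|exact: cint_trunc].
apply: (@fatou_le _ _ _ mu2 (fun j y => (box m y)%:R * c2 (evo (gj j) y))).
- by move=> j; apply: measurable_funM => //; exact: mev.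
- by apply: measurable_funM => //; exact: mc.
- by move=> j y; rewrite mulr_ge0// c2_ge0.
- by move=> y; rewrite mulr_ge0// c2_ge0.
- apply: filterS (ext_ae hh hN); first exact: (ae_filter_ringOfSetsType mu2).
  move=> y [yr yi]; apply: cvgM; first exact: cvg_cst.
  under [X in X @ _ --> _]eq_fun do rewrite ev /c2 ReB ImB.
  have sh (v : nat -> R) (l : R) : v @ \oo --> l -> (fun j => v (j + L)%N) @ \oo --> l by rewrite (@cvg_shiftn L _ v).
  rewrite /c2 ReB ImB; apply: cvgD; apply: cvg_exprn; apply: cvgB; try exact: cvg_cst.
    exact: (sh (fun j => Rep (evo (trunc (n_ j) h) y)) _ yr).
  exact: (sh (fun j => Imp (evo (trunc (n_ j) h) y)) _ yi).
move=> j.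
have tl : trunc L (gj j) = trunc L (r n).
  apply/funext => k; rewrite /trunc /gj /r /cut; case: ifP => // kL.
  rewrite /trunc /cut (_ : `|k| <= (n_ (j + L)%N)%:R)//.
  by apply: le_trans kL _; rewrite ler_nat (leq_trans _ (hN (j + L)%N).1)// leq_addl.
have pw y : (box m y)%:R * c2 (evo (gj j) y) <=
    2 * e1 * (box m y)%:R + 2 * ((box m y)%:R * c2 (evo (tail L (gj j)) y)).
  have -> : evo (gj j) y = evo (trunc L (r n)) y + evo (tail L (gj j)) y.
    have -> : tail L (gj j) = fun k => gj j k - trunc L (gj j) k.
      by apply/funext => k; rewrite {2}(trunc_tail L (gj j)) addrAC subrr add0r.
    rewrite evoB; [|exact: cpt_cint|exact: cint_trunc].
    by rewrite tl addrC subrK.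
  have := c2D_le (evo (trunc L (r n)) y) (evo (tail L (gj j)) y).
  case: (boolP (box m y)) => [/low|_]; last by rewrite !mul0r !mulr0 addr0.
  by rewrite !mul1r mulr1; lra.
have mt : measurable_fun setT (fun y => (box m y)%:R * c2 (evo (tail L (gj j)) y)).
  by apply: measurable_funM => //; apply: mev; exact: csq_tail.
apply: (@le_trans _ _ (\int[mu2]_y ((2 * e1)%:E * ((box m y)%:R)%:E +
    2%:E * ((box m y)%:R * c2 (evo (tail L (gj j)) y))%:E))%E).
  apply: ge0_le_integral => //.
  - by move=> y _; rewrite lee_fin mulr_ge0// c2_ge0.
  - by apply/measurable_EFinP; apply: measurable_funM => //; exact: mev.
  - by apply: emeasurable_funD; apply: emeasurable_funM => //; exact/measurable_EFinP.
  - by move=> y _; rewrite -!EFinM -EFinD lee_fin.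
rewrite ge0_integralD//; last 4 first.
- by move=> y _; rewrite mule_ge0// lee_fin// mulr_ge0// ltW.
- by apply: emeasurable_funM => //; exact/measurable_EFinP.
- by move=> y _; rewrite mule_ge0// lee_fin mulr_ge0// c2_ge0.
- by apply: emeasurable_funM => //; exact/measurable_EFinP.
rewrite ge0_integralZl//; last 2 first.
- exact/measurable_EFinP.
- by rewrite lee_fin mulr_ge0// ltW.
rewrite ge0_integralZl//; last 2 first.
- exact/measurable_EFinP.
- by move=> y _; rewrite lee_fin mulr_ge0// c2_ge0.
rewrite integral_box//.
have kb := @kato_box L m (gj j) isT m0 (gq j) (gc j).
apply: (@le_trans _ _ ((2 * e1 * (2 * m) ^+ 2)%:E + (2 * (2 * m * (2 * pi * (cnsq mu (gj j) / (3 * L%:R ^+ 2)))))%:E)%E).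
  apply: leeD; first by rewrite EFinM.
  by rewrite [leRHS]EFinM; apply: lee_wpmul2l.
rewrite -EFinD lee_fin.
have hW : 2 * (2 * m * (2 * pi * (cnsq mu (gj j) / (3 * L%:R ^+ 2)))) <= W / L%:R ^+ 2.
  have -> : W / L%:R ^+ 2 = 2 * (2 * m * (2 * pi * (4 / (3 * L%:R ^+ 2)))).
    by rewrite /W; field; rewrite gt_eqF.
  apply: ler_wpM2l => //; apply: ler_wpM2l; first by rewrite mulr_ge0.
  apply: ler_wpM2l; first by rewrite mulr_ge0// pi_ge0.
  by apply: ler_wpM2r => //; rewrite invr_ge0 mulr_ge0// sqr_ge0.
lra.
Qed.

Let ev0 y : evo (fun=> 0 : R[i]) y = 0.
Proof.
rewrite /evo /oscC /oscR /oscI; apply/eqP; rewrite eq_complex /=; apply/andP; split; apply/eqP.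
  rewrite (@eq_Rint _ _ _ mu _ (fun=> 0)); first by rewrite Rintegral_cst// mul0r.
  by move=> k; rewrite !mulr0 subrr.
rewrite (@eq_Rint _ _ _ mu _ (fun=> 0)); first by rewrite Rintegral_cst// mul0r.
by move=> k; rewrite !mulr0 addr0.
Qed.

Lemma ext8 : rint mu2 (fun y => c2 (u y) ^+ 4) /\
  \int[mu2]_y (c2 (u y) ^+ 4) <= a8 R * cnsq mu h ^+ 4.
Proof.
have c0 : csq mu (fun=> 0 : R[i]) by split; exact: sqint0.
have p0 : cpt (fun=> 0 : R[i]) by exists 0.
have := ext_B_le hh hN c0 p0.
have -> : (\int[mu2]_y (c2 (evo (fun=> 0) y - u y) ^+ 4)%:E = \int[mu2]_y (c2 (u y) ^+ 4)%:E)%E.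
  by apply: eq_integral => y _; rewrite ev0 sub0r c2N.
have -> : cnsq mu (fun k => 0 - h k) = cnsq mu h.
  apply: EFin_inj; rewrite -(cnsqE hh) -(cnsqE (csqB c0 hh)).
  by apply: eq_integral => k _; rewrite sub0r c2N.
move=> le1; have [m1 m2] := measurable_ext n_ hh.
have ri : rint mu2 (fun y => c2 (u y) ^+ 4).
  apply: rint_ge0.
  - by apply: measurable_funX; exact: measurable_c2 m1 m2.
  - by move=> y; rewrite exprn_ge0// c2_ge0.
  - by apply: le_lt_trans le1 _; exact: ltry.
by split=> //; rewrite -lee_fin -rint_EFin.
Qed.

Lemma Rint_exhaust d (Y : measurableType d) (p : {measure set Y -> \bar R}) (f : Y -> R) (Q : nat -> Y -> bool) :
  rint p f -> (forall y, 0 <= f y) -> (forall M, measurable_fun setT (Q M)) ->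
  (forall y, \forall M \near \oo, Q M y) ->
  (fun M => \int[p]_y ((~~ Q M y)%:R * f y)) @ \oo --> (0 : R).
Proof.
move=> fi f0 mQ Qy.
have mq M : measurable_fun setT (fun y => (~~ Q M y)%:R : R).
  by apply: measurable_natb; exact: measurable_neg.
have [] := @dominated_convergence _ Y R p setT measurableT
  (fun M y => ((~~ Q M y)%:R * f y)%:E) (cst 0%E) (fun y => (f y)%:E).
- by move=> M; apply/measurable_EFinP; apply: measurable_funM => //; exact: rint_meas fi.
- exact: measurable_cst.
- by apply: aeW => y _; apply: cvg_near_cst; apply: filterS (Qy y) => M -> /=; rewrite mul0r.
- exact: fi.
- apply: aeW => y M _; rewrite gee0_abs ?lee_fin ?mulr_ge0//.
  by case: (Q M y); rewrite /= ?mul0r ?mul1r.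
move=> _ _; rewrite integral0 => H; exact: (fine_cvg H).
Qed.

Lemma le_addl3 (x a b c y z : R) : 0 <= a -> 0 <= b -> 0 <= c -> x <= y + z ->
  x <= a + b + c + y + z.
Proof. lra. Qed.

Lemma mul_le_quarter (e C x : R) : 0 < e -> 0 <= C -> x <= e / (4 * (C + 1)) -> C * x <= e / 4.
Proof.
move=> e0 C0 xe; apply: (le_trans (ler_wpM2l C0 xe)).
rewrite mulrA ler_pdivrMr; last by rewrite mulr_gt0// ltr_wpDl.
by have := mulr_ge0 C0 (ltW e0); lra.
Qed.

Lemma quarters_le (L I A V d t1 t2 t3 e : R) : L <= I + t1 + t2 + (1 + d) * V + t3 ->
  V <= A -> d * V <= e / 4 -> t1 <= e / 4 -> t2 <= e / 4 -> t3 <= e / 4 -> L <= I + A + e.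
Proof. lra. Qed.

Lemma brezis_lieb (e : R) : 0 < e -> \forall n \near U,
  l8 (h_ n) <= \int[mu2]_y (c2 (u y) ^+ 4) + a8 R * cnsq mu (r n) ^+ 4 + e.
Proof.
move=> e0; have A0 := a8_ge0 R; have [iu _] := ext8.
pose d := e / (4 * (256 * a8 R + 1)).
have q0 : 0 < 4 * (256 * a8 R + 1) by lra.
have d0 : 0 < d by rewrite divr_gt0.
have dA : d * (a8 R * 256) <= e / 4.
  have : d * (4 * (256 * a8 R + 1)) = e by rewrite /d (divfK (lt0r_neq0 q0)).
  lra.
have [C1 C10 H1] := c2_far d0.
pose Q (M : nat) (y : R * R) : bool := box M%:R y && (c2 (u y) <= M%:R ^+ 2).
have [m1 m2] := measurable_ext n_ hh.
have mcu : measurable_fun setT (fun y => c2 (u y)) := measurable_c2 m1 m2.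
have mQ M : measurable_fun setT (Q M).
  by apply: measurable_and; [exact: measurable_box|exact: measurable_fun_ler].
have mNQ M : measurable_fun setT (fun y : R * R => (~~ Q M y)%:R : R).
  by apply: measurable_natb; exact: measurable_neg.
have Qy y : \forall M \near \oo, Q M y.
  pose N := maxn (Num.truncn `|y.1|).+1 (maxn (Num.truncn `|y.2|).+1 (Num.truncn (c2 (u y))).+1).
  exists N => // M /= NM; have t1 := truncnS_gt `|y.1|; have t2 := truncnS_gt `|y.2|.
  have t3 := truncnS_gt (c2 (u y)).
  have nM (k : nat) : (k <= N)%N -> k%:R <= M%:R :> R by move=> kN; rewrite ler_nat (leq_trans kN).
  have a1 := nM (Num.truncn `|y.1|).+1 (leq_maxl _ _).
  have a2 := nM (Num.truncn `|y.2|).+1 (leq_trans (leq_maxl _ _) (leq_maxr _ _)).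
  have a3 := nM (Num.truncn (c2 (u y))).+1 (leq_trans (leq_maxr _ _) (leq_maxr _ _)).
  have M1 : 1 <= M%:R :> R by apply: le_trans a1; rewrite ler1n.
  apply/andP; split; [apply/andP; split; apply: ltW; [exact: lt_le_trans t1 a1|exact: lt_le_trans t2 a2]|].
  apply: (ltW (lt_le_trans t3 (le_trans a3 _))).
  by rewrite expr2 ler_peMr// ler0n.
have c80 y : 0 <= c2 (u y) ^+ 4 by rewrite exprn_ge0// c2_ge0.
have /cvgrPdist_le Ex := Rint_exhaust iu c80 mQ Qy.
have e1 : 0 < e / (4 * (C1 + 1)) by rewrite divr_gt0// mulr_gt0// ltr_wpDl.
have [M _ /(_ M (leqnn M))] := Ex _ e1.
rewrite sub0r normrN => /(le_trans (ler_norm _)) ExM.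
have M0 : 0 <= M%:R :> R by [].
have mm0 : 0 <= (2 * M%:R) ^+ 2 :> R by exact: sqr_ge0.
pose eta := e / (4 * ((2 * M%:R) ^+ 2 + 1)).
have q1 : 0 < 4 * ((2 * M%:R) ^+ 2 + 1) :> R by lra.
have eta0 : 0 < eta by rewrite divr_gt0.
have etaM : eta * (2 * M%:R) ^+ 2 <= e / 4.
  have : eta * (4 * ((2 * M%:R) ^+ 2 + 1)) = e by rewrite /eta (divfK (lt0r_neq0 q1)).
  lra.
have [C2 C20 H2] := c2_near d0 eta0 M0.
have e2 : 0 < e / (4 * (C2 + 1)) by rewrite divr_gt0// mulr_gt0// ltr_wpDl.
apply: filterS (loc_small M0 e2) => n sm.
pose v y := evo (h_ n) y - u y.
have rb : rint mu2 (fun y => (box M%:R y)%:R).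
  apply: rint_ge0 => //; last by rewrite integral_box// ltry.
  by apply: measurable_natb; exact: measurable_box.
have rbv : rint mu2 (fun y => (box M%:R y)%:R * c2 (v y)).
  apply: rint_ge0.
  - by apply: measurable_funM; [exact: rint_meas rb|exact: mc].
  - by move=> y; rewrite mulr_ge0// c2_ge0.
  - by apply: le_lt_trans sm _; exact: ltry.
have bv : \int[mu2]_y ((box M%:R y)%:R * c2 (v y)) <= e / (4 * (C2 + 1)).
  by rewrite -lee_fin -rint_EFin.
have vle := ext_B_le hh hN (hq n) (hc n).
have rv : rint mu2 (fun y => c2 (v y) ^+ 4).
  apply: rint_ge0.
  - by apply: measurable_funX; exact: mc.
  - by move=> y; rewrite exprn_ge0// c2_ge0.
  - by apply: le_lt_trans vle _; exact: ltry.
have vle' : \int[mu2]_y (c2 (v y) ^+ 4) <= a8 R * cnsq mu (r n) ^+ 4.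
  by rewrite -lee_fin -rint_EFin.
have rq' : rint mu2 (fun y => (~~ Q M y)%:R * c2 (u y) ^+ 4).
  apply: (@rint_le _ _ _ mu2 _ _ _ iu).
    by apply: measurable_funM; [exact: mNQ|exact: rint_meas iu].
  move=> y; have := c80 y; move: (c2 (u y) ^+ 4) => z z0.
  by case: (Q M y); rewrite /= ?mul0r ?mul1r ?normr0 ?ger0_norm.
have pw y : c2 (evo (h_ n) y) ^+ 4 <=
   c2 (u y) ^+ 4 + eta * (box M%:R y)%:R + C2 * ((box M%:R y)%:R * c2 (v y)) +
   (1 + d) * c2 (v y) ^+ 4 + C1 * ((~~ Q M y)%:R * c2 (u y) ^+ 4).
  have -> : evo (h_ n) y = u y + v y by rewrite /v addrC subrK.
  have c2v := c2_ge0 (v y); have c2v4 : 0 <= c2 (v y) ^+ 4 by rewrite exprn_ge0.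
  have b0 : 0 <= (box M%:R y)%:R :> R by [].
  have := H1 (u y) (v y); have := H2 (u y) (v y).
  have eb : 0 <= eta * (box M%:R y)%:R by rewrite mulr_ge0// ltW.
  have cb : 0 <= C2 * ((box M%:R y)%:R * c2 (v y)) by rewrite mulr_ge0// mulr_ge0.
  have := c80 y; case: (boolP (Q M y)) => [/andP[-> uM] _ /(_ uM) nr _|_ cu _ fr] /=.
    by rewrite !mul1r mulr1 mul0r mulr0 addr0.
  by rewrite mul1r; exact: le_addl3 cu eb cb fr.
have int1 := rintD iu (rintZ eta rb).
have int2 := rintD int1 (rintZ C2 rbv).
have int3 := rintD int2 (rintZ (1 + d) rv).
have int4 := rintD int3 (rintZ C1 rq').
have := Rint_le (rint_evo8 (hq n) (hc n)) int4 pw.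
rewrite (RintD int3 (rintZ C1 rq')) (RintD int2 (rintZ (1 + d) rv)) (RintD int1 (rintZ C2 rbv)).
rewrite (RintD iu (rintZ eta rb)) !RintZ//.
have -> : \int[mu2]_y (box M%:R y)%:R = (2 * M%:R) ^+ 2.
  by apply: EFin_inj; rewrite -rint_EFin// integral_box.
rewrite -/(l8 (h_ n)) => big.
have r4 : cnsq mu (r n) ^+ 4 <= 256.
  have -> : 256 = 4 ^+ 4 :> R by rewrite -natrX.
  by rewrite lerXn2r ?nnegrE ?cnsq_ge0//; exact: cnsq_diff_le.
have dV : d * \int[mu2]_y (c2 (v y) ^+ 4) <= e / 4.
  apply: le_trans dA; apply: ler_wpM2l; first exact: ltW.
  by apply: (le_trans vle'); exact: ler_wpM2l.
exact: quarters_le big vle' dV etaM (mul_le_quarter e0 C20 bv) (mul_le_quarter e0 C10 ExM).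
Qed.

End weak_sequence.

End local_compactness.

(** * Existence of an extremiser *)

Section existence.
Context (R : realType).
Local Notation mu := (@lebesgue_measure R).
Local Notation mu2 := (prodm mu mu).
Implicit Types (g h : R -> R[i]).

Lemma quartic_split (a : R) : 0 < a -> a <= 1 -> 1 <= a ^+ 4 + (1 - a) ^+ 4 -> a = 1.
Proof.
move=> a0 a1 h; apply/eqP; rewrite eq_le a1/= leNgt; apply/negP => lt1.
set b := 1 - a in h; have b0 : 0 < b by rewrite subr_gt0.
have ab : a + b = 1 by rewrite /b; ring.
have e : 1 - (a ^+ 4 + b ^+ 4) = a * b * (4 * a ^+ 2 + 6 * (a * b) + 4 * b ^+ 2).
  have b4 : b ^+ 4 = (1 - a) ^+ 4 by [].
  by rewrite /b; ring.
have : 0 < a * b * (4 * a ^+ 2 + 6 * (a * b) + 4 * b ^+ 2).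
  by rewrite mulr_gt0 ?mulr_gt0// !addr_gt0// ?mulr_gt0 ?exprn_gt0// mulr_gt0.
by rewrite -e; lra.
Qed.

Lemma quarter_const (a : R) :
  1024 * (8 / 3 * pi ^+ 2) * 64 * (a / strichartz_const R) * 1 ^+ 3 = a / 4.
Proof.
have : strichartz_const R != 0 by exact: lt0r_neq0 (strichartz_const_gt0 R).
rewrite /strichartz_const mulf_eq0 negb_or => /andP[_].
by move: (1024 * _ * 64) => c c0; rewrite expr1n; field.
Qed.

Lemma three_eps (x1 x2 x3 x4 x5 x6 e : R) : x1 - x6 <= x2 -> x2 <= x3 + x5 + e / 3 ->
  - (e / 3) <= x4 - x5 -> x6 <= e / 3 -> x1 <= x3 + x4 + e.
Proof. lra. Qed.

(* A dilation and a translation bring the frequency concentration given by the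
   refined Strichartz inequality to the unit frequency interval. *)
Lemma concentrated_maximizer (e : R) : 0 < a8 R -> 0 < e -> exists h,
  [/\ csq mu h, cpt h, cnsq mu h = 1, a8 R - e <= l8 h &
    a8 R / strichartz_const R <= osc2 mu (fun=> 0) (cut (fun k : R => `|k| < 1) h)].
Proof.
move=> A0 e0.
have e1 : 0 < Num.min e (a8 R / 2) by rewrite lt_min e0 divr_gt0.
have hs : has_sup (@unit_l8 R) by split; [exact: unit_l8_neq0|exact: unit_l8_ub].
have [_ [g [gg gc g1] <-] gl] := sup_adherent e1 hs.
rewrite -/(a8 R) in gl.
have me : Num.min e (a8 R / 2) <= e by rewrite ge_min lexx.
have ma : Num.min e (a8 R / 2) <= a8 R / 2 by rewrite ge_min lexx orbT.
have S0 := strichartz_const_gt0 R.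
pose M := a8 R / strichartz_const R; have M0 : 0 < M by rewrite divr_gt0.
have [[N [y [N0 Ny]]]|no] := pselect (exists N y, 0 < N /\
    M * N < osc2 mu (phase1 y) (cut (fun k : R => `|k| < N) g)).
  have [h [hq hc hn hl ho]] := concentrate y N0 gg gc.
  exists h; split; [exact: hq|exact: hc|by rewrite hn g1| |].
    by rewrite hl; apply: ltW; apply: le_lt_trans gl; rewrite lerD2l lerN2.
  by rewrite ho (ler_pdivlMr _ _ N0) (ltW Ny).
have hM N y : 0 < N -> osc2 mu (phase1 y) (cut (fun k : R => `|k| < N) g) <= M * N.
  by move=> N0; rewrite leNgt; apply/negP => lt1; apply: no; exists N, y.
have [K gK] := gc.
have g1' : cnsq mu g <= 1 by rewrite g1.
have le1 := refined_strichartz gg gK M0 hM ltr01 g1'.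
have le2 : l8 g <= a8 R / 4.
  by rewrite -lee_fin -(l8E gg gc) -(quarter_const (a8 R)).
have le3 : a8 R / 2 < l8 g.
  by apply: le_lt_trans gl; rewrite lerBrDl -lerBrDr; apply: (le_trans ma); rewrite lerBrDl -splitr.
have := lt_le_trans le3 le2; rewrite ltr_pM2l// ltf_pV2 ?posrE// ltr_nat.
by [].
Qed.

Theorem extremal_profile : exists h, [/\ csq mu h, cnsq mu h = 1 &
  forall n_ : nat -> nat,
    (forall j, (j <= n_ j)%N /\ cnsq mu (tail (n_ j) h) <= 16^-1 ^+ j / 16) ->
    \int[mu2]_y (c2 (ext h n_ y) ^+ 4) = a8 R].
Proof.
have := a8_ge0 R; rewrite le_eqVlt => /orP[/eqP A0|A0].
  have [_ [h [hh hc h1] _]] := unit_l8_neq0 R.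
  exists h; split => // n_ hN; have [_] := ext8 hh hN.
  rewrite -A0 mul0r => le0; apply/eqP; rewrite eq_le le0/=.
  by apply: Rintegral_ge0 => y _; rewrite exprn_ge0// c2_ge0.
have e0 n : 0 < n.+1%:R^-1 :> R by rewrite invr_gt0.
pose h_ n := projT1 (cid (concentrated_maximizer A0 (e0 n))).
have hP n : [/\ csq mu (h_ n), cpt (h_ n), cnsq mu (h_ n) = 1, a8 R - n.+1%:R^-1 <= l8 (h_ n) &
    a8 R / strichartz_const R <= osc2 mu (fun=> 0) (cut (fun k : R => `|k| < 1) (h_ n))].
  exact: (projT2 (cid (concentrated_maximizer A0 (e0 n)))).
have [U [UU Uoo]] := @ultraFilterLemma _ (nbhs (\oo : set_system nat)) _.
have hq n : csq mu (h_ n) by case: (hP n).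
have hc n : cpt (h_ n) by case: (hP n).
have h1 n : cnsq mu (h_ n) = 1 by case: (hP n).
have PU : ProperFilter U by exact: ultra_proper.
have n1 n : nsq mu (fun k => Rep (h_ n k)) <= 1 /\ nsq mu (fun k => Imp (h_ n k)) <= 1.
  have := h1 n; rewrite /cnsq.
  have := nsq_ge0 mu (fun k => Rep (h_ n k)); have := nsq_ge0 mu (fun k => Imp (h_ n k)); lra.
have [a sa wa] := @weak_limit _ (measurableTypeR R) R mu U UU (fun n k => Rep (h_ n k)) 1
   (fun n => (hq n).1) (fun n => (n1 n).1).
have [b sb wb] := @weak_limit _ (measurableTypeR R) R mu U UU (fun n k => Imp (h_ n k)) 1
   (fun n => (hq n).2) (fun n => (n1 n).2).
pose h k : R[i] := Complex (a k) (b k).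
have hh : csq mu h by split.
have hw g : csq mu g -> (fun n => cip mu (h_ n) g) @ U --> cip mu h g.
  by move=> [g1 g2]; apply: cvgD; [exact: wa|exact: wb].
have c1 := cnsq_weak_le UU hq h1 hh hw.
have mz : measurable_fun setT (fun _ : R => 0 : R) by exact: measurable_cst.
have mV : (mu [set k : R | (`|k| < 1)%R] <= (2 * 1)%:E)%E by rewrite measure_lt_norm.
have [wo _] := osc2_weak_cvg UU hq hh hw (measurable_lt_norm 1) mV mz.
have S0 := strichartz_const_gt0 R.
have c0 : 0 < cnsq mu h.
  have b0 : 0 < a8 R / strichartz_const R by rewrite divr_gt0.
  have b1 : a8 R / strichartz_const R <= osc2 mu (fun=> 0) (cut (fun k : R => `|k| < 1) h).
    rewrite leNgt; apply/negP => lt1.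
    have d0 : 0 < a8 R / strichartz_const R - osc2 mu (fun=> 0) (cut (fun k : R => `|k| < 1) h) by rewrite subr_gt0.
    have /cvgrPdist_lt/(_ _ d0)/filter_ex[n] := wo.
    have [_ _ _ _ ge1] := hP n.
    by rewrite distrC ltr_norml => /andP[_]; rewrite ltrD2r ltNge ge1.
  have b2 := @osc2_cut_le _ _ _ mu _ _ _ _ (measurable_lt_norm 1) mV hh mz.
  have := lt_le_trans b0 (le_trans b1 b2).
  by rewrite pmulr_rgt0// mulr_gt0.
have [n_ hN] := fast_tail hh.
have [iu ule] := ext8 hh hN.
have dc := cnsq_diff_cvg UU hq h1 hh hw.
have key m_ : (forall j, (j <= m_ j)%N /\ cnsq mu (tail (m_ j) h) <= 16^-1 ^+ j / 16) ->
    a8 R <= \int[mu2]_y (c2 (ext h m_ y) ^+ 4) + a8 R * (1 - cnsq mu h) ^+ 4.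
  move=> mN; set I := \int[mu2]_y (c2 (ext h m_ y) ^+ 4).
  apply/ler_addgt0Pr => e ee; have e2 : 0 < e / 3 by rewrite divr_gt0.
  have c4 : (fun n => a8 R * cnsq mu (fun k => h_ n k - h k) ^+ 4) @ U --> a8 R * (1 - cnsq mu h) ^+ 4.
    by apply: cvgM; [exact: cvg_cst|exact: cvg_exprn].
  have bl := brezis_lieb UU hq hc h1 hh hw mN e2.
  have /cvgrPdist_le/(_ _ e2) near4 := c4.
  have nearn : \forall n \near U, n.+1%:R^-1 <= e / 3.
    apply: Uoo; have /cvgrPdist_le/(_ _ e2) := @cvg_harmonic R.
    by apply: filterS => n; rewrite sub0r normrN; exact: le_trans (ler_norm _).
  have [n [[b4 d4] l4]] := filter_ex (filterI (filterI bl near4) nearn).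
  have [_ _ _ lo _] := hP n.
  move: d4; rewrite ler_norml => /andP[d4 _].
  exact: three_eps lo b4 d4 l4.
have ha : cnsq mu h = 1.
  apply: quartic_split => //.
  rewrite -(ler_pM2l A0) mulr1 mulrDr; apply: (le_trans (key _ hN)).
  by rewrite lerD2r.
exists h; split => // m_ mN; have [_ mle] := ext8 hh mN.
rewrite ha expr1n mulr1 in mle; apply/eqP; rewrite eq_le mle/=.
by have := key _ mN; rewrite ha subrr expr0n mulr0 addr0.
Qed.

End existence.

Section airy_norms.
Context (R : realType).
Local Notation mu := (@lebesgue_measure R).
Local Notation mu2 := (prodm mu mu).
Implicit Types (f g h : R -> R[i]).

Lemma normc_sqr (z : R[i]) : Normc.normc z ^+ 2 = c2 z.
Proof. by case: z => a b; rewrite /Normc.normc sqr_sqrtr// addr_ge0 ?sqr_ge0. Qed.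

Lemma normc_ge0 (z : R[i]) : 0 <= Normc.normc z.
Proof. by case: z => a b; exact: sqrtr_ge0. Qed.

Lemma normc_poweR (z : R[i]) n : ((`|(Normc.normc z)%:E| `^ n%:R)%E = (Normc.normc z ^+ n)%:E).
Proof.
rewrite gee0_abs ?lee_fin ?normc_ge0// poweR_EFin powR_mulrn//; exact: normc_ge0.
Qed.

Lemma L2normE f : L2norm f = ((\int[mu]_x (c2 (f x))%:E) `^ 2^-1)%E.
Proof.
rewrite /L2norm /cLnorm unlock; congr (_ `^ _)%E; apply: eq_integral => x _.
by rewrite (normc_poweR _ 2) normc_sqr.
Qed.

Lemma L8normE (u : R * R -> R[i]) : L8norm u = ((\int[mu2]_y (c2 (u y) ^+ 4)%:E) `^ 8^-1)%E.
Proof.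
rewrite /L8norm /cLnorm unlock; congr (_ `^ _)%E; apply: eq_integral => x _.
by rewrite (normc_poweR _ 8) (exprM _ 2 4) normc_sqr.
Qed.

Lemma memL2P f : memL2 f <-> csq mu f.
Proof.
split=> [[[m1 m2]]|hf].
  rewrite L2normE => /lty_poweRy h; apply: csqP => //; apply: h.
  by rewrite invr_eq0 pnatr_eq0.
split; first exact: csq_meas hf.
by rewrite L2normE cnsqE//; apply: poweR_lty; exact: ltry.
Qed.

Lemma L2norm_csq f : csq mu f -> L2norm f = (Num.sqrt (cnsq mu f))%:E.
Proof. by move=> hf; rewrite L2normE cnsqE// poweR_EFin powR12_sqrt// cnsq_ge0. Qed.

Lemma L2_limitP (F : nat -> R -> R[i]) g : (forall n, csq mu (F n)) ->
  L2_limit F g <-> csq mu g /\ (fun n => cnsq mu (fun x => F n x - g x)) @ \oo --> (0 : R).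
Proof.
move=> hF; have E : csq mu g -> (fun n => L2norm (fun x => F n x - g x)) =
    EFin \o (fun n => Num.sqrt (cnsq mu (fun x => F n x - g x))).
  by move=> hg; apply/funext => n /=; exact: L2norm_csq (csqB (hF n) hg).
rewrite /L2_limit; split=> [[/memL2P hg]|[hg c0]]; rewrite (E hg).
  move=> /fine_cvg /= c0; split=> //.
  have := @cvg_exprn R nat \oo _ _ _ 2 c0 => /(_ _); rewrite expr0n /=.
  by under [X in X @ _ --> _]eq_fun do rewrite sqr_sqrtr ?cnsq_ge0//.
split; first exact/memL2P.
apply: cvg_EFin; first exact: nearW.
by rewrite -[X in _ --> X](@sqrtr0 R); apply: (cvg_comp _ _ c0); exact: sqrt_continuous.
Qed.

Lemma L2_limit_unique (F : nat -> R -> R[i]) g g' : (forall n, csq mu (F n)) -> csq mu g -> csq mu g' ->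
  (fun n => cnsq mu (fun x => F n x - g x)) @ \oo --> (0 : R) ->
  (fun n => cnsq mu (fun x => F n x - g' x)) @ \oo --> (0 : R) ->
  cnsq mu (fun x => g x - g' x) = 0.
Proof.
move=> hF hg hg' c1 c2'; apply/eqP; rewrite eq_le cnsq_ge0 andbT.
have c3 : (fun n => 2 * cnsq mu (fun x => F n x - g' x) + 2 * cnsq mu (fun x => F n x - g x)) @ \oo --> (0 : R).
  have -> : (0 : R) = 2 * 0 + 2 * 0 by rewrite mulr0 addr0.
  by apply: cvgD; apply: cvgM => //; exact: cvg_cst.
apply: (ler_cvg_to (cvg_cst _) c3); apply: nearW => n.
have -> : (fun x => g x - g' x) = fun x => (F n x - g' x) - (F n x - g x).
  by apply/funext => x; ring.
exact: (cnsqB_le (csqB (hF n) hg') (csqB (hF n) hg)).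
Qed.

Local Notation s := ((Num.sqrt (2 * pi : R))^-1).

Lemma truncated_oscE (phase : R -> R -> R) f n y :
  truncated_osc_integral phase f n y = s%:C%C * oscC mu (phase y) (trunc n f).
Proof.
rewrite /truncated_osc_integral; congr (_ * _); rewrite /cintegral /oscC.
have P k : (k \in `[- n%:R, n%:R]%classic) = (`|k| <= n%:R :> R).
  by apply/idP/idP => [/set_mem|kn]; [|apply/mem_set]; rewrite /= in_itv/= -ler_norml.
by congr Complex; rewrite Rintegral_mkcond; apply: eq_Rint => k;
  rewrite patchE P /trunc /cut; case: ifP => _ /=; rewrite ?ReM ?ImM /= ?mulr0 ?subrr ?addr0//.
Qed.

Definition airy_of h (u : R * R -> R[i]) : Prop :=
  cmeasurable_fun (T := (measurableTypeR R * measurableTypeR R)%type) u /\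
  forall t : R, L2_limit (truncated_osc_integral (fun x k => x * k + t * k ^+ 3) h) (fun x => u (t, x)).

Lemma airy_truncE h t n : truncated_osc_integral (fun x k => x * k + t * k ^+ 3) h n =
  fun x => s%:C%C * evo (trunc n h) (t, x).
Proof. by apply/funext => x; rewrite truncated_oscE. Qed.

Lemma csq_evo_slice h t n : csq mu h -> csq mu (fun x => evo (trunc n h) (t, x)).
Proof.
move=> hh; have mt : measurable_fun setT (fun k : R => t * k ^+ 3) by apply: measurable_funM => //; exact: measurable_funX.
have hm : csq mu (modul (fun k : R => t * k ^+ 3) h) by exact: csq_modul.
have -> : (fun x => evo (trunc n h) (t, x)) = four (trunc n (modul (fun k : R => t * k ^+ 3) h)).
  by apply/funext => x; rewrite /four /trunc cut_modul -oscC_modul.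
exact: csq_four (cint_trunc n hm) (csq_trunc n hm).
Qed.

Lemma airy_slicesP h u t : csq mu h ->
  L2_limit (truncated_osc_integral (fun x k => x * k + t * k ^+ 3) h) (fun x => u (t, x)) <->
  csq mu (fun x => u (t, x)) /\
  (fun n => cnsq mu (fun x => s%:C%C * evo (trunc n h) (t, x) - u (t, x))) @ \oo --> (0 : R).
Proof.
move=> hh.
have -> : truncated_osc_integral (fun x k => x * k + t * k ^+ 3) h =
    fun n x => s%:C%C * evo (trunc n h) (t, x).
  by apply/funext => n; exact: airy_truncE.
by apply: L2_limitP => n; exact: csqZ (csq_evo_slice t n hh).
Qed.

Lemma airy_of_ext h n_ : csq mu h ->
  (forall j, (j <= n_ j)%N /\ cnsq mu (tail (n_ j) h) <= 16^-1 ^+ j / 16) ->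
  airy_of h (fun y => s%:C%C * ext h n_ y).
Proof.
move=> hh hN; have [mr mi] := measurable_ext n_ hh; split.
  split; under eq_fun do rewrite ?ReZ ?ImZ.
    exact: measurable_funM (measurable_cst _) mr.
  exact: measurable_funM (measurable_cst _) mi.
move=> t; have [c1 c2'] := ext_slice hh hN t.
apply/(airy_slicesP (fun y => s%:C%C * ext h n_ y) t hh); split; first exact: csqZ.
have -> : (fun n => cnsq mu (fun x => s%:C%C * evo (trunc n h) (t, x) - s%:C%C * ext h n_ (t, x))) =
    fun n => s ^+ 2 * cnsq mu (fun x => evo (trunc n h) (t, x) - ext h n_ (t, x)).
  apply/funext => n; rewrite -cnsqZ; last exact: csqB (csq_evo_slice t n hh) c1.
  by congr cnsq; apply/funext => x; rewrite mulrBr.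
by rewrite -(mulr0 (s ^+ 2)); apply: cvgM => //; exact: cvg_cst.
Qed.

Lemma L8norm_slices (u v : R * R -> R[i]) :
  cmeasurable_fun (T := (measurableTypeR R * measurableTypeR R)%type) u ->
  cmeasurable_fun (T := (measurableTypeR R * measurableTypeR R)%type) v ->
  (forall t, csq mu (fun x => u (t, x)) /\ csq mu (fun x => v (t, x))) ->
  (forall t, cnsq mu (fun x => u (t, x) - v (t, x)) = 0) -> L8norm u = L8norm v.
Proof.
move=> [ur ui] [vr vi] sq e; rewrite !L8normE; congr (_ `^ _)%E.
have md : measurable_fun setT (fun y => c2 (u y - v y)) by exact: measurable_c2B.
have z : (\int[mu2]_y (c2 (u y - v y))%:E = 0)%E.
  rewrite (@fubini_tonelli1 _ _ _ _ _ mu mu (fun y => (c2 (u y - v y))%:E)); first last.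
  - by move=> y; rewrite lee_fin c2_ge0.
  - exact/measurable_EFinP.
  rewrite integral0_eq// => t _; rewrite /fubini_F/=.
  by have [su sv] := sq t; rewrite (cnsqE (csqB su sv)) e.
apply: (@ge0_ae_eq_integral _ _ _ mu2) => //.
- by apply/measurable_EFinP; apply: measurable_funX; exact: measurable_c2.
- by apply/measurable_EFinP; apply: measurable_funX; exact: measurable_c2.
- by move=> y _; rewrite lee_fin exprn_ge0// c2_ge0.
- by move=> y _; rewrite lee_fin exprn_ge0// c2_ge0.
have [+ _] := @ae_eq_integral_abs _ _ _ mu2 setT measurableT (fun y => (c2 (u y - v y))%:E) (proj2 (measurable_EFinP _ _) md).
have -> : (\int[mu2]_(x in setT) `|(c2 (u x - v x))%:E| = 0)%E.
  by rewrite -[RHS]z; apply: eq_integral => y _; rewrite gee0_abs// lee_fin c2_ge0.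
move=> /(_ erefl) ae0; apply: (@filterS _ _ (ae_filter_ringOfSetsType mu2)) ae0.
by move=> y /(_ Logic.I) [] /c2_eq0 /subr0_eq -> _.
Qed.

Lemma L8norm_airy_of h n_ u : csq mu h ->
  (forall j, (j <= n_ j)%N /\ cnsq mu (tail (n_ j) h) <= 16^-1 ^+ j / 16) ->
  airy_of h u ->
  L8norm u = ((s ^+ 8 * \int[mu2]_y (c2 (ext h n_ y) ^+ 4))%:E `^ 8^-1)%E.
Proof.
move=> hh hN hu; have he := airy_of_ext hh hN.
have L t := proj1 (airy_slicesP u t hh) (proj2 hu t).
have L' t := proj1 (airy_slicesP _ t hh) (proj2 he t).
rewrite (@L8norm_slices u (fun y => s%:C%C * ext h n_ y) (proj1 hu) (proj1 he)); first last.
- move=> t; apply: (@L2_limit_unique (fun n x => s%:C%C * evo (trunc n h) (t, x))).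
  + by move=> n; exact: csqZ (csq_evo_slice t n hh).
  + exact: proj1 (L t).
  + exact: proj1 (L' t).
  + exact: proj2 (L t).
  + exact: proj2 (L' t).
- by move=> t; split; [exact: proj1 (L t)|exact: proj1 (L' t)].
rewrite L8normE; congr (_ `^ _)%E.
have [ri _] := ext8 hh hN.
rewrite -RintZ// -rint_EFin; last exact: rintZ.
by apply: eq_integral => y _; rewrite c2Z exprMn -exprM.
Qed.

Lemma trunc_null h h' th n : csq mu h -> csq mu h' -> cnsq mu (fun k => h k - h' k) = 0 ->
  measurable_fun setT th -> oscC mu th (trunc n h) = oscC mu th (trunc n h').
Proof.
move=> hh hh' e mth.
have b : (mu [set k : R | (`|k| <= n%:R)%R] <= (2 * n%:R)%:E)%E.
  by rewrite measure_seg.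
have := @osc2_cut_le _ _ _ mu _ th _ _ (measurable_norm_le n) b (csqB hh hh') mth.
rewrite e mulr0 => le0.
have : osc2 mu th (cut (fun k => `|k| <= n%:R) (fun k => h k - h' k)) = 0.
  by apply/eqP; rewrite eq_le le0 addr_ge0// sqr_ge0.
have -> : cut (fun k => `|k| <= n%:R) (fun k => h k - h' k) = fun k => trunc n h k - trunc n h' k.
  by apply/funext => k; rewrite /trunc /cut; case: ifP; rewrite ?subr0.
rewrite /osc2 (@oscRB _ _ _ mu _ _ _ mth (cint_trunc n hh) (cint_trunc n hh')).
rewrite (@oscIB _ _ _ mu _ _ _ mth (cint_trunc n hh) (cint_trunc n hh')).
move=> /eqP; rewrite paddr_eq0 ?sqr_ge0// !sqrf_eq0 !subr_eq0 => /andP[/eqP e1 /eqP e2].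
by rewrite /oscC e1 e2.
Qed.

Lemma airy_of_null h h' u : csq mu h -> csq mu h' -> cnsq mu (fun k => h k - h' k) = 0 ->
  airy_of h' u -> airy_of h u.
Proof.
move=> hh hh' e [mu_ hu]; split=> // t.
have -> : truncated_osc_integral (fun x k => x * k + t * k ^+ 3) h =
    truncated_osc_integral (fun x k => x * k + t * k ^+ 3) h'.
  apply/funext => n; apply/funext => x; rewrite !truncated_oscE; congr (_ * _).
  by apply: trunc_null => //; exact: (measurable_phase1r (t, x)).
exact: hu.
Qed.

Lemma fourier_truncE f n : truncated_osc_integral (fun k x => - (x * k)) f n =
  fun k => s%:C%C * four (trunc n f) (- k).
Proof.
apply/funext => k; rewrite truncated_oscE; congr (_ * _); rewrite /four.
by congr oscC; apply/funext => x; rewrite mulNr mulrC.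
Qed.

Lemma csq_fourier_trunc f n : csq mu f -> csq mu (fun k => s%:C%C * four (trunc n f) (- k)).
Proof.
move=> hf; apply: csqZ.
exact: proj1 (csq_opp (csq_four (cint_trunc n hf) (csq_trunc n hf))).
Qed.

Lemma is_fourierP f h : csq mu f -> is_fourier f h <->
  csq mu h /\ (fun n => cnsq mu (fun k => s%:C%C * four (trunc n f) (- k) - h k)) @ \oo --> (0 : R).
Proof.
move=> hf; rewrite /is_fourier.
have -> : truncated_osc_integral (fun k x => - (x * k)) f = fun n k => s%:C%C * four (trunc n f) (- k).
  by apply/funext => n; exact: fourier_truncE.
by apply: L2_limitP => n; exact: csq_fourier_trunc.
Qed.

Lemma s2pi : s ^+ 2 * (2 * pi) = 1.
Proof.
have p0 : 0 < 2 * pi :> R by rewrite mulr_gt0// pi_gt0.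
by rewrite exprVn sqr_sqrtr ?ltW// mulVf// gt_eqF.
Qed.

Lemma is_fourier_le f h : csq mu f -> is_fourier f h -> csq mu h /\ cnsq mu h <= cnsq mu f.
Proof.
move=> hf /(is_fourierP h hf) [hh lim]; split=> //.
have [lc _] := cnsq_cvg (fun n => csq_fourier_trunc n hf) hh lim.
apply: (ler_cvg_to lc (cvg_cst _)); apply: nearW => n.
have fq := csq_four (cint_trunc n hf) (csq_trunc n hf).
have [oq oe] := csq_opp fq.
rewrite (cnsqZ s oq) oe; apply: (@le_trans _ _ (s ^+ 2 * (2 * pi * cnsq mu (trunc n f)))).
  by apply: ler_wpM2l; [exact: sqr_ge0|exact: cnsq_four_le (cint_trunc n hf) (csq_trunc n hf)].
rewrite mulrA s2pi mul1r (cnsq_trunc_tail n hf) lerDl; exact: cnsq_ge0.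
Qed.

Lemma is_fourier_unique f h h' : csq mu f -> is_fourier f h -> is_fourier f h' ->
  cnsq mu (fun k => h k - h' k) = 0.
Proof.
move=> hf /(is_fourierP h hf) [hh l] /(is_fourierP h' hf) [hh' l'].
by apply: (L2_limit_unique (fun n => csq_fourier_trunc n hf)).
Qed.

Lemma fourier_le f : csq mu f -> csq mu (fourier f) /\ cnsq mu (fourier f) <= cnsq mu f.
Proof.
move=> hf; have [ex|nex] := pselect (exists h, is_fourier f h).
  exact: is_fourier_le (xgetPex _ ex).
have -> : fourier f = fun=> 0.
  by apply: xgetPN => h hP; apply: nex; exists h.
have c0 : csq mu (fun=> 0 : R[i]) by split; exact: sqint0.
split=> //; suff -> : cnsq mu (fun=> 0 : R[i]) = 0 by exact: cnsq_ge0.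
by apply: EFin_inj; rewrite -cnsqE// integral0_eq// => x _; rewrite c2_0.
Qed.

Lemma L8norm_airy f n_ : csq mu (fourier f) ->
  (forall j, (j <= n_ j)%N /\ cnsq mu (tail (n_ j) (fourier f)) <= 16^-1 ^+ j / 16) ->
  L8norm (airy f) = ((s ^+ 8 * \int[mu2]_y (c2 (ext (fourier f) n_ y) ^+ 4))%:E `^ 8^-1)%E.
Proof.
move=> hh hN; apply: (L8norm_airy_of hh hN).
by apply: (@xgetPex _ _ [set u | is_airy_evolution f u]); eexists; exact: airy_of_ext hh hN.
Qed.

Lemma L8norm_airy_le f : csq mu f -> cnsq mu f = 1 ->
  (L8norm (airy f) <= (s ^+ 8 * a8 R)%:E `^ 8^-1)%E.
Proof.
move=> hf f1; have [hh le1] := fourier_le hf; rewrite f1 in le1.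
have [n_ hN] := fast_tail hh; rewrite (L8norm_airy hh hN).
have [_ le8] := ext8 hh hN.
have s8 : 0 <= s ^+ 8 by rewrite exprn_ge0// invr_ge0 sqrtr_ge0.
have i0 : 0 <= \int[mu2]_y (c2 (ext (fourier f) n_ y) ^+ 4).
  by apply: Rintegral_ge0 => y _; rewrite exprn_ge0// c2_ge0.
have le8' : \int[mu2]_y (c2 (ext (fourier f) n_ y) ^+ 4) <= a8 R.
  apply: (le_trans le8); rewrite ler_piMr ?a8_ge0// exprn_ile1//; exact: cnsq_ge0.
apply: gt0_ler_poweR; first by rewrite invr_ge0.
- by rewrite in_itv/= leey lee_fin mulr_ge0.
- by rewrite in_itv/= leey lee_fin mulr_ge0// a8_ge0.
by rewrite lee_fin ler_wpM2l.
Qed.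

Lemma extremiser_exists : exists f, [/\ csq mu f, cnsq mu f = 1 &
  L8norm (airy f) = ((s ^+ 8 * a8 R)%:E `^ 8^-1)%E].
Proof.
have [h [hh h1 hE]] := extremal_profile R.
have [f [hf fh lim]] := fourier_onto hh.
have Ff : is_fourier f h by apply/(is_fourierP h hf).
have F2 : is_fourier f (fourier f) by apply: (@xgetPex _ _ [set g | is_fourier f g]); exists h.
have [hq _] := fourier_le hf.
have [n_ hN] := fast_tail hh.
exists f; split; [by []|by rewrite fh|].
rewrite -(hE n_ hN); apply: (L8norm_airy_of hh hN).
apply: (airy_of_null hh hq); first exact: is_fourier_unique hf Ff F2.
have [m_ hM] := fast_tail hq.
by apply: (@xgetPex _ _ [set u | is_airy_evolution f u]); eexists; exact: airy_of_ext hq hM.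
Qed.

Lemma L2norm1 f : csq mu f -> L2norm f = 1%E <-> cnsq mu f = 1.
Proof.
move=> hf; rewrite (L2norm_csq hf); split=> [[e]|->]; last by rewrite sqrtr1.
by rewrite -(sqr_sqrtr (cnsq_ge0 mu f)) e expr1n.
Qed.

Lemma airy_constE : airy_const R = ((s ^+ 8 * a8 R)%:E `^ 8^-1)%E.
Proof.
apply/eqP; rewrite eq_le; apply/andP; split.
  apply: ge_ereal_sup => _ [g [/memL2P hg /(L2norm1 hg) g1] <-].
  exact: L8norm_airy_le.
have [f [hf f1 <-]] := extremiser_exists.
apply: ereal_sup_ubound; exists f => //; split; first exact/memL2P.
exact/(L2norm1 hf).
Qed.

End airy_norms.

Theorem theorem1p2 (R : realType) :
  exists f : R -> complex R,
    [/\ memL2 f,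
        ~ {ae @lebesgue_measure R, forall x, f x = 0%R} &
        L8norm (airy f) = (airy_const R * L2norm f)%E].
Proof.
have [f [hf f1 fE]] := extremiser_exists R.
exists f; split.
- exact/memL2P.
- move=> ae0; have : (\int[@lebesgue_measure R]_x (c2 (f x))%:E = \int[@lebesgue_measure R]_x (cst 0 x))%E.
    apply: ge0_ae_eq_integral => //.
    + by apply/measurable_EFinP; exact: rint_meas (rint_c2 hf).
    + by move=> x _; rewrite lee_fin c2_ge0.
    by apply: (@filterS _ _ (ae_filter_ringOfSetsType (@lebesgue_measure R))) ae0 => x -> _; rewrite c2_0.
  by rewrite cnsqE// f1 integral0 => -[] /eqP; rewrite oner_eq0.
by rewrite (proj2 (L2norm1 hf) f1) mule1 fE airy_constE.
Qed.
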